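(* Let $d\ge2$, let $\tau_1,\ldots,\tau_d>0$, and let $\kappa\in\mathbb R$ satisfy $\kappa\ge-\min(\tau_1^2,\ldots,\tau_d^2)$. Put $P:=\operatorname{conv}(0,e_1/\tau_1,\ldots,e_d/\tau_d)$, where $e_1,\ldots,e_d$ is the standard basis of $\mathbb R^d$. Then $P\subseteq\bar{\mathbb B}^d(\kappa)$. (i) For $k\in\{0,\ldots,d-1\}$, let $F=\operatorname{conv}(0,e_1/\tau_1,\ldots,e_k/\tau_k)$, and let $x\in\operatorname{relint}(F)\cap\mathbb B^d(\kappa)$. Then: (a) $N_x(F,P)$ is isometric to a $(d-k)$-dimensional orthant. (b) The external angle at $F$ is $\alpha_x(N_x(F,P))=1/2^{d-k}$. (c) $T_x(F,P)$ is isometric to the direct orthogonal sum of $\mathbb R^k$ and a $(d-k)$-dimensional orthant. (d) The internal angle at $F$ is $\alpha_x(T_x(F,P))=1/2^{d-k}$. (ii) For $k\in\{0,\ldots,d-1\}$, let $G=\operatorname{conv}(e_1/\tau_1,\ldots,e_{k+1}/\tau_{k+1})$, and let $x\in\operatorname{relint}(G)\cap\mathbb B^d(\kappa)$. Then: (a) $N_x(G,P)$ is isometric to a cone $\operatorname{pos}(w_0,w_{k+2},\ldots,w_d)\subseteq\mathbb R^d$ generated by vectors with $$\langle w_0,w_0\rangle=\kappa+\tau_1^2+\cdots+\tau_d^2,\qquad\langle w_0,w_j\rangle=-\tau_j,\qquad\langle w_i,w_j\rangle=\delta_{ij}\qquad(i,j\in\{k+2,\ldots,d\}).$$ (b) The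 external angle at $G$ is $$\alpha_x(N_x(G,P))=\frac1{\sqrt{2\pi}}\int_0^\infty\prod_{j=k+2}^d\Phi\left(\frac{\tau_j}{\sqrt{\kappa+\tau_1^2+\cdots+\tau_{k+1}^2}}\,y\right)e^{-y^2/2}\,dy.$$ (c) $T_x(G,P)$ is isometric to the direct orthogonal sum of $\mathbb R^k$ and a cone $\operatorname{pos}(v_0,v_{k+2},\ldots,v_d)\subseteq\mathbb R^d$ generated by vectors with $$\langle v_0,v_0\rangle=1,\qquad\langle v_0,v_j\rangle=\tau_j,\qquad\langle v_i,v_j\rangle=\tau_i\tau_j+\delta_{ij}\bigl(\kappa+\tau_1^2+\cdots+\tau_{k+1}^2\bigr)\qquad(i,j\in\{k+2,\ldots,d\}).$$ (d) The internal angle at $G$ is $$\alpha_x(T_x(G,P))=\frac1{2^{d-k}}+\frac1\pi\int_0^\infty\frac{e^{-(\kappa+\tau_1^2+\cdots+\tau_d^2)y^2/2}}{y}\operatorname{Im}\left(\prod_{j=k+2}^d\Phi(-\mathrm i\tau_jy)\right)dy.$$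
   Context: Klein model. $\mathbb B^d(\kappa):=\mathbb R^d$ if $\kappa\ge0$ and $\mathbb B^d(\kappa):=\{x\in\mathbb R^d:\|x\|<1/\sqrt{-\kappa}\}$ if $\kappa<0$; $\bar{\mathbb B}^d(\kappa)$ is its Euclidean closure. The tangent space at $x\in\mathbb B^d(\kappa)$ is identified with $\mathbb R^d$ and carries the inner product $$g_x(u,v)=\frac{\langle u,v\rangle}{1+\kappa\|x\|^2}-\frac{\kappa\langle x,u\rangle\langle x,v\rangle}{(1+\kappa\|x\|^2)^2}.$$ Cones and angles. Let $P=\{y\in\mathbb R^d:\langle a_r,y\rangle\le b_r,\ r=1,\ldots,m\}\subseteq\bar{\mathbb B}^d(\kappa)$ be a full-dimensional polytope with irredundant inequalities ($a_r\neq 0$), $F\ne P$ a (nonempty) face, $I(F)=\{r:\langle a_r,y\rangle=b_r\ \forall y\in F\}$. For $x\in\operatorname{relint}(F)\cap\mathbb B^d(\kappa)$: $T_x(F,P)=\{u\in\mathbb R^d:\langle a_r,u\rangle\le0\ \forall r\in I(F)\}$ (tangent cone) and $N_x(F,P)=\{v\in\mathbb R^d: g_x(v,u)\le0\ \forall u\in T_x(F,P)\}$ (normal cone), both regarded as cones in $(\mathbb R^d,g_x)$. For a polyhedral cone $K$ in a finite-dimensional inner product space with linear hull $L$, its solid angle is the ratio of the $(\dim L)$-dimensional volumes of $K\cap B$ and $L\cap B$, $B$ the unit ball; $\alpha_x$ is the solid angle with respect to $g_x$. The internal and external angles at $F$ are $\alpha_x(T_x(F,P))$ and $\alpha_x(N_x(F,P))$.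 Two cones in inner product spaces are isometric if a linear isometry between their linear hulls maps one onto the other. $\operatorname{pos}$ denotes the set of nonnegative linear combinations; the $m$-dimensional orthant is $[0,\infty)^m$; empty products equal $1$. $\Phi$ is the entire function $\Phi(z)=\frac12+\frac1{\sqrt{2\pi}}\int_0^z e^{-t^2/2}\,dt$, and $\mathrm i=\sqrt{-1}$. *)

(* Defs.v *)
From HB Require Import structures.
From mathcomp Require Import all_boot all_order all_algebra.
From mathcomp Require Import complex.
From mathcomp Require Import all_classical all_reals all_analysis.

Set Implicit Arguments.
Unset Strict Implicit.
Unset Printing Implicit Defensive.

Import Order.TTheory GRing.Theory Num.Theory numFieldNormedType.Exports.

Local Open Scope classical_set_scope.
Local Open Scope ring_scope.
Local Open Scope complex_scope.

Section euclidean.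
Context {R : realType}.

Definition dotp n (u v : 'rV[R]_n) : R := \sum_i u 0 i * v 0 i.

Definition enorm n (u : 'rV[R]_n) : R := Num.sqrt (dotp u u).

(* Finite linear combinations of points of S whose coefficient family
   satisfies C. *)
Definition combinations (C : forall m, ('I_m -> R) -> Prop) n
    (S : set 'rV[R]_n) : set 'rV[R]_n :=
  [set y | exists m (c : 'I_m -> R) (p : 'I_m -> 'rV[R]_n),
    [/\ C m c, forall i, S (p i) & y = \sum_i c i *: p i]].

Definition lin_hull : forall n, set 'rV[R]_n -> set 'rV[R]_n :=
  combinations (fun _ _ => True).

Definition aff_hull : forall n, set 'rV[R]_n -> set 'rV[R]_n :=
  combinations (fun _ c => \sum_i c i = 1).

Definition pos_hull : forall n, set 'rV[R]_n -> set 'rV[R]_n :=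
  combinations (fun _ c => forall i, 0 <= c i).

Definition conv_hull : forall n, set 'rV[R]_n -> set 'rV[R]_n :=
  combinations (fun _ c => (forall i, 0 <= c i) /\ \sum_i c i = 1).

Definition relint n (A : set 'rV[R]_n) : set 'rV[R]_n :=
  [set x | A x /\ exists2 e : R, 0 < e &
    forall y, aff_hull A y -> enorm (y - x) < e -> A y].

Definition orthant n : set 'rV[R]_n := [set u | forall i, 0 <= u 0 i].

(* R^p and R^q sit in R^(p+q) as orthogonal complements. *)
Definition orth_sum p q (K1 : set 'rV[R]_p) (K2 : set 'rV[R]_q) :
    set 'rV[R]_(p + q) :=
  [set row_mx u v | u in K1 & v in K2].

(* n-dimensional Lebesgue measure on Borel sets: the n-fold product of
   lebesgue_measure, with the product measure unfolded as the integral of the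
   measures of the sections. *)
Fixpoint lebesgue_vol n : set (n.-tuple R) -> \bar R :=
  match n with
  | 0 => fun A => \d_([tuple] : 0.-tuple R) A
  | n'.+1 => fun A =>
      (\int[@lebesgue_measure R]_t lebesgue_vol [set v | A (cons_tuple (t : R) v)])%E
  end.

End euclidean.

Arguments dotp {R n} u v.
Arguments orthant {R} n _.

Section cones.
Context {R : realType}.

(* A linear isometry between the linear hulls is given as the restriction of a
   linear map f between the ambient spaces; every linear map between the hulls
   extends in this way. *)
Definition cone_isometric n n'
    (g : 'rV[R]_n -> 'rV[R]_n -> R) (K : set 'rV[R]_n)
    (g' : 'rV[R]_n' -> 'rV[R]_n' -> R) (K' : set 'rV[R]_n') : Prop :=
  exists f : {linear 'rV[R]_n -> 'rV[R]_n'},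
    [/\ forall u v, lin_hull K u -> lin_hull K v -> g' (f u) (f v) = g u v,
        f @` lin_hull K = lin_hull K'
      & f @` K = K'].

Section solid_angle.
Variables (n : nat) (g : 'rV[R]_n -> 'rV[R]_n -> R).

Definition is_orthonormal_basis (L : set 'rV[R]_n) m (b : 'M[R]_(m, n)) :
    Prop :=
  (forall i j, g (row i b) (row j b) = (i == j)%:R) /\
  lin_hull (range (fun i => row i b)) = L.

Definition vol_in_basis m (b : 'M[R]_(m, n)) (A : set 'rV[R]_n) : \bar R :=
  lebesgue_vol [set c : m.-tuple R | A (\sum_i tnth c i *: row i b)].

Definition unit_ball : set 'rV[R]_n := [set y | g y y <= 1].

(* The volume on the linear hull L of K is transported from R^(dim L) by an
   orthonormal basis of L, whose choice is immaterial. *)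
Definition solid_angle (K : set 'rV[R]_n) : R :=
  let L := lin_hull K in
  let b := xget (Tagged (fun m => 'M[R]_(m, n)) (0 : 'M[R]_(0, n)))
    [set b : {m : nat & 'M[R]_(m, n)} | is_orthonormal_basis L (tagged b)] in
  fine (vol_in_basis (tagged b) (K `&` unit_ball)) /
  fine (vol_in_basis (tagged b) (L `&` unit_ball)).

End solid_angle.
End cones.

Section klein.
Context {R : realType} {d : nat}.
Variable kappa : R.

Definition klein_ball : set 'rV[R]_d :=
  if 0 <= kappa then setT else [set x | enorm x < 1 / Num.sqrt (- kappa)].

Definition klein_form (x u v : 'rV[R]_d) : R :=
  dotp u v / (1 + kappa * enorm x ^+ 2)
  - kappa * dotp x u * dotp x v / (1 + kappa * enorm x ^+ 2) ^+ 2.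

Variables (m : nat) (a : 'I_m -> 'rV[R]_d) (b : 'I_m -> R).

(* P = {y | <a_r, y> <= b_r for all r}, and no inequality can be dropped. *)
Definition irredundant_hrep (P : set 'rV[R]_d) : Prop :=
  [/\ forall r, a r != 0,
      P = [set y | forall r, dotp (a r) y <= b r]
    & forall s, P != [set y | forall r, r != s -> dotp (a r) y <= b r]].

Definition active (F : set 'rV[R]_d) : set 'I_m :=
  [set r | forall y, F y -> dotp (a r) y = b r].

(* The cone at x is the same for all x in the relative interior of F. *)
Definition tangent_cone (F : set 'rV[R]_d) : set 'rV[R]_d :=
  [set u | forall r, active F r -> dotp (a r) u <= 0].

Definition normal_cone (x : 'rV[R]_d) (F : set 'rV[R]_d) : set 'rV[R]_d :=
  [set v | forall u, tangent_cone F u -> klein_form x v u <= 0].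

End klein.

Section Phi.
Context {R : realType}.
Implicit Types (z : R[i]) (x y t : R).

Definition expC z : R[i] :=
  (expR (complex.Re z))%:C * (cos (complex.Im z) +i* sin (complex.Im z)).

Definition cintegral (D : set R) (f : R -> R[i]) : R[i] :=
  (\int[lebesgue_measure]_(t in D) complex.Re (f t)) +i*
  (\int[lebesgue_measure]_(t in D) complex.Im (f t)).

(* The path integral from 0 to z is taken along the segment t |-> t z. *)
Definition Phi z : R[i] :=
  2^-1 + ((Num.sqrt (2 * pi))^-1)%:C *
    cintegral `[0, 1] (fun t => expC (- (t%:C * z) ^+ 2 / 2) * z).

Lemma Phi_real x : Phi x%:C =
  (2^-1 + (Num.sqrt (2 * pi))^-1 *
    \int[lebesgue_measure]_(t in `[0, 1]) (expR (- (t * x) ^+ 2 / 2) * x))%:C.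
Proof.
have cM (u v : R) : (u * v)%:C = u%:C * v%:C by exact: rmorphM.
have H t : expC (- (t%:C * x%:C) ^+ 2 / 2) * x%:C =
    (expR (- (t * x) ^+ 2 / 2) * x)%:C.
  have -> : - (t%:C * x%:C) ^+ 2 / 2 = (- (t * x) ^+ 2 / 2)%:C :> R[i].
    by rewrite cM rmorphN rmorphXn fmorphV rmorph_nat -cM.
  by rewrite /expC /= cos0 sin0 cM mulr1.
set I := \int[_]_(t in _) _; have E : cintegral `[0, 1]
      (fun t => expC (- (t%:C * x%:C) ^+ 2 / 2) * x%:C) = I%:C.
  rewrite /cintegral; congr (_ +i* _).
    by apply: eq_Rintegral => t _; rewrite H.
  rewrite (@eq_Rintegral _ _ _ _ _ (cst 0)); first by rewrite Rintegral_cst ?mul0r.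
  by move=> t _; rewrite H.
have -> : (2^-1 + (Num.sqrt (2 * pi))^-1 * I)%:C =
    (2^-1)%:C + ((Num.sqrt (2 * pi))^-1 * I)%:C :> R[i] by exact: rmorphD.
have -> : (2^-1)%:C = 2^-1 :> R[i] by rewrite fmorphV rmorph_nat.
by rewrite /Phi E cM.
Qed.

End Phi.

Definition vertex {R : realType} {d : nat} (tau : 'I_d -> R) (i : 'I_d) :
  'rV[R]_d := (tau i)^-1 *: delta_mx 0 i.

(* Main.v *)
(* The inner product g_x is the Euclidean one up to the explicit symmetric
   matrix sqrt q (1 + beta x^T x), with q = 1 + kappa |x|^2 and beta =
   kappa / (1 + sqrt q), so all cones can be computed in Euclidean coordinates.
   At a face through 0 the tangent cone is R^k times an orthant.  At a face G
   opposite to 0 a Householder reflection turns it into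
     {y | y_j >= 0 for j > k, sum_(j > k) tau_j y_j <= sqrt s_k y_0},
   whose polar cone is generated by w_0, w_(k+2), ..., w_d.

   A solid angle is a standard Gaussian measure, because the superlevel sets of
   the Gaussian density are balls.  Integrating out all coordinates but y_0
   turns the external angle into an integral of products of Phi.  For the
   internal angle, integrating out y_0 leaves the error function of
   K = sum_j tau_j y_j, which is represented by
     int_0^oo e^(-s y^2 / 2) sin (K y) / y dy;
   after exchanging the integrals, the inner one factors as the imaginary part
   of a product of
     int_0^oo e^(-z^2 / 2) e^(- i t z) dz = sqrt (2 pi) e^(-t^2 / 2) Phi (- i t). *)
Require Import Defs.
From HB Require Import structures.
From mathcomp Require Import all_boot all_order all_algebra.
From mathcomp Require Import complex ring lra.
From mathcomp Require Import all_classical all_reals all_analysis.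
From mathcomp Require Import measurable_realfun.

Set Implicit Arguments.
Unset Strict Implicit.
Unset Printing Implicit Defensive.

Import Order.TTheory GRing.Theory Num.Theory numFieldNormedType.Exports.

Local Open Scope classical_set_scope.
Local Open Scope ring_scope.

(** * Lebesgue and Gaussian measure on tuples *)

(** The solid angle is a quotient of volumes in an orthonormal basis that is merely chosen, and
    [lebesgue_vol] is a bare iterated integral. It is therefore identified with a product measure
    [tleb], whose invariance under orthogonal matrices comes from the linear change of variables, by
    Gaussian elimination. The factor between volume and Gaussian measure is the same for a cone and
    for its hull, so the volume of the unit ball is never computed.

    At a point x of a face the coordinates beyond the face vanish. Hence 1 + beta x^T x leaves these
    coordinates alone and the sign conditions of the tangent cone survive. At G only the constraint
    with normal (tau_1, ..., tau_d) has to be straightened, which is the purpose of the reflection.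

    Phi is given by integrals along segments, so the transforms of the Gaussian are computed by
    differentiating in a parameter and comparing values at 0. The sine integral makes the exchange
    of integrals an absolutely convergent Fubini problem. *)

Section tuple_lebesgue.
Context {R : realType}.
Local Notation T := (measurableTypeR R).
Local Notation leb := (@lebesgue_measure R).

Definition tcons n (p : T * n.-tuple T) : n.+1.-tuple T := cons_tuple p.1 p.2.

Lemma measurable_tcons n : measurable_fun setT (@tcons n).
Proof. exact: (measurable_cons measurable_fst measurable_snd). Qed.

Definition tuncons n (w : n.+1.-tuple T) : T * n.-tuple T :=
  (thead w, [tuple of behead w]).

Lemma measurable_tuncons n : measurable_fun setT (@tuncons n).
Proof.
by apply: measurable_fun_pair; [exact: measurable_tnth|exact: measurable_behead].
Qed.

Lemma tconsK n : cancel (@tcons n) (@tuncons n).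
Proof. by move=> [t v]; rewrite /tuncons theadE; congr pair; exact: val_inj. Qed.

Lemma tunconsK n : cancel (@tuncons n) (@tcons n).
Proof.
case/tupleP => t v; have -> : [tuple of t :: v] = tcons (t, v) by exact: val_inj.
by rewrite tconsK.
Qed.

Section tleb_succ.
Local Open Scope ereal_scope.
Variables (n : nat) (m : {sigma_finite_measure set (n.-tuple T) -> \bar R}).

Definition tleb_succ : set (n.+1.-tuple T) -> \bar R :=
  pushforward (leb \x m) (@tcons n).

Let pm : {measure set (n.+1.-tuple T) -> \bar R} :=
  measure_function_pushforward__canonical__measure_function_Measure
    (leb \x m) (@measurable_tcons n).

HB.instance Definition _ := Measure.copy tleb_succ pm.

Let tleb_succ_sigma_finite : sigma_finite setT tleb_succ.
Proof.
have /sigma_finiteP[F [TF ndF Foo]] := @sigma_finiteT _ _ _ leb.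
have /sigma_finiteP[G [TG ndG Goo]] := sigma_finiteT m.
exists (fun i => @tuncons n @^-1` (F i `*` G i)).
  apply/seteqP; split => // w _.
  have /= [i _ Fi] : (\bigcup_i F i) (thead w) by rewrite -TF.
  have /= [j _ Gj] : (\bigcup_i G i) [tuple of behead w] by rewrite -TG.
  (* Both exhaustions increase, so the larger index serves both factors. *)
  exists (maxn i j) => //=; split.
  - by move: (thead w) Fi; exact/subsetPset/ndF/leq_maxl.
  - by move: [tuple of behead w] Gj; exact/subsetPset/ndG/leq_maxr.
move=> k; have [mF Fk] := Foo k; have [mG Gk] := Goo k.
have mFG : measurable (F k `*` G k) by exact: measurableX.
split; first by rewrite -[X in measurable X]setTI; exact: measurable_tuncons.
rewrite /tleb_succ /pushforward -comp_preimage (_ : @tuncons n \o _ = id); last first.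
  by apply/funext => p; exact: tconsK.
by rewrite preimage_id product_measure1E// lte_mul_pinfty// ge0_fin_numE.
Qed.

HB.instance Definition _ := Measure_isSigmaFinite.Build _ _ _ tleb_succ
  tleb_succ_sigma_finite.
End tleb_succ.

(** The recursion of [lebesgue_vol], carrying along the sigma-finite measure structure that the next
    product measure and Fubini's theorem require. *)
Fixpoint tleb n : {sigma_finite_measure set (n.-tuple T) -> \bar R} :=
  match n with
  | 0 => \d_([tuple] : 0.-tuple T)
  | n'.+1 => tleb_succ (tleb n')
  end.

Lemma measurable_cons_tuple n (t : T) :
  measurable_fun setT (fun v : n.-tuple T => cons_tuple t v).
Proof. exact: (measurable_cons (@measurable_cst _ _ _ _ setT t)). Qed.

Lemma measurable_cons_tuple2 n (v : n.-tuple T) :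
  measurable_fun setT (fun t : T => cons_tuple t v).
Proof. exact: (measurable_cons _ (@measurable_cst _ _ _ _ setT v)). Qed.

Lemma measurable_tuple_xsection n (A : set (n.+1.-tuple T)) (t : T) :
  measurable A -> measurable [set v | A (cons_tuple t v)].
Proof.
by move=> mA; rewrite -[X in measurable X]setTI; exact: measurable_cons_tuple.
Qed.

Lemma measurable_tuple_ysection n (A : set (n.+1.-tuple T)) (v : n.-tuple T) :
  measurable A -> measurable [set t | A (cons_tuple t v)].
Proof.
by move=> mA; rewrite -[X in measurable X]setTI; exact: measurable_cons_tuple2.
Qed.

Lemma measurable_tcons_preimage n (A : set (n.+1.-tuple T)) :
  measurable A -> measurable (@tcons n @^-1` A).
Proof.
by move=> mA; rewrite -[X in measurable X]setTI; exact: measurable_tcons.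
Qed.

Lemma tlebSE n (A : set (n.+1.-tuple T)) :
  tleb n.+1 A = (\int[leb]_t tleb n [set v | A (cons_tuple t v)])%E.
Proof.
apply: eq_integral => t _ /=; congr (tleb n _).
by apply/seteqP; split => v; rewrite /xsection /= ?inE// mem_setE.
Qed.

(** The product measures built from the two orders of integration agree on rectangles, hence
    everywhere. *)
Lemma tlebS_swap n (A : set (n.+1.-tuple T)) : measurable A ->
  tleb n.+1 A = (\int[tleb n]_v leb [set t | A (cons_tuple t v)])%E.
Proof.
move=> mA; have mA' := measurable_tcons_preimage mA.
transitivity ((leb \x^ tleb n)%E (@tcons n @^-1` A)).
  apply: product_measure_unique => // B C mB mC /=.
  by rewrite product_measure2E.
apply: eq_integral => v _ /=; congr (leb _).
by apply/seteqP; split => t; rewrite /ysection /= ?inE// mem_setE.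
Qed.

Lemma lebesgue_volE n (A : set (n.-tuple T)) : measurable A ->
  @lebesgue_vol R n A = tleb n A.
Proof.
elim: n A => [//|n IH] A mA; rewrite tlebSE /=; apply: eq_integral => t _.
by rewrite IH//; exact: measurable_tuple_xsection.
Qed.

Lemma ge0_integral_tlebS n (f : n.+1.-tuple T -> \bar R) :
  measurable_fun setT f -> (forall w, 0 <= f w)%E ->
  (\int[tleb n.+1]_w f w = \int[leb]_t \int[tleb n]_v f (cons_tuple t v))%E.
Proof.
move=> mf f0; rewrite (@ge0_integral_pushforward _ _ _ _ _ _ (@measurable_tcons n) _ setT)//.
rewrite preimage_setT fubini_tonelli1//; last by move=> ? /=; exact: f0.
exact: measurableT_comp mf (@measurable_tcons n).
Qed.

Lemma ge0_integral_tlebS_swap n (f : n.+1.-tuple T -> \bar R) :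
  measurable_fun setT f -> (forall w, 0 <= f w)%E ->
  (\int[tleb n.+1]_w f w = \int[tleb n]_v \int[leb]_t f (cons_tuple t v))%E.
Proof.
move=> mf f0; rewrite (@ge0_integral_pushforward _ _ _ _ _ _ (@measurable_tcons n) _ setT)//.
rewrite preimage_setT fubini_tonelli2//; last by move=> ? /=; exact: f0.
exact: measurableT_comp mf (@measurable_tcons n).
Qed.

(** Both sides are measures in [A], so by uniqueness of Lebesgue measure the intervals []x, y]]
    suffice; a negative [a] turns their preimages into intervals closed on the left. *)
Lemma lebesgue_measure_affine (a b : R) (A : set T) : a != 0 -> measurable A ->
  (`|a|%:E * leb [set t : T | A (a * t + b)%R] = leb A)%E.
Proof.
move=> a0 mA; pose h (t : T) : T := a * t + b.
have mh : measurable_fun setT h by exact: measurable_funD.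
pose m : {measure set T -> \bar R} :=
  mscale (NngNum (normr_ge0 a))
    (measure_function_pushforward__canonical__measure_function_Measure leb mh).
suff : leb A = m A by rewrite /m /= /mscale.
apply: lebesgue_measure_unique => // _ [[x y]] _ <-.
change (leb `]x, y] = (`|a|%:E * leb (h @^-1` `]x, y]))%E).
have [a_lt0|a_gt0|/eqP] := ltgtP a 0; last by rewrite (negbTE a0).
- rewrite (_ : h @^-1` _ = `[(y - b) / a, (x - b) / a[%classic); last first.
    apply/seteqP; split => t; rewrite /h /= !in_itv/= ler_ndivrMr// ltr_ndivlMr//.
      by move=> /andP[? ?]; apply/andP; split; lra.
    by move=> /andP[? ?]; apply/andP; split; lra.
  rewrite !lebesgue_measure_itv/= !lte_fin ltr_nM2r ?invr_lt0// ltrD2r.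
  case: ifPn => _; last by rewrite mule0.
  by rewrite -!EFinD -EFinM ltr0_norm//; congr EFin; field.
- rewrite (_ : h @^-1` _ = `](x - b) / a, (y - b) / a]%classic); last first.
    apply/seteqP; split => t; rewrite /h /= !in_itv/= ler_pdivlMr// ltr_pdivrMr//.
      by move=> /andP[? ?]; apply/andP; split; lra.
    by move=> /andP[? ?]; apply/andP; split; lra.
  rewrite !lebesgue_measure_itv/= !lte_fin ltr_pM2r ?invr_gt0// ltrD2r.
  case: ifPn => _; last by rewrite mule0.
  by rewrite -!EFinD -EFinM gtr0_norm//; congr EFin; field.
Qed.

Definition tadd n (w v : n.-tuple T) : n.-tuple T :=
  [tuple tnth v i + tnth w i | i < n].

Lemma measurable_tadd n (w : n.-tuple T) : measurable_fun setT (tadd w).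
Proof.
apply/measurable_fun_tnthP => i.
rewrite (_ : _ \o _ = fun v => tnth v i + tnth w i); last first.
  by apply/funext => v /=; rewrite tnth_mktuple.
by apply: measurable_funD => //; exact: measurable_tnth.
Qed.

Lemma tadd_cons n (s t : T) (w v : n.-tuple T) :
  tadd (cons_tuple s w) (cons_tuple t v) = cons_tuple (t + s) (tadd w v).
Proof.
apply: eq_from_tnth => i; rewrite tnth_mktuple.
by have [j ->|->] := unliftP ord0 i; rewrite ?tnth0// !tnthS tnth_mktuple.
Qed.

(** Induction on the dimension: the head is translated on lines parallel to the first axis, in the
    swapped order of integration, and the tail on the sections of the original order. *)
Lemma tleb_tadd n (w : n.-tuple T) (A : set (n.-tuple T)) : measurable A ->
  tleb n (tadd w @^-1` A) = tleb n A.
Proof.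
elim: n w A => [|n IH] w A mA.
  by congr (tleb 0 _); apply/seteqP; split => v; rewrite /= [tadd _ _]tuple0 [v]tuple0.
have mA' (u : n.+1.-tuple T) : measurable (tadd u @^-1` A).
  by rewrite -[X in measurable X]setTI; exact: measurable_tadd.
case/tupleP: w => s w.
transitivity (tleb n.+1 (tadd (cons_tuple 0 w) @^-1` A)).
  rewrite [LHS](tlebS_swap (mA' _)) [RHS](tlebS_swap (mA' _)).
  apply: eq_integral => v _.
  rewrite -[RHS](@lebesgue_measure_affine 1 s [set t | _ (cons_tuple t v)] (oner_neq0 _)).
    rewrite normr1 mul1e; congr (leb _); apply/seteqP.
    by split => t /=; rewrite !tadd_cons mul1r addr0.
  exact: measurable_tuple_ysection.
rewrite !tlebSE; apply: eq_integral => t _.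
rewrite -(IH w [set v | A (cons_tuple t v)]); last exact: measurable_tuple_xsection.
by congr (tleb n _); apply/seteqP; split => v /=; rewrite tadd_cons addr0.
Qed.

Definition trow n (c : n.-tuple R) : 'rV[R]_n := \row_i tnth c i.

Definition tmx m n (M : 'M[R]_(m, n)) (c : m.-tuple R) : n.-tuple R :=
  [tuple (trow c *m M) 0 i | i < n].

Lemma trow_tmx m n (M : 'M[R]_(m, n)) c : trow (tmx M c) = trow c *m M.
Proof. by apply/rowP => i; rewrite mxE tnth_mktuple. Qed.

Lemma trow_inj n : injective (@trow n).
Proof. by move=> u v /rowP uv; apply: eq_from_tnth => i; have := uv i; rewrite !mxE. Qed.

Lemma tmxM m n p (M : 'M[R]_(m, n)) (N : 'M[R]_(n, p)) c :
  tmx (M *m N) c = tmx N (tmx M c).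
Proof. by apply: trow_inj; rewrite !trow_tmx mulmxA. Qed.

Lemma measurable_tmx m n (M : 'M[R]_(m, n)) :
  measurable_fun setT (tmx M : m.-tuple T -> n.-tuple T).
Proof.
apply/measurable_fun_tnthP => i.
rewrite (_ : _ \o _ = fun c : m.-tuple T => \sum_j tnth c j * M j i); last first.
  by apply/funext => c /=; rewrite tnth_mktuple mxE; apply: eq_bigr => j _; rewrite mxE.
apply: measurable_sum => j; apply: measurable_funM => //.
exact: measurable_tnth.
Qed.

Lemma measurable_tmx_preimage m n (M : 'M[R]_(m, n)) (A : set (n.-tuple T)) :
  measurable A -> measurable (tmx M @^-1` A : set (m.-tuple T)).
Proof. by move=> mA; rewrite -[X in measurable X]setTI; exact: measurable_tmx. Qed.

Lemma trow_cons n (t : R) (v : n.-tuple R) :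
  trow (cons_tuple t v) = row_mx (t%:M : 'M[R]_1) (trow v) :> 'rV[R]_(1 + n).
Proof.
apply/rowP => i; rewrite mxE; have [j ->|->] := unliftP ord0 i.
  by rewrite tnthS (_ : lift ord0 j = rshift 1 j) ?row_mxEr ?mxE//; exact: val_inj.
have E : @ord0 n = lshift n (@ord0 0) :> 'I_(1 + n) by exact: val_inj.
by rewrite tnth0 [in RHS]E row_mxEl mxE.
Qed.

Lemma tmx_block n (a : R) (r : 'rV[R]_n) (c : 'cV[R]_n) (D : 'M[R]_n) (t : R)
    (v : n.-tuple R) :
  tmx (block_mx a%:M r c D : 'M[R]_(1 + n)) (cons_tuple t v) =
  cons_tuple (t * a + (trow v *m c) 0 0)
    [tuple t * r 0 i + (trow v *m D) 0 i | i < n].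
Proof.
apply: trow_inj; rewrite trow_tmx !trow_cons mul_row_block; congr row_mx.
  by apply/rowP => i; rewrite !ord1 -scalar_mxM !mxE.
by apply/rowP => i; rewrite [RHS]mxE tnth_mktuple mul_scalar_mx mxE [X in X + _]mxE.
Qed.

(** * Linear change of variables *)

Definition scales n (M : 'M[R]_n) := forall A : set (n.-tuple T), measurable A ->
  (`|\det M|%:E * tleb n (tmx M @^-1` A) = tleb n A)%E.

Lemma scalesM n (M N : 'M[R]_n) : scales M -> scales N -> scales (M *m N).
Proof.
move=> sM sN A mA; rewrite det_mulmx normrM mulrC EFinM -muleA.
rewrite (_ : tmx _ @^-1` A = tmx M @^-1` (tmx N @^-1` A)); last first.
  by apply/seteqP; split => c /=; rewrite tmxM.
by rewrite sM ?sN//; exact: measurable_tmx_preimage.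
Qed.

(** On the section with head [t] this map is the translation by [t *: r]. *)
Lemma scales_rshear n (r : 'rV[R]_n) :
  scales (block_mx 1%:M r 0 1%:M : 'M[R]_(1 + n)).
Proof.
move=> A mA; rewrite det_ublock !det1 mulr1 normr1 mul1e [LHS]tlebSE [RHS]tlebSE.
apply: eq_integral => t _.
rewrite -[RHS](@tleb_tadd _ [tuple t * r 0 i | i < n]).
  congr (tleb n _); apply/seteqP; split => v /=;
  by rewrite tmx_block mulr1 mulmx0 mxE addr0; congr (A (cons_tuple _ _));
    apply: eq_from_tnth => i; rewrite !tnth_mktuple mulmx1 mxE addrC.
exact: measurable_tuple_xsection.
Qed.

(** On a line parallel to the first axis this map is affine with slope [a], so the swapped order of
    integration reduces it to dimension one. *)
Lemma scales_lshear n (a : R) (c : 'cV[R]_n) : a != 0 ->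
  scales (block_mx a%:M 0 c 1%:M : 'M[R]_(1 + n)).
Proof.
move=> a0 A mA; rewrite det_lblock det_scalar1 det1 mulr1.
have mA' := measurable_tmx_preimage (block_mx a%:M 0 c 1%:M) mA.
rewrite [X in (_ * X)%E](tlebS_swap mA') [RHS](tlebS_swap mA).
rewrite -ge0_integralZl//.
  apply: eq_integral => v _.
  rewrite -[RHS](@lebesgue_measure_affine a ((trow v *m c) 0 0))//.
    congr (_ * leb _)%E; apply/seteqP; split => t /=;
    by rewrite tmx_block (mulrC t); congr (A (cons_tuple _ _));
      apply: eq_from_tnth => i; rewrite !tnth_mktuple mulmx1 !mxE mulr0 add0r.
  exact: measurable_tuple_ysection.
apply: eq_measurable_fun (measurable_fun_ysection leb (measurable_tcons_preimage mA')).
move=> v _ /=; congr (leb _).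
by apply/seteqP; split => t; rewrite /ysection /= ?inE// mem_setE.
Qed.

Lemma scales_diag n (D : 'M[R]_n) : scales D ->
  scales (block_mx 1%:M 0 0 D : 'M[R]_(1 + n)).
Proof.
move=> sD A mA; rewrite det_ublock det1 mul1r.
have mA' := measurable_tmx_preimage (block_mx 1%:M 0 0 D) mA.
rewrite [X in (_ * X)%E]tlebSE [RHS]tlebSE.
rewrite -ge0_integralZl//.
  apply: eq_integral => t _; rewrite -[RHS]sD; last exact: measurable_tuple_xsection.
  congr (_ * tleb n _)%E; apply/seteqP; split => v /=;
  by rewrite tmx_block mulr1 mulmx0 mxE addr0; congr (A (cons_tuple _ _));
    apply: eq_from_tnth => i; rewrite !tnth_mktuple !mxE mulr0 add0r.
apply: eq_measurable_fun (measurable_fun_xsection (tleb n) (measurable_tcons_preimage mA')).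
move=> t _ /=; congr (tleb n _).
by apply/seteqP; split => v; rewrite /xsection /= ?inE// mem_setE.
Qed.

(* Elimination with the Schur complement of the entry a. *)
Lemma scales_pivot n (a : R) (r : 'rV[R]_n) (c : 'cV[R]_n) (D : 'M[R]_n) :
  (forall D' : 'M[R]_n, D' \in unitmx -> scales D') -> a != 0 ->
  block_mx a%:M r c D \in unitmx -> scales (block_mx a%:M r c D : 'M[R]_(1 + n)).
Proof.
move=> IH a0; pose D' := D - c *m (a^-1 *: r).
have -> : block_mx a%:M r c D =
    block_mx a%:M 0 c 1%:M *m block_mx 1%:M 0 0 D' *m
    block_mx 1%:M (a^-1 *: r) 0 1%:M :> 'M[R]_(1 + n).
  rewrite !mulmx_block !(mulmx0, mul0mx, mulmx1, mul1mx, addr0, add0r).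
  by rewrite mul_scalar_mx scalerA divff// scale1r /D' addrC subrK.
rewrite !unitmx_mul => /andP[/andP[_ uD] _].
apply: scalesM; last exact: scales_rshear.
apply: scalesM; first exact: scales_lshear.
apply: scales_diag; apply: IH; move: uD.
by rewrite !unitmxE det_ublock det1 mul1r.
Qed.

(** Gaussian elimination by induction on the dimension. If the corner entry is zero, invertibility
    provides a nonzero entry below it, which a row operation moves into the corner. *)
Lemma scales_unit n (M : 'M[R]_n) : M \in unitmx -> scales M.
Proof.
elim: n M => [|n IH] M uM.
  move=> A mA; rewrite det_mx00 normr1 mul1e; congr (tleb 0 _).
  by apply/seteqP; split => v /=; rewrite (tuple0 v) (tuple0 (tmx _ _)).
change 'M[R]_(1 + n) in M; move: uM.
rewrite -[M]submxK [ulsubmx M]mx11_scalar.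
set a := ulsubmx M 0 0; set r := ursubmx M; set c := dlsubmx M; set D := drsubmx M.
have [->|a0] := eqVneq a 0; last exact: scales_pivot.
have [->|/eqP/matrixP c0 uM] := eqVneq c 0.
  by rewrite unitmxE (det_ublock 0%:M r D) det_scalar1 mul0r unitr0.
have [j cj] : exists j, c j 0 != 0.
  apply/existsP; apply: contra_notT c0 => /existsPn h i j.
  by rewrite ord1 [RHS]mxE; exact/eqP/negbNE/h.
(* [S 1] adds row [j] of the lower blocks to the first row, so that [c j 0] becomes the pivot;
   [S (-1)] undoes this. *)
pose S (s : R) : 'M[R]_(1 + n) := block_mx 1%:M (s *: delta_mx 0 j) 0 1%:M.
have uS s : S s \in unitmx by rewrite unitmxE det_ublock !det1 mulr1 unitr1.
have -> : block_mx 0%:M r c D = S (-1) *m (S 1 *m block_mx 0%:M r c D).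
  rewrite mulmxA (_ : S (-1) *m S 1 = 1%:M) ?mul1mx//.
  rewrite mulmx_block !(mulmx0, mul0mx, mulmx1, mul1mx, addr0, add0r).
  by rewrite scaleN1r scale1r subrr -scalar_mx_block.
apply: scalesM; first exact: scales_rshear.
have : S 1 *m block_mx 0%:M r c D \in unitmx by rewrite unitmx_mul uS.
rewrite mulmx_block [X in block_mx X](_ : _ = (c j 0)%:M); first exact: scales_pivot.
rewrite mul1mx scale1r -rowE; apply/rowP => i.
by rewrite !ord1 !mxE /= mul0rn add0r.
Qed.

Lemma tleb_unitary n (Q : 'M[R]_n) (A : set (n.-tuple T)) :
  Q *m Q^T = 1%:M -> measurable A -> tleb n (tmx Q @^-1` A) = tleb n A.
Proof.
move=> QQ mA; have uQ : Q \in unitmx by case/mulmx1_unit: QQ.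
rewrite -[RHS](scales_unit uQ mA).
have : `|\det Q| ^+ 2 = 1 by rewrite real_normK ?num_real// expr2 -{2}det_tr -det_mulmx QQ det1.
by move=> /eqP; rewrite sqrp_eq1// => /eqP ->; rewrite mul1e.
Qed.

Definition tscale n (r : R) (c : n.-tuple R) := [tuple r * tnth c i | i < n].

Lemma tleb_scale n (r : R) (A : set (n.-tuple T)) : 0 < r -> measurable A ->
  ((r ^+ n)%:E * tleb n (tscale r @^-1` A) = tleb n A)%E.
Proof.
move=> r0 mA; have uM : (r%:M : 'M[R]_n) \in unitmx.
  by rewrite unitmxE det_scalar unitrX// unitfE gt_eqF.
rewrite -[RHS](scales_unit uM mA) det_scalar ger0_norm ?exprn_ge0 ?ltW//.
congr (_ * tleb n (_ @^-1` A))%E; apply/funext => c.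
by apply: eq_from_tnth => i; rewrite !tnth_mktuple mul_mx_scalar !mxE.
Qed.

Lemma measurable_le_set d (U : measurableType d) (f g : U -> R) :
  measurable_fun setT f -> measurable_fun setT g ->
  measurable [set x | f x <= g x].
Proof.
move=> mf mg; rewrite -[X in measurable X]setTI.
exact: (@measurable_fun_ler _ _ _ _ f g mf mg measurableT [set true]).
Qed.

Lemma measurable_lt_set d (U : measurableType d) (f g : U -> R) :
  measurable_fun setT f -> measurable_fun setT g ->
  measurable [set x | f x < g x].
Proof.
move=> mf mg; rewrite -[X in measurable X]setTI.
exact: (@measurable_fun_ltr _ _ _ _ f g mf mg measurableT [set true]).
Qed.

Definition sqnorm n (c : n.-tuple R) : R := \sum_i tnth c i ^+ 2.

Lemma sqnorm_ge0 n (c : n.-tuple R) : 0 <= sqnorm c.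
Proof. by apply: sumr_ge0 => i _; exact: sqr_ge0. Qed.

Lemma measurable_sqnorm n : measurable_fun setT (@sqnorm n : n.-tuple T -> R).
Proof.
apply: measurable_sum => i; apply: measurable_funX; exact: measurable_tnth.
Qed.

Lemma sqnorm_tscale n r (c : n.-tuple R) : sqnorm (tscale r c) = r ^+ 2 * sqnorm c.
Proof.
by rewrite /sqnorm mulr_sumr; apply: eq_bigr => i _; rewrite tnth_mktuple exprMn.
Qed.

Definition tball n : set (n.-tuple T) := [set c | sqnorm c <= 1].

Lemma measurable_tball n : measurable (@tball n).
Proof.
exact: measurable_le_set (@measurable_sqnorm n) (measurable_cst _).
Qed.

(** * Gaussian measure of cones *)

Definition gauss_weight n (c : n.-tuple R) : R := expR (- sqnorm c / 2).

Lemma measurable_gauss_weight n :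
  measurable_fun setT (@gauss_weight n : n.-tuple T -> R).
Proof.
apply: measurableT_comp => //; apply: measurable_funM => //.
by apply: measurableT_comp => //; exact: measurable_sqnorm.
Qed.

Definition gauss n (C : set (n.-tuple T)) : \bar R :=
  (\int[tleb n]_(c in C) (gauss_weight c)%:E)%E.

(* The superlevel set of the Gaussian density at height t is the ball of radius
   sqrt (-2 ln t), so k is the integral of the n-th power of this radius. *)
Lemma gauss_cone n : exists k : \bar R, (0 <= k)%E /\
  forall C : set (n.-tuple T), measurable C ->
  (forall r : R, 0 < r -> tscale r @^-1` C = C) ->
  (gauss C = k * tleb n (C `&` @tball n))%E.
Proof.
pose rad (t : T) : T := Num.sqrt (- 2 * ln t).
exists (\int[leb]_(t in `]0%R, 1%R[) (rad t ^+ n)%:E)%E.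
split; first by apply: integral_ge0 => t _; rewrite lee_fin exprn_ge0// sqrtr_ge0.
move=> C mC coneC.
(* The region under the graph of the weight over [C], to be measured in both orders. Heights stay in
   []0, 1[], where [ln t < 0] makes the radius [rad t] positive. *)
pose U : set (n.-tuple T * T) := (fst @^-1` C) `&`
  ([set p | 0 < p.2] `&` [set p | p.2 < 1] `&` [set p | p.2 <= gauss_weight p.1]).
have mU : measurable U.
  apply: measurableI; first by rewrite -[X in measurable X]setTI; exact: measurable_fst.
  apply: measurableI; last first.
    apply: measurable_le_set => //.
    by apply: measurableT_comp => //; exact: measurable_gauss_weight.
  by apply: measurableI; exact: measurable_lt_set.
transitivity (\int[tleb n]_c leb (xsection U c))%E.
  rewrite /gauss integral_mkcond; apply: eq_integral => c _.
  rewrite xsectionE /patch; case: ifPn => [|/negP]; rewrite inE => Cc; last first.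
    by rewrite (_ : _ @^-1` _ = set0) ?measure0//; apply/seteqP; split => t // -[].
  have w0 : 0 < gauss_weight c by exact: expR_gt0.
  have : gauss_weight c <= 1.
    by rewrite -expR0 ler_expR mulNr oppr_le0 divr_ge0// sqnorm_ge0.
  (* At weight 1 the open bound on the heights only cuts off the point 1, which has length zero. *)
  rewrite le_eqVlt => /orP[/eqP w1|w1].
    rewrite w1 (_ : _ @^-1` _ = `]0, 1[%classic).
      by rewrite lebesgue_measure_itv/= lte_fin ltr01 oppr0 adde0.
    apply/seteqP; split => t; rewrite /U/= in_itv/= w1.
      by move=> [_ [[-> ->]]].
    by move=> /andP[-> t1]; rewrite t1 (ltW t1).
  rewrite (_ : _ @^-1` _ = `]0, gauss_weight c]%classic).
    by rewrite lebesgue_measure_itv/= lte_fin w0 oppr0 adde0.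
  apply/seteqP; split => t; rewrite /U/= in_itv/=.
    by move=> [_ [[-> _] ->]].
  by move=> /andP[-> tw]; rewrite tw (le_lt_trans tw).
transitivity (\int[leb]_t tleb n (ysection U t))%E.
  have := indic_fubini_tonelli (tleb n) leb mU.
  by rewrite indic_fubini_tonelli_FE// indic_fubini_tonelli_GE.
rewrite -ge0_integralZr//.
- rewrite [RHS]integral_mkcond; apply: eq_integral => t _.
  rewrite ysectionE /patch; case: ifPn => [|/negP]; rewrite inE/= in_itv/= => t01; last first.
    rewrite (_ : _ @^-1` _ = set0) ?measure0//; apply/seteqP; split => c // [_ [[t0 t1] _]].
    by apply: t01; rewrite t0.
  case/andP: t01 => t0 t1.
  have lnt : 0 < - 2 * ln t by rewrite mulNr oppr_gt0 pmulr_rlt0// ln_lt0// t0.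
  have r0 : 0 < rad t by rewrite sqrtr_gt0.
  have rsq : rad t ^+ 2 = - 2 * ln t by rewrite sqr_sqrtr// ltW.
  have mUt : measurable (pair^~ t @^-1` U).
    by rewrite -ysectionE; exact: measurable_ysection.
  rewrite -[LHS](tleb_scale r0 mUt); congr (_ * tleb n _)%E.
  have {}coneC c : C (tscale (rad t) c) = C c by rewrite -[in RHS](coneC _ r0).
  have lt0 : ln t < 0 by rewrite ln_lt0// t0.
  (* The exponent of the scaled point is [ln t * sqnorm c], and [ln t < 0] reverses the comparison
     with [ln t]. *)
  have E c : (t <= gauss_weight (tscale (rad t) c)) = (sqnorm c <= 1).
    rewrite -[X in X <= gauss_weight _](lnK t0) /gauss_weight ler_expR sqnorm_tscale rsq.
    by rewrite -[RHS](ler_nM2l lt0) mulr1; congr (_ <= _); lra.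
  apply/seteqP; split => c; rewrite /U /tball /preimage /= coneC E t0 t1.
    by move=> [Cc [_ cB]].
  by move=> [Cc cB].
- apply/measurable_EFinP; apply: measurable_funX.
  apply: (measurableT_comp (continuous_measurable_fun (@sqrt_continuous R))).
  by apply: measurable_funM => //; apply: measurable_funTS; exact: measurable_ln.
- by move=> t _; rewrite lee_fin exprn_ge0// sqrtr_ge0.
Qed.

Lemma measurable_fun_tconsP n d (U : measurableType d) (f : n.+1.-tuple T -> U) :
  measurable_fun setT (f \o @tcons n) -> measurable_fun setT f.
Proof.
move=> mf; rewrite (_ : f = (f \o @tcons n) \o @tuncons n).
  exact: measurableT_comp mf (@measurable_tuncons n).
by apply/funext => w /=; rewrite tunconsK.
Qed.

(** * Integrals of functions that factor over the coordinates *)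

Section products.
Variables (n : nat) (a : T -> R) (b : n.-tuple T -> R) (f : n.+1.-tuple T -> R).
Hypothesis fE : forall t v, f (cons_tuple t v) = a t * b v.

Lemma measurable_fun_tleb_prod : measurable_fun setT a -> measurable_fun setT b ->
  measurable_fun setT f.
Proof.
move=> ma mb; apply: measurable_fun_tconsP.
rewrite (_ : _ \o _ = fun p => a p.1 * b p.2); last by apply/funext => -[t v]; exact: fE.
by apply: measurable_funM; exact: measurableT_comp.
Qed.

Lemma ge0_integral_tleb_prod (A B : R) :
  measurable_fun setT a -> measurable_fun setT b ->
  (forall t, 0 <= a t) -> (forall v, 0 <= b v) ->
  (\int[leb]_t (a t)%:E = A%:E)%E -> (\int[tleb n]_v (b v)%:E = B%:E)%E ->
  (\int[tleb n.+1]_w (f w)%:E = (A * B)%:E)%E.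
Proof.
move=> ma mb a0 b0 IA IB.
rewrite ge0_integral_tlebS; last 2 first.
- by apply/measurable_EFinP; exact: measurable_fun_tleb_prod.
- by case/tupleP => t v; rewrite fE lee_fin mulr_ge0.
have E t : (\int[tleb n]_v (f (cons_tuple t v))%:E = (a t)%:E * B%:E)%E.
  rewrite -IB -ge0_integralZl//; last 3 first.
  - exact/measurable_EFinP.
  - by move=> v _; rewrite lee_fin.
  - by rewrite lee_fin.
  by apply: eq_integral => v _; rewrite fE EFinM.
under eq_integral do rewrite E.
rewrite ge0_integralZr//; last 3 first.
- exact/measurable_EFinP.
- by move=> v _; rewrite lee_fin.
- by rewrite -IB; apply: integral_ge0 => v _; rewrite lee_fin.
by rewrite IA.
Qed.

Lemma integrable_tleb_prod : leb.-integrable setT (EFin \o a) ->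
  (tleb n).-integrable setT (EFin \o b) ->
  (tleb n.+1).-integrable setT (EFin \o f).
Proof.
move=> ia ib.
have ma : measurable_fun setT a by apply/measurable_EFinP; exact: measurable_int ia.
have mb : measurable_fun setT b by apply/measurable_EFinP; exact: measurable_int ib.
have mf := measurable_fun_tleb_prod ma mb.
apply/integrableP; split; first exact/measurable_EFinP.
rewrite ge0_integral_tlebS//; last first.
  by apply: measurableT_comp => //; exact/measurable_EFinP.
have /integrableP[_ fa] := ia; have /integrableP[_ fb] := ib.
have fin : (\int[tleb n]_v `|(EFin \o b) v|)%E \is a fin_num.
  by rewrite ge0_fin_numE//; exact: integral_ge0.
have E t : (\int[tleb n]_v `|(EFin \o f) (cons_tuple t v)|
    = `|(a t)%:E| * \int[tleb n]_v `|(EFin \o b) v|)%E.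
  rewrite -ge0_integralZl//; last by apply: measurableT_comp => //; exact/measurable_EFinP.
  by apply: eq_integral => v _ /=; rewrite fE normrM EFinM.
under eq_integral do rewrite E.
rewrite ge0_integralZr//; last 2 first.
- by apply: measurableT_comp => //; exact/measurable_EFinP.
- exact: integral_ge0.
rewrite lte_mul_pinfty//; first exact: integral_ge0.
by rewrite ge0_fin_numE//; exact: integral_ge0.
Qed.

Lemma Rintegral_tleb_prod : leb.-integrable setT (EFin \o a) ->
  (tleb n).-integrable setT (EFin \o b) ->
  \int[tleb n.+1]_w f w = (\int[leb]_t a t) * (\int[tleb n]_v b v).
Proof.
move=> ia ib; have iF := integrable_tleb_prod ia ib.
have mf : measurable_fun setT (EFin \o f) by exact: measurable_int iF.
have intf : (leb \x tleb n)%E.-integrable setT ((EFin \o f) \o @tcons n).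
  apply/integrableP; split; first exact: measurableT_comp mf (@measurable_tcons n).
  have /integrableP[_] := iF.
  rewrite (@ge0_integral_pushforward _ _ _ _ _ _ (@measurable_tcons n) _ setT)//.
  exact: measurableT_comp.
rewrite /Rintegral (@integral_pushforward _ _ _ _ _ _ (@measurable_tcons n) _ setT)//.
rewrite preimage_setT -integral12_prod_meas1// -fineM; last 2 first.
- exact: integrable_fin_num.
- exact: integrable_fin_num.
have finb : (\int[tleb n]_v (b v)%:E)%E \is a fin_num by exact: integrable_fin_num.
rewrite -(fineK finb) -integralZr//; congr fine; apply: eq_integral => t _.
rewrite /fubini_F fineK// -integralZl//.
by apply: eq_integral => v _ /=; rewrite [f _]fE EFinM.
Qed.

End products.

Lemma measurable_fun_tuple0 d (U : measurableType d) (f : 0.-tuple T -> U) :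
  measurable_fun setT f.
Proof.
rewrite (_ : f = cst (f [tuple])); first exact: measurable_cst.
by apply/funext => c; rewrite (tuple0 c).
Qed.

Lemma integral_tleb0 (f : 0.-tuple T -> \bar R) :
  (\int[tleb 0]_c f c = f [tuple])%E.
Proof.
rewrite [LHS]integral_dirac//; last exact: measurable_fun_tuple0.
by rewrite diracT mul1e.
Qed.

Lemma prod_tnth_cons (K : comPzRingType) n (F : 'I_n.+1 -> T -> K) t (v : n.-tuple T) :
  \prod_i F i (tnth (cons_tuple t v) i) =
  F ord0 t * \prod_i F (lift ord0 i) (tnth v i).
Proof.
by rewrite big_ord_recl tnth0; congr (_ * _); apply: eq_bigr => i _; rewrite tnthS.
Qed.

Lemma ge0_integral_tleb_bigprod n (F : 'I_n -> T -> R) (I : 'I_n -> R) :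
  (forall i, measurable_fun setT (F i)) -> (forall i t, 0 <= F i t) ->
  (forall i, \int[leb]_t (F i t)%:E = (I i)%:E)%E ->
  (\int[tleb n]_c (\prod_i F i (tnth c i))%:E = (\prod_i I i)%:E)%E.
Proof.
elim: n F I => [|n IH] F I mF F0 FI.
  by rewrite integral_tleb0 !big_ord0.
have mG m (G : 'I_m -> T -> R) : (forall i, measurable_fun setT (G i)) ->
    measurable_fun setT (fun c : m.-tuple T => \prod_i G i (tnth c i)).
  move=> mG; apply: measurable_prod => i _.
  by apply: measurableT_comp => //; exact: measurable_tnth.
rewrite [in RHS]big_ord_recl.
apply: (@ge0_integral_tleb_prod _ _ (fun v : n.-tuple T => \prod_i F (lift ord0 i) (tnth v i))
  (fun w => \prod_i F i (tnth w i)) (fun t v => prod_tnth_cons F t v)) => //.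
- exact: (mG _ (fun i => F (lift ord0 i))).
- by move=> v; apply: prodr_ge0 => i _.
- exact: (IH (fun i => F (lift ord0 i))).
Qed.

(** Real and imaginary part of a product are bilinear in those of the factors, so the induction has
    to carry both integrabilities and both values together. *)
Lemma Rintegral_tleb_complex_bigprod n (F : 'I_n -> T -> R[i]) :
  (forall i, leb.-integrable setT (EFin \o (fun t => complex.Re (F i t)))) ->
  (forall i, leb.-integrable setT (EFin \o (fun t => complex.Im (F i t)))) ->
  let G (c : n.-tuple T) := \prod_i F i (tnth c i) in
  let J := \prod_i cintegral setT (F i) in
  [/\ (tleb n).-integrable setT (EFin \o (fun c => complex.Re (G c))),
      (tleb n).-integrable setT (EFin \o (fun c => complex.Im (G c))),
      \int[tleb n]_c complex.Re (G c) = complex.Re J &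
      \int[tleb n]_c complex.Im (G c) = complex.Im J].
Proof.
elim: n F => [|n IH] F iR iI G J.
  have i0 (f : 0.-tuple T -> R) : (tleb 0).-integrable setT (EFin \o f).
    apply/integrableP; split; first exact: measurable_fun_tuple0.
    by rewrite integral_tleb0 ltry.
  by split; rewrite ?/Rintegral ?integral_tleb0 /G /J ?big_ord0.
have := IH (fun i => F (lift ord0 i)) (fun i => iR _) (fun i => iI _).
set H := fun v : n.-tuple T => \prod_i F (lift ord0 i) (tnth v i).
move=> [jR jI IR II].
have GE t v : G (cons_tuple t v) = F ord0 t * H v by exact: prod_tnth_cons.
pose P (a : T -> R) (b : n.-tuple T -> R) (w : n.+1.-tuple T) := a (tuncons w).1 * b (tuncons w).2.
have PE a b t v : P a b (cons_tuple t v) = a t * b v.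
  by rewrite /P -[cons_tuple t v]/(tcons (t, v)) tconsK.
pose fR t := complex.Re (F ord0 t); pose fI t := complex.Im (F ord0 t).
pose hR v := complex.Re (H v); pose hI v := complex.Im (H v).
have {}IR : \int[tleb n]_v hR v = _ := IR.
have {}II : \int[tleb n]_v hI v = _ := II.
have ReE : (fun c => complex.Re (G c)) = P fR hR \- P fI hI.
  apply/funext => w; rewrite -(tunconsK w); case: (tuncons w) => t v.
  rewrite /= [G _]GE /tcons !PE /fR /fI /hR /hI.
  by case: (F _ _) => ? ?; case: (H v).
have ImE : (fun c => complex.Im (G c)) = P fR hI \+ P fI hR.
  apply/funext => w; rewrite -(tunconsK w); case: (tuncons w) => t v.
  rewrite /= [G _]GE /tcons !PE /fR /fI /hR /hI.
  by case: (F _ _) => ? ?; case: (H v).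
have iP a b : leb.-integrable setT (EFin \o a) -> (tleb n).-integrable setT (EFin \o b) ->
  (tleb n.+1).-integrable setT (EFin \o P a b).
  exact: integrable_tleb_prod (PE _ _).
have JE : J = cintegral setT (F ord0) * \prod_i cintegral setT (F (lift ord0 i)).
  by rewrite /J big_ord_recl.
split.
- by rewrite ReE; exact: (integrableB measurableT (iP _ _ (iR ord0) jR) (iP _ _ (iI ord0) jI)).
- by rewrite ImE; exact: (integrableD measurableT (iP _ _ (iR ord0) jI) (iP _ _ (iI ord0) jR)).
- rewrite ReE RintegralB//; [|exact: (iP _ _ (iR ord0) jR)|exact: (iP _ _ (iI ord0) jI)].
  rewrite !(Rintegral_tleb_prod (PE _ _))// ?IR ?II ?JE /cintegral; [|exact: iI|exact: iR..].
  by case: (\prod_i _).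
- rewrite ImE RintegralD//; [|exact: (iP _ _ (iR ord0) jI)|exact: (iP _ _ (iI ord0) jR)].
  rewrite !(Rintegral_tleb_prod (PE _ _))// ?IR ?II ?JE /cintegral; [|exact: iI|exact: iR..].
  by case: (\prod_i _).
Qed.

End tuple_lebesgue.

Arguments tleb : simpl never.

(** * Gaussian integrals and the function Phi *)

Section real_analysis.
Context {R : realType}.
Local Notation T := (measurableTypeR R).
Local Notation leb := (@lebesgue_measure R).
Implicit Types (a y z w : R).

Section real_integrable.
Context d (U : measurableType d) (mu : {measure set U -> \bar R}) (D : set U).
Hypothesis mD : measurable D.

Lemma integrable_realZ (k : R) (f : U -> R) : mu.-integrable D (EFin \o f) ->
  mu.-integrable D (EFin \o (fun x => k * f x)).
Proof. exact: integrableZl. Qed.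

Lemma integrable_realN (f : U -> R) : mu.-integrable D (EFin \o f) ->
  mu.-integrable D (EFin \o (fun x => - f x)).
Proof. exact: integrableN. Qed.

Lemma integrable_realD (f g : U -> R) : mu.-integrable D (EFin \o f) ->
  mu.-integrable D (EFin \o g) -> mu.-integrable D (EFin \o (fun x => f x + g x)).
Proof. exact: integrableD. Qed.

Lemma integrable_realB (f g : U -> R) : mu.-integrable D (EFin \o f) ->
  mu.-integrable D (EFin \o g) -> mu.-integrable D (EFin \o (fun x => f x - g x)).
Proof. exact: integrableB. Qed.

End real_integrable.

(** [a] times the image of Lebesgue measure under [x |-> a x] is Lebesgue measure again. *)
Lemma ge0_integral_scale a (f : R -> \bar R) : 0 < a ->
  measurable_fun setT f -> (forall x, 0 <= f x)%E ->
  (a%:E * \int[leb]_x f (a * x)%R = \int[leb]_x f x)%E.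
Proof.
move=> a0 mf f0; pose h (t : T) : T := a * t.
have mh : measurable_fun setT h by exact: measurable_funM.
pose m : {measure set T -> \bar R} :=
  mscale (NngNum (ltW a0))
    (measure_function_pushforward__canonical__measure_function_Measure leb mh).
transitivity (\int[m]_x f x)%E.
  rewrite ge0_integral_mscale//; congr (_ * _)%E.
  by rewrite (@ge0_integral_pushforward _ _ _ _ _ _ mh _ setT)// preimage_setT.
apply: eq_measure_integral => A mA _.
rewrite -[RHS](@lebesgue_measure_affine _ a 0 A) ?gt_eqF// gtr0_norm//.
congr (_ * leb _)%E; apply/seteqP; rewrite /h.
by split => t /=; rewrite addr0.
Qed.

Definition gss y : R := expR (- y ^+ 2 / 2).

Lemma gss_ge0 y : 0 <= gss y. Proof. exact: expR_ge0. Qed.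

Lemma integrable_expR_sqr a : 0 < a ->
  leb.-integrable setT (EFin \o (fun y => expR (- (a * y) ^+ 2))).
Proof.
move=> a0; have mg : measurable_fun setT (@gauss_fun R) by exact: measurable_gauss_fun.
apply/integrableP; split.
  apply/measurable_EFinP; apply: (measurableT_comp mg).
  exact: measurable_funM.
have E : (a%:E * \int[leb]_x (gauss_fun (a * x))%:E = (Num.sqrt pi)%:E)%E.
  rewrite -integralT_gauss; apply: (ge0_integral_scale a0 (f := EFin \o gauss_fun)).
    exact/measurable_EFinP.
  by move=> x; rewrite lee_fin gauss_fun_ge0.
under eq_integral do rewrite /= ger0_norm ?expR_ge0//.
rewrite ltey; apply/eqP => ioo; move: E; rewrite [X in (_ * X)%E]ioo.
by rewrite gt0_muley ?lte_fin.
Qed.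

Lemma gssE y : gss y = gauss_fun ((Num.sqrt 2)^-1 * y).
Proof.
by rewrite /gss /gauss_fun exprMn exprVn sqr_sqrtr// mulNr mulrC.
Qed.

Lemma continuous_gss : continuous gss.
Proof.
move=> x; rewrite (_ : gss = gauss_fun \o (fun y => (Num.sqrt 2)^-1 * y)); last first.
  by apply/funext => y; rewrite gssE.
apply: continuous_comp; first exact: mulrl_continuous.
exact: continuous_gauss_fun.
Qed.

Lemma measurable_gss : measurable_fun setT gss.
Proof. exact: continuous_measurable_fun continuous_gss. Qed.

Lemma integrable_gss : leb.-integrable setT (EFin \o gss).
Proof.
have s2 : 0 < (Num.sqrt 2)^-1 :> R by rewrite invr_gt0 sqrtr_gt0.
apply: eq_integrable (integrable_expR_sqr s2) => // y _ /=.
by rewrite gssE.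
Qed.

Lemma integral_gss_pos : (\int[leb]_(x in `[0%R, +oo[) (gss x)%:E)%E = (Num.sqrt (pi / 2))%:E.
Proof.
have s2 : 0 < (Num.sqrt 2)^-1 :> R by rewrite invr_gt0 sqrtr_gt0.
pose f : R -> \bar R := (EFin \o gauss_fun) \_ `[0, +oo[.
have mf : measurable_fun setT f.
  apply/(measurable_restrictT _ _).1 => //; apply: measurable_funTS.
  by apply/measurable_EFinP; exact: measurable_gauss_fun.
have f0 x : (0 <= f x)%E by rewrite /f /patch; case: ifP => // _; rewrite lee_fin gauss_fun_ge0.
have := ge0_integral_scale s2 mf f0.
rewrite -[RHS]integral_mkcond integral0y_gauss => E.
transitivity (\int[leb]_x f ((Num.sqrt 2)^-1 * x)%R)%E.
  rewrite integral_mkcond; apply: eq_integral => x _.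
  by rewrite /f /patch !mem_setE /= !in_itv/= !andbT pmulr_rge0// gssE.
have -> : (Num.sqrt (pi / 2))%:E = ((Num.sqrt 2)%:E * (Num.sqrt pi / 2)%:E)%E :> \bar R.
  rewrite -EFinM sqrtrM ?pi_ge0// sqrtrV//; congr EFin.
  have := sqr_sqrtr (ler0n R 2); set s := Num.sqrt 2 => ss.
  have s0 : s != 0 by rewrite /s gt_eqF// sqrtr_gt0.
  by rewrite -ss; field.
rewrite -E muleA -EFinM divff ?mul1e// gt_eqF// sqrtr_gt0.
Qed.

Lemma integrable_normM_gss : leb.-integrable setT (EFin \o (fun y => `|y| * gss y)).
Proof.
have s2 : 0 < 2^-1 :> R by rewrite invr_gt0.
apply: le_integrable (integrable_expR_sqr s2) => //.
  apply/measurable_EFinP; apply: measurable_funM; last exact: measurable_gss.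
  exact: normr_measurable.
move=> y _ /=; rewrite lee_fin normrM normr_id (ger0_norm (gss_ge0 y)) (ger0_norm (expR_ge0 _)).
have -> : expR (- (2^-1 * y) ^+ 2) = expR (y ^+ 2 / 4) * gss y :> R.
  by rewrite /gss -expRD; congr expR; field.
(* [|y| <= 1 + y^2 / 4 <= e^(y^2 / 4)], where the first inequality is [(1 - |y| / 2)^2 >= 0]. *)
rewrite ler_wpM2r ?gss_ge0//.
have := sqr_ge0 (1 - `|y| / 2); have := expR_ge1Dx (y ^+ 2 / 4).
rewrite -(real_normK (num_real y)); set u := `|y|; set e := expR _; lra.
Qed.

(** * Differentiation under the integral sign and integration over a half-line *)

Lemma is_derive_integral (D : set T) (f f' : R -> T -> R) (G : T -> R) (a : R) :
  measurable D ->
  (forall (x : R) y, is_derive x 1 (f ^~ y) (f' x y)) ->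
  (forall x, leb.-integrable D (EFin \o f x)) ->
  (forall y, 0 <= G y) -> leb.-integrable D (EFin \o G) ->
  (forall x y, `|x - a| < 1 -> D y -> `|f' x y| <= G y) ->
  is_derive a 1 (fun x => \int[leb]_(y in D) f x y) (\int[leb]_(y in D) f' a y).
Proof.
move=> mD df intf G0 intG fG.
have d1 x y : derive1 (f ^~ y) x = f' x y.
  by rewrite derive1E; apply: derive_val.
have Ia : `]a - 1, a + 1[%classic a by rewrite /= in_itv/=; apply/andP; split; lra.
have near_a x : `]a - 1, a + 1[%classic x -> `|x - a| < 1.
  by rewrite /= in_itv/= => /andP[? ?]; rewrite ltr_norml; apply/andP; split; lra.
have H1 x y : `]a - 1, a + 1[%classic x -> D y -> derivable (f ^~ y) x 1.
  by move=> _ _; exact: ex_derive.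
have H2 x y : `]a - 1, a + 1[%classic x -> D y -> `|partial1of2 f x y| <= G y.
  by move=> /near_a xa Dy; rewrite /partial1of2 d1 fG.
apply: DeriveDef.
  exact: (@derivable_under_integral _ _ T leb f D mD a _ _ Ia (fun x _ => intf x) H1 G G0 intG H2).
rewrite -derive1E.
rewrite (@differentiation_under_integral _ _ T leb f D mD a _ _ Ia (fun x _ => intf x) H1 G G0 intG H2).
by apply: eq_Rintegral => y _; rewrite /partial1of2 d1.
Qed.

(** The fundamental theorem on [[0, n]] passes to the limit by dominated convergence, with [|f|] as
    the dominating function. *)
Lemma Rintegral_FTC2y (F f : R -> R) (l : R) :
  continuous f -> (forall x : R, is_derive x 1 F (f x)) ->
  leb.-integrable `[0, +oo[ (EFin \o f) -> F x @[x --> +oo] --> l ->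
  \int[leb]_(x in `[0, +oo[) f x = l - F 0.
Proof.
move=> cf dF intf Fl.
have mf : measurable_fun setT f by exact: continuous_measurable_fun.
pose g n : R -> \bar R := (EFin \o f) \_ `[0, n%:R].
have mg n : measurable_fun (`[0, +oo[ : set R) (g n).
  apply: measurable_funTS; apply/(measurable_restrictT _ _).1 => //.
  by apply: measurable_funTS; exact/measurable_EFinP.
have gf : {ae leb, forall x, `[0, +oo[%classic x -> g ^~ x @ \oo --> (EFin \o f) x}.
  apply: aeW => x /=; rewrite in_itv/= andbT => x0; apply: cvg_near_cst.
  near=> n; rewrite /g /patch mem_setE/= in_itv/= x0 (_ : x <= n%:R)//.
  by near: n; exact: nbhs_infty_ger.
have intn : leb.-integrable `[0, +oo[ (fun x => `|(EFin \o f) x|%E).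
  exact: integrable_abse.
have gle : {ae leb, forall x n, `[0, +oo[%classic x -> (`|g n x| <= `|(EFin \o f) x|)%E}.
  apply: aeW => x n _; rewrite /g /patch; case: ifP => //=.
  by rewrite normr0 lee_fin.
have mf' : measurable_fun (`[0, +oo[ : set R) (EFin \o f).
  by apply: measurable_funTS; exact/measurable_EFinP.
have [//|_ _ gcvg] := @dominated_convergence _ _ _ leb _ _ g (EFin \o f) _ mg mf' gf intn gle.
(* The shift to [n.+1] keeps the interval of integration nondegenerate. *)
have gE n : (\int[leb]_(x in `[0%R, +oo[) g n.+1 x = (F n.+1%:R - F 0)%:E)%E.
  rewrite /g -integral_mkcondr setIidr; last first.
    by apply: subset_itvl.
  rewrite EFinB; apply: continuous_FTC2 => //.
  - exact: continuous_subspaceT.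
  - have cF x : {for x, continuous F} by apply: differentiable_continuous; apply/derivable1_diffP; exact: ex_derive.
    split; [by move=> x _; exact: ex_derive| |].
    + exact/cvg_at_right_filter/cF.
    + exact/cvg_at_left_filter/cF.
  - by move=> x _; rewrite derive1E derive_val.
rewrite /Rintegral; apply/EFin_inj; rewrite fineK; last exact: integrable_fin_num.
suff H : (\int[leb]_(x in `[0%R, +oo[) g n x)%E @[n --> \oo] --> (l - F 0)%:E.
  exact: (cvg_unique _ gcvg H).
rewrite -cvg_shiftS [X in X @ _ --> _](_ : _ = (fun n => (F n.+1%:R - F 0)%:E)); last first.
  by apply/funext => n; exact: gE.
apply: cvg_EFin; first exact: nearW.
apply: cvgB; last exact: cvg_cst.
rewrite (cvg_shiftS (fun n => F n%:R)).
by move/cvg_pinftyP : Fl; apply; exact: cvgr_idn.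
Unshelve. all: end_near. Qed.

Lemma is_derive_Mr a z : is_derive a 1 (fun x => x * z) z.
Proof.
have := @is_deriveM R R id (cst z) a 1 1 0 (is_derive_id _ _) (is_derive_cst _ _ _).
by rewrite scaler0 add0r /GRing.scale/= mulr1.
Qed.

Lemma is_derive_cosM a z : is_derive a 1 (fun x => cos (x * z)) (- sin (a * z) * z).
Proof. exact: (is_derive1_comp (is_derive_cos _) (is_derive_Mr a z)). Qed.

Lemma is_derive_sinM a z : is_derive a 1 (fun x => sin (x * z)) (cos (a * z) * z).
Proof. exact: (is_derive1_comp (is_derive_sin _) (is_derive_Mr a z)). Qed.

Lemma is_derive_expR_sqr (s a : R) :
  is_derive a 1 (fun x => expR (s * x ^+ 2 / 2)) (s * a * expR (s * a ^+ 2 / 2)).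
Proof.
have d : is_derive a 1 (fun x => s * x ^+ 2 / 2) (s * a).
  rewrite (_ : (fun x => s * x ^+ 2 / 2) = (s / 2) \*: (id ^+ 2)); last first.
    by apply/funext => x; rewrite /GRing.scale/= fctE mulrAC.
  apply: is_derive_eq; rewrite /GRing.scale/= mulr1.
  by rewrite expr1 -mulr_natr; field.
have := is_derive1_comp (is_derive_expR _) d.
by rewrite mulrC.
Qed.

Lemma is_derive_gss a : is_derive a 1 gss (- a * gss a).
Proof.
have := is_derive_expR_sqr (-1) a.
rewrite mulN1r (_ : (fun x => _) = gss); last first.
  by apply/funext => x; rewrite /gss mulN1r.
by rewrite mulN1r.
Qed.

Lemma continuous_cosM a : continuous (fun z => cos (a * z)).
Proof.
move=> x; apply: continuous_comp; first exact: mulrl_continuous.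
exact: continuous_cos.
Qed.

Lemma continuous_sinM a : continuous (fun z => sin (a * z)).
Proof.
move=> x; apply: continuous_comp; first exact: mulrl_continuous.
exact: continuous_sin.
Qed.

Lemma integrable_gss_bounded (D : set T) (h : R -> R) : measurable D ->
  measurable_fun setT h ->
  (forall z, `|h z| <= 1) -> leb.-integrable D (EFin \o (fun z => gss z * h z)).
Proof.
move=> mD mh h1.
have iD : leb.-integrable D (EFin \o gss).
  exact: integrableS integrable_gss.
apply: le_integrable iD => //.
  apply/measurable_EFinP/measurable_funTS/measurable_funM => //.
  exact: measurable_gss.
move=> z _ /=; rewrite lee_fin normrM (ger0_norm (gss_ge0 z)).
by rewrite ler_piMr// gss_ge0.
Qed.

Lemma integrable_id_gss_bounded (D : set T) (h : R -> R) : measurable D ->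
  measurable_fun setT h ->
  (forall z, `|h z| <= 1) -> leb.-integrable D (EFin \o (fun z => z * gss z * h z)).
Proof.
move=> mD mh h1.
have iD : leb.-integrable D (EFin \o (fun y => `|y| * gss y)).
  exact: integrableS integrable_normM_gss.
apply: le_integrable iD => //.
  apply/measurable_EFinP/measurable_funTS/measurable_funM => //.
  by apply: measurable_funM => //; exact: measurable_gss.
move=> z _ /=; rewrite lee_fin !normrM normr_id (ger0_norm (gss_ge0 z)).
by rewrite ler_piMr// mulr_ge0// gss_ge0.
Qed.

Lemma cvg_gss_bounded (h : R -> R) : (forall z, `|h z| <= 1) ->
  gss z * h z @[z --> +oo] --> 0.
Proof.
move=> h1.
have g0 : gss z @[z --> +oo] --> (0 : R).
  rewrite (_ : gss = gauss_fun \o (fun y => (Num.sqrt 2)^-1 * y)); last first.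
    by apply/funext => y; rewrite gssE.
  apply: (cvg_comp _ _ _ (@cvg_gauss_fun R)).
  by apply: gt0_cvgMry => //; rewrite invr_gt0 sqrtr_gt0.
apply: norm_cvg0; apply: (@squeeze_cvgr _ _ _ _ (cst 0) gss) => //; last exact: cvg_cst.
apply: nearW => z; rewrite normr_ge0/= normrM (ger0_norm (gss_ge0 z)).
by rewrite ler_piMr// gss_ge0.
Qed.

(** [gcos] and [gsin] are the real and imaginary parts of the half-line Fourier transform of the
    Gaussian. *)
Definition gcos a : R := \int[leb]_(z in `[0, +oo[) (gss z * cos (a * z)).
Definition gsin a : R := \int[leb]_(z in `[0, +oo[) (gss z * sin (a * z)).

Lemma continuous_derivable (f f' : R -> R) : (forall x : R, is_derive x 1 f (f' x)) -> continuous f.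
Proof.
move=> df x; apply: differentiable_continuous; apply/derivable1_diffP.
exact: ex_derive.
Qed.

Lemma is_deriveMr (f g : R -> R) (x a b : R) : is_derive x 1 f a -> is_derive x 1 g b ->
  is_derive x 1 (fun z => f z * g z) (a * g x + f x * b).
Proof.
move=> df dg; have := is_deriveM df dg.
by rewrite /GRing.scale/= addrC (mulrC a).
Qed.

(** The derivative of [gss z] is [- z * gss z]. The boundary term at infinity vanishes because [h]
    is bounded, and the one at 0 is [h 0]. *)
Lemma gss_by_parts (h k : R -> R) a : continuous k ->
  (forall z, is_derive z 1 h (a * k z)) ->
  (forall z, `|h z| <= 1) -> (forall z, `|k z| <= 1) ->
  \int[leb]_(z in `[0, +oo[) (z * gss z * h z) =
  h 0 + a * \int[leb]_(z in `[0, +oo[) (gss z * k z).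
Proof.
move=> ck dh h1 k1.
have ch : continuous h by exact: continuous_derivable.
have mD : measurable (`[0, +oo[%classic : set T) by exact: measurable_itv.
have mh := continuous_measurable_fun ch.
have mk := continuous_measurable_fun ck.
have i1 := integrable_id_gss_bounded mD mh h1.
have i2 := integrable_gss_bounded mD mk k1.
pose F z := gss z * h z.
pose f z := a * (gss z * k z) - z * gss z * h z.
have dF z : is_derive z 1 F (f z).
  have -> : f z = - z * gss z * h z + gss z * (a * k z) by rewrite /f; ring.
  by apply: is_deriveMr; exact: is_derive_gss.
have i2a : leb.-integrable `[0, +oo[ (EFin \o (fun z => a * (gss z * k z))).
  exact: integrable_realZ.
have cf : continuous f.
  move=> z; apply: (@continuousB _ _ _ (fun z => a * (gss z * k z)) (fun z => z * gss z * h z)).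
    apply: (@continuousM _ _ (fun=> a) (fun z => gss z * k z)); first exact: cst_continuous.
    by apply: (@continuousM _ _ gss k); [exact: continuous_gss|exact: ck].
  apply: (@continuousM _ _ (fun z => z * gss z) h); last exact: ch.
  by apply: (@continuousM _ _ id gss); [exact: cvg_id|exact: continuous_gss].
have intf : leb.-integrable `[0, +oo[ (EFin \o f) by exact: integrable_realB.
have := Rintegral_FTC2y cf dF intf (cvg_gss_bounded h1).
have -> : F 0 = h 0 by rewrite /F /gss expr0n oppr0 mul0r expR0 mul1r.
by rewrite RintegralB// RintegralZl// => E; lra.
Qed.

Lemma integral_id_gss_cos a :
  \int[leb]_(z in `[0, +oo[) (z * gss z * cos (a * z)) = 1 - a * gsin a.
Proof.
have dh z : is_derive z 1 (fun z => cos (a * z)) (a * - sin (a * z)).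
  have := is_derive_cosM z a; rewrite (mulrC z) [X in is_derive _ _ _ X]mulrC.
  rewrite (_ : (fun x : R => cos (x * a)) = (fun x => cos (a * x)))//.
  by apply/funext => x; rewrite mulrC.
have ck : continuous (fun z => - sin (a * z)).
  by move=> z; apply: continuousN; exact: continuous_sinM.
have k1 z : `|- sin (a * z)| <= 1 by rewrite normrN; exact: sin_max.
rewrite [LHS](gss_by_parts ck dh (fun z => cos_max _) k1).
rewrite mulr0 cos0; congr (_ + _).
under eq_Rintegral do rewrite mulrN -mulN1r.
rewrite RintegralZl; [by rewrite mulN1r mulrN|exact: measurable_itv|].
apply: integrable_gss_bounded; [exact: measurable_itv| |by move=> z; exact: sin_max].
exact: continuous_measurable_fun (continuous_sinM (a := a)).
Qed.

Lemma integral_id_gss_sin a :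
  \int[leb]_(z in `[0, +oo[) (z * gss z * sin (a * z)) = a * gcos a.
Proof.
have dh z : is_derive z 1 (fun z => sin (a * z)) (a * cos (a * z)).
  have := is_derive_sinM z a; rewrite (mulrC z) [X in is_derive _ _ _ X]mulrC.
  rewrite (_ : (fun x : R => sin (x * a)) = (fun x => sin (a * x)))//.
  by apply/funext => x; rewrite mulrC.
rewrite [LHS](gss_by_parts (continuous_cosM (a := a)) dh (fun z => sin_max _) (fun z => cos_max _)).
by rewrite mulr0 sin0 add0r.
Qed.

(** Differentiation under the integral brings out a factor [z], which integration by parts removes
    again; this closes the differential equation. *)
Lemma is_derive_gcos a : is_derive a 1 gcos (- a * gcos a).
Proof.
have mD : measurable (`[0, +oo[%classic : set T) by exact: measurable_itv.
have -> : - a * gcos a = \int[leb]_(z in `[0, +oo[) (gss z * (- sin (a * z) * z)).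
  rewrite mulNr -integral_id_gss_sin -mulN1r -RintegralZl//.
    by apply: eq_Rintegral => z _; ring.
  apply: integrable_id_gss_bounded => //; last by move=> z; exact: sin_max.
  exact: continuous_measurable_fun (continuous_sinM (a := a)).
apply: (@is_derive_integral _ (fun (x : R) z => gss z * cos (x * z))
  (fun x z => gss z * (- sin (x * z) * z)) (fun z => `|z| * gss z)) => //.
- move=> x z; have := @is_deriveMr (cst (gss z)) _ x _ _ (is_derive_cst _ _ _) (is_derive_cosM x z).
  by rewrite mul0r add0r.
- move=> x; apply: integrable_gss_bounded => //; last by move=> z; exact: cos_max.
  exact: continuous_measurable_fun (continuous_cosM (a := x)).
- by move=> z; rewrite mulr_ge0// gss_ge0.
- exact: integrableS integrable_normM_gss.
- move=> x z _ _; rewrite !normrM (ger0_norm (gss_ge0 z)) mulrC ler_wpM2r ?gss_ge0//.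
  by rewrite normrN ler_piMl//; exact: sin_max.
Qed.

Lemma is_derive_gsin a : is_derive a 1 gsin (1 - a * gsin a).
Proof.
have mD : measurable (`[0, +oo[%classic : set T) by exact: measurable_itv.
have -> : 1 - a * gsin a = \int[leb]_(z in `[0, +oo[) (gss z * (cos (a * z) * z)).
  by rewrite -integral_id_gss_cos; apply: eq_Rintegral => z _; ring.
apply: (@is_derive_integral _ (fun (x : R) z => gss z * sin (x * z))
  (fun x z => gss z * (cos (x * z) * z)) (fun z => `|z| * gss z)) => //.
- move=> x z; have := @is_deriveMr (cst (gss z)) _ x _ _ (is_derive_cst _ _ _) (is_derive_sinM x z).
  by rewrite mul0r add0r.
- move=> x; apply: integrable_gss_bounded => //; last by move=> z; exact: sin_max.
  exact: continuous_measurable_fun (continuous_sinM (a := x)).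
- by move=> z; rewrite mulr_ge0// gss_ge0.
- exact: integrableS integrable_normM_gss.
- move=> x z _ _; rewrite !normrM (ger0_norm (gss_ge0 z)) mulrC ler_wpM2r ?gss_ge0//.
  by rewrite ler_piMl//; exact: cos_max.
Qed.

Lemma is_derive_expR_sqrM (s t x : R) :
  is_derive x 1 (fun x => expR (s * (t * x) ^+ 2 / 2))
    (s * t ^+ 2 * x * expR (s * (t * x) ^+ 2 / 2)).
Proof.
have E y : s * (t * y) ^+ 2 = s * t ^+ 2 * y ^+ 2 by ring.
have -> : (fun y : R => expR (s * (t * y) ^+ 2 / 2)) =
    (fun y => expR (s * t ^+ 2 * y ^+ 2 / 2)) by apply/funext => y; rewrite E.
by rewrite E; exact: is_derive_expR_sqr.
Qed.

Lemma continuous_expR_sqrM (s x : R) :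
  continuous (fun t : R => expR (s * (t * x) ^+ 2 / 2)).
Proof.
apply: (@continuous_derivable _ (fun t => s * x ^+ 2 * t * expR (s * (x * t) ^+ 2 / 2))) => t.
rewrite (_ : (fun _ => _) = (fun t => expR (s * (x * t) ^+ 2 / 2))); first exact: is_derive_expR_sqrM.
by apply/funext => y; rewrite (mulrC x).
Qed.

(* For s = -1 and s = 1 this is int_0^w e^(-t^2/2) dt and int_0^w e^(t^2/2) dt,
   in the shape in which they occur in Phi w and Phi (- i w). *)
Definition gerf (s w : R) : R := \int[leb]_(t in `[0, 1]) (expR (s * (t * w) ^+ 2 / 2) * w).

(** On the fixed segment [[0, 1]], the derivative of the integrand in [w] equals the derivative of
    [t e^(s (t w)^2 / 2)] in [t], so its integral is the boundary value at [t = 1]. *)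
Lemma is_derive_gerf (s w : R) : is_derive w 1 (gerf s) (expR (s * w ^+ 2 / 2)).
Proof.
have mD : measurable (`[0, 1]%classic : set T) by exact: measurable_itv.
pose f' (x t : R) := expR (s * (t * x) ^+ 2 / 2) * (1 + s * (t * x) ^+ 2).
have ce x := @continuous_expR_sqrM s x.
have cf' x : continuous (f' x).
  have cq : continuous (fun t : R => (t * x) ^+ 2).
    move=> t; apply: (@continuous_comp _ _ _ (fun t : R => t * x) (fun y : R => y ^+ 2)).
      exact: mulrr_continuous.
    exact: exprn_continuous.
  move=> t; apply: (@continuousM _ _ (fun t : R => expR (s * (t * x) ^+ 2 / 2))
    (fun t : R => 1 + s * (t * x) ^+ 2)); first exact: ce.
  apply: (@continuousD _ _ _ (fun _ : R => 1 : R) (fun t : R => s * (t * x) ^+ 2)).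
    exact: cst_continuous.
  apply: (@continuousM _ _ (fun _ : R => s) (fun t : R => (t * x) ^+ 2)).
    exact: cst_continuous.
  exact: cq.
have -> : expR (s * w ^+ 2 / 2) = \int[leb]_(t in `[0, 1]) (f' w t).
  pose F (t : R) := t * expR (s * (t * w) ^+ 2 / 2).
  have dF (t : R) : is_derive t 1 F (f' w t).
    have -> : f' w t = 1 * expR (s * (t * w) ^+ 2 / 2) + t * (s * w ^+ 2 * t * expR (s * (w * t) ^+ 2 / 2)).
      by rewrite /f' (mulrC w t); ring.
    apply: (@is_deriveMr id (fun t : R => expR (s * (t * w) ^+ 2 / 2)) t 1
      (s * w ^+ 2 * t * expR (s * (w * t) ^+ 2 / 2)) (is_derive_id _ _)).
    rewrite (_ : (fun _ => _) = (fun t => expR (s * (w * t) ^+ 2 / 2))); first exact: is_derive_expR_sqrM.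
    by apply/funext => y; rewrite (mulrC w).
  rewrite /Rintegral (@continuous_FTC2 _ _ F)//.
  - by rewrite -EFinB /F /= !mul1r mul0r subr0.
  - exact/continuous_subspaceT.
  - have cF := continuous_derivable dF.
    split; [by move=> x _; exact: ex_derive|exact/cvg_at_right_filter/cF|exact/cvg_at_left_filter/cF].
  - by move=> x _; rewrite derive1E derive_val.
(* For [|x - w| < 1] and [t] in [[0, 1]] one has [|t x| <= M], so the constant [B] dominates
   [f' x t]. *)
pose M := `|w| + 1.
have M0 : 0 <= M by rewrite addr_ge0.
pose B := expR (`|s| * M ^+ 2 / 2) * (1 + `|s| * M ^+ 2).
have B0 : 0 <= B by rewrite mulr_ge0 ?expR_ge0// addr_ge0// mulr_ge0// exprn_ge0.
apply: (@is_derive_integral _ (fun (x : R) t => expR (s * (t * x) ^+ 2 / 2) * x) f' (cst B)) => //.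
- move=> x t; have -> : f' x t = s * t ^+ 2 * x * expR (s * (t * x) ^+ 2 / 2) * x + expR (s * (t * x) ^+ 2 / 2) * 1.
    by rewrite /f'; ring.
  exact: (@is_deriveMr (fun x : R => expR (s * (t * x) ^+ 2 / 2)) id x _ 1
    (is_derive_expR_sqrM _ _ _) (is_derive_id _ _)).
- move=> x; apply: continuous_compact_integrable; first exact: segment_compact.
  apply: continuous_subspaceT => t.
  by apply: (@continuousM _ _ (fun t : R => expR (s * (t * x) ^+ 2 / 2)) (fun=> x));
    [exact: ce|exact: cst_continuous].
- apply: continuous_compact_integrable; first exact: segment_compact.
  by apply: continuous_subspaceT; exact: cst_continuous.
move=> x t xw /=; rewrite in_itv/= => /andP[t0 t1].
have xM : `|t * x| <= M.
  rewrite normrM (ger0_norm t0) (le_trans (ler_piMl _ t1))//.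
  rewrite /M -[x](subrK w) addrC (le_trans (ler_normD _ _))// lerD2l.
  by rewrite ltW// (le_lt_trans _ xw)// distrC.
have sM : s * (t * x) ^+ 2 <= `|s| * M ^+ 2.
  rewrite (le_trans (ler_norm _))// normrM normrX ler_wpM2l// lerXn2r//.
rewrite normrM ger0_norm ?expR_ge0// ler_pM ?expR_ge0//.
  by rewrite ler_expR ler_pM2r.
rewrite (le_trans (ler_normD _ _))// normr1 lerD2l.
by rewrite normrM normrX ler_wpM2l// lerXn2r.
Qed.

Lemma gerf0 s : gerf s 0 = 0.
Proof.
rewrite /gerf; under eq_Rintegral do rewrite mulr0.
by rewrite Rintegral_cst ?mul0r.
Qed.

Let segment_integrable (f : R -> R) : continuous f -> leb.-integrable `[0, 1] (EFin \o f).
Proof.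
move=> cf; apply: continuous_compact_integrable; first exact: segment_compact.
exact: continuous_subspaceT.
Qed.

Lemma gerf_opp (s w : R) : gerf s (- w) = - gerf s w.
Proof.
rewrite -[RHS]mulN1r /gerf -RintegralZl.
- by apply: eq_Rintegral => t _; rewrite (mulrN t) sqrrN mulN1r mulrN.
- exact: measurable_itv.
- apply: segment_integrable => t.
  apply: (@continuousM _ _ (fun t : R => expR (s * (t * w) ^+ 2 / 2)) (fun=> w));
    last exact: cst_continuous.
  exact: continuous_expR_sqrM.
Qed.

(* The functions gcos and gsin solve u' = - a u and u' = 1 - a u. *)
Lemma eq_gcos a : gcos a = Num.sqrt (pi / 2) * gss a.
Proof.
have dE (x : R) : is_derive x 1 (fun x => gcos x * expR (1 * x ^+ 2 / 2)) 0.
  have := is_deriveMr (is_derive_gcos x) (is_derive_expR_sqr 1 x).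
  by rewrite [X in is_derive _ _ _ X -> _](_ : _ = 0)//; ring.
have := is_derive_0_is_cst a 0 dE.
rewrite expr0n mulr0 mul0r expR0 mulr1 mul1r (_ : gcos 0 = Num.sqrt (pi / 2)); last first.
  rewrite /gcos; under eq_Rintegral do rewrite mul0r cos0 mulr1.
  by rewrite /Rintegral integral_gss_pos.
by move=> <-; rewrite /gss -mulrA -expRD mulNr subrr expR0 mulr1.
Qed.

Lemma eq_gsin a : gsin a = gss a * gerf 1 a.
Proof.
(* [e^(x^2 / 2)] is the integrating factor; it turns the inhomogeneous term 1 into the derivative of
   [gerf 1]. *)
have dE (x : R) : is_derive x 1 (fun x => gsin x * expR (1 * x ^+ 2 / 2) - gerf 1 x) 0.
  have := is_deriveB (is_deriveMr (is_derive_gsin x) (is_derive_expR_sqr 1 x)) (is_derive_gerf 1 x).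
  by rewrite [X in is_derive _ _ _ X -> _](_ : _ = 0)//; ring.
have := is_derive_0_is_cst a 0 dE.
rewrite gerf0 subr0 (_ : gsin 0 = 0) ?mul0r; last first.
  rewrite /gsin; under eq_Rintegral do rewrite mul0r sin0 mulr0.
  by rewrite Rintegral_cst ?mul0r.
move=> /eqP; rewrite subr_eq0 mul1r => /eqP <-.
by rewrite mulrCA /gss -expRD mulNr addNr expR0 mulr1.
Qed.

Lemma integral_gss_ge w :
  (\int[leb]_(t in `[w, +oo[) (gss t)%:E)%E = (Num.sqrt (pi / 2) - gerf (-1) w)%:E.
Proof.
have dE (x : R) : is_derive x 1 (gerf (-1)) (gss x).
  by have := is_derive_gerf (-1) x; rewrite mulN1r.
have cE := continuous_derivable dE.
have FTC a b : (a < b)%R ->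
    (\int[leb]_(t in `[a, b[) (gss t)%:E = (gerf (-1) b - gerf (-1) a)%:E)%E.
  move=> ab; rewrite integral_itv_bndo_bndc; last first.
    by apply/measurable_EFinP/measurable_funTS; exact: measurable_gss.
  rewrite EFinB; apply: continuous_FTC2 => //.
  - exact/continuous_subspaceT/continuous_gss.
  - split; [by move=> x _; exact: ex_derive|exact/cvg_at_right_filter/cE|exact/cvg_at_left_filter/cE].
  - by move=> x _; rewrite derive1E derive_val.
have split_itv a b : a < b ->
    (\int[leb]_(t in `[a, +oo[) (gss t)%:E =
     (gerf (-1) b - gerf (-1) a)%:E + \int[leb]_(t in `[b, +oo[) (gss t)%:E)%E.
  move=> ab; rewrite -FTC// -ge0_integral_setU//=.
  - congr (integral _ _ _); rewrite -itv_bndbnd_setU//; exact: ltW.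
  - by apply/measurable_EFinP/measurable_funTS; exact: measurable_gss.
  - by move=> x _; rewrite lee_fin gss_ge0.
  - apply: lt_disjoint => x y; rewrite !in_itv/= andbT => /andP[_ xb] /(lt_le_trans xb).
    by [].
have [w0|w0|->] := ltgtP w 0.
- rewrite (split_itv _ _ w0) integral_gss_pos -EFinD gerf0; congr EFin; ring.
(* Here the tail is the unknown: the known finite value over [[0, +oo[] forces it to be finite and
   then determines it. *)
- have := split_itv _ _ w0; rewrite integral_gss_pos gerf0 subr0.
  by case: (integral _ _ _) => [r| |]// [->]; congr EFin; ring.
- by rewrite integral_gss_pos gerf0 subr0.
Qed.

(** * The kernel sin (w y) / y *)

Lemma norm_sin_le (x : R) : `|sin x| <= `|x|.
Proof.
wlog x0 : x / 0 <= x.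
  move=> H; have [/H//|/ltW x0] := leP 0 x.
  by have := H (- x); rewrite oppr_ge0 sinN !normrN; exact.
have [c _] := @MVT_segment R sin cos 0 x x0 (fun y _ => is_derive_sin y)
   (continuous_subspaceT (@continuous_sin R)).
rewrite sin0 !subr0 => ->; rewrite normrM ler_piMl//; exact: cos_max.
Qed.

Lemma Rintegral_scale (a : R) (f : R -> R) : 0 < a ->
  leb.-integrable setT (EFin \o f) ->
  leb.-integrable setT (EFin \o (fun x => f (a * x))) /\
  \int[leb]_x f x = a * \int[leb]_x f (a * x).
Proof.
move=> a0 intf.
have mf : measurable_fun setT (EFin \o f) by exact: measurable_int intf.
have mfa : measurable_fun setT (EFin \o (fun x => f (a * x))).
  by apply: (measurableT_comp mf); exact: measurable_funM.
have ifa : leb.-integrable setT (EFin \o (fun x => f (a * x))).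
  apply/integrableP; split => //.
  have := ge0_integral_scale a0 (f := fun x => `|(EFin \o f) x|%E).
  move=> /(_ _ _) E; rewrite ltey; apply/eqP => ioo.
  have /integrableP[_] := intf; rewrite -E//; last exact: measurableT_comp.
  by rewrite [X in (_ * X)%E]ioo gt0_muley ?lte_fin.
split => //; apply: EFin_inj.
rewrite EFinM /Rintegral !fineK; [|exact: integrable_fin_num..].
rewrite integralE [in RHS]integralE muleBr//; last first.
  by rewrite fin_num_adde_defl// fin_numN; exact: integrable_neg_fin_num ifa.
congr (_ - _)%E.
  rewrite -[LHS](ge0_integral_scale a0); last by move=> x; exact: funepos_ge0.
    by congr (_ * _)%E; apply: eq_integral => x _; rewrite !funeposE.
  exact: measurable_funepos.
rewrite -[LHS](ge0_integral_scale a0); last by move=> x; exact: funeneg_ge0.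
  by congr (_ * _)%E; apply: eq_integral => x _; rewrite !funenegE.
exact: measurable_funeneg.
Qed.

(** The power with exponent -1 agrees with the inverse only on nonnegative numbers, hence the detour
    through [y ^+ 2]; at 0 both sides are 0. *)
Lemma measurable_inv : measurable_fun setT (fun y : R => y^-1).
Proof.
rewrite (_ : (fun y : R => y^-1) = (fun y => y * (y ^+ 2) `^ (-1))).
  apply: measurable_funM => //.
  by apply: (measurableT_comp (@measurable_powR R (-1))); exact: measurable_funX.
apply/funext => y; rewrite powR_inv1 ?sqr_ge0//.
have [->|y0] := eqVneq y 0; first by rewrite invr0 mul0r.
by field.
Qed.

Lemma integrable_sinc (s w : R) : 0 < s ->
  leb.-integrable setT (EFin \o (fun y => expR (- (s * y ^+ 2) / 2) * (sin (w * y) / y))).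
Proof.
move=> s0; have a0 : 0 < Num.sqrt (s / 2) by rewrite sqrtr_gt0 divr_gt0.
have i0 : leb.-integrable setT (EFin \o (fun y => `|w| * expR (- (Num.sqrt (s / 2) * y) ^+ 2))).
  by apply: integrable_realZ => //; exact: integrable_expR_sqr.
apply: le_integrable i0 => //.
  apply/measurable_EFinP; apply: measurable_funM.
    apply: measurableT_comp => //; apply: measurable_funM => //.
    by apply: measurableT_comp => //; apply: measurable_funM => //; exact: measurable_funX.
  apply: measurable_funM; last exact: measurable_inv.
  exact: continuous_measurable_fun (continuous_sinM (a := w)).
move=> y _ /=; rewrite lee_fin exprMn sqr_sqrtr ?divr_ge0 ?(ltW s0)// !normrM normr_id.
rewrite mulrC (_ : - (s * y ^+ 2) / 2 = - (s / 2 * y ^+ 2)); last by field.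
rewrite ler_wpM2r// normfV; have [->|y0] := eqVneq y 0; first by rewrite normr0 invr0 mulr0.
by rewrite ler_pdivrMr ?normr_gt0// -normrM norm_sin_le.
Qed.

(** The derivative in [w] cancels the denominator and leaves [gcos w], a multiple of [gss w], whose
    antiderivative is [gerf (-1)]. Both sides vanish at [w = 0]. *)
Lemma Rintegral_sinc (w : R) :
  \int[leb]_(y in `]0, +oo[) (gss y * (sin (w * y) / y)) =
  Num.sqrt (pi / 2) * gerf (-1) w.
Proof.
have mD : measurable (`]0, +oo[%classic : set T) by exact: measurable_itv.
pose f (x y : R) := gss y * (sin (x * y) / y).
pose F (x : R) := \int[leb]_(y in `]0, +oo[) f x y.
have intf x : leb.-integrable `]0, +oo[ (EFin \o f x).
  apply: (@integrableS _ _ _ leb setT) => //.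
  apply: eq_integrable (integrable_sinc x ltr01) => // y _.
  by rewrite /f /gss /= mul1r.
have dF (x : R) : is_derive x 1 F (Num.sqrt (pi / 2) * gss x).
  have -> : Num.sqrt (pi / 2) * gss x =
      \int[leb]_(y in `]0, +oo[) (gss y * (cos (x * y) * y / y)).
    rewrite -eq_gcos /gcos -Rintegral_itv_obnd_cbnd.
      apply: eq_Rintegral => y; rewrite inE/= in_itv/= andbT => y0.
      by rewrite mulfK// gt_eqF.
    apply: integrable_gss_bounded => //; last by move=> y; exact: cos_max.
    exact: continuous_measurable_fun (continuous_cosM (a := x)).
  apply: (@is_derive_integral _ f (fun x y => gss y * (cos (x * y) * y / y)) gss) => //.
  - move=> z y; rewrite /f.
    rewrite (_ : (fun x : R => gss y * (sin (x * y) / y)) = (fun x => sin (x * y) * (gss y / y))); last first.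
      by apply/funext => u; ring.
    have := @is_deriveMr _ (cst (gss y / y)) z _ _ (is_derive_sinM z y) (is_derive_cst _ _ _).
    by rewrite [X in is_derive _ _ _ X -> _](_ : _ = gss y * (cos (z * y) * y / y))//=; ring.
  - by move=> y; exact: gss_ge0.
  - exact: integrableS integrable_gss.
  - move=> z y _; rewrite /= in_itv/= andbT => y0.
    rewrite mulfK ?gt_eqF// normrM (ger0_norm (gss_ge0 y)) ler_piMr ?gss_ge0//.
    exact: cos_max.
have dE (x : R) : is_derive x 1 (fun x => F x - Num.sqrt (pi / 2) * gerf (-1) x) 0.
  have dg := @is_deriveMr (cst (Num.sqrt (pi / 2))) _ x _ _ (is_derive_cst _ _ _) (is_derive_gerf (-1) x).
  have := is_deriveB (dF x) dg.
  by rewrite [X in is_derive _ _ _ X -> _](_ : _ = 0)// mul0r add0r mulN1r subrr.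
have := is_derive_0_is_cst w 0 dE.
rewrite gerf0 mulr0 subr0 (_ : F 0 = 0); last first.
  rewrite /F /f; under eq_Rintegral do rewrite mul0r sin0 mul0r mulr0.
  by rewrite Rintegral_cst ?mul0r.
by move=> /eqP; rewrite subr_eq0 => /eqP.
Qed.

(** The substitution [y |-> sqrt s y] preserves [dy / y], so only the frequency is rescaled. *)
Lemma Rintegral_sinc_scaled (s w : R) : 0 < s ->
  \int[leb]_(y in `]0, +oo[) (expR (- (s * y ^+ 2) / 2) * (sin (w * y) / y)) =
  Num.sqrt (pi / 2) * gerf (-1) (w / Num.sqrt s).
Proof.
move=> s0; set a := Num.sqrt s; have a0 : 0 < a by rewrite sqrtr_gt0.
pose f : R -> R := (fun y => gss y * (sin (w / a * y) / y)) \_ `]0, +oo[.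
have intf : leb.-integrable setT (EFin \o f).
  rewrite /f -restrict_EFin; apply/(integrable_mkcond _ _).1 => //.
  apply: (@integrableS _ _ _ leb setT) => //.
  apply: eq_integrable (integrable_sinc (w / a) ltr01) => // y _.
  by rewrite /gss /= mul1r.
rewrite -Rintegral_sinc Rintegral_mkcond [RHS]Rintegral_mkcond.
rewrite [RHS](Rintegral_scale a0 intf).2 -RintegralZl//; last exact: (Rintegral_scale a0 intf).1.
apply: eq_Rintegral => y _; rewrite /f /patch !mem_setE !in_itv/= !andbT pmulr_rgt0//.
case: ifPn => [y0|_]; last by rewrite mulr0.
have y1 : y != 0 by rewrite gt_eqF.
have a1 : a != 0 by rewrite gt_eqF.
rewrite /gss (_ : w / a * (a * y) = w * y); last by field.
by rewrite exprMn sqr_sqrtr ?(ltW s0)//; field; apply/andP.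
Qed.

(** * Phi on the real and the imaginary axis *)

Lemma Phi_gerf (w : R) :
  Phi w%:C%C = (2^-1 + (Num.sqrt (2 * pi))^-1 * gerf (-1) w)%:C%C.
Proof.
rewrite Phi_real /gerf; congr (_ + _ * _)%:C%C.
by apply: eq_Rintegral => t _; rewrite mulN1r.
Qed.

(** On the imaginary axis the exponent changes sign, which is the case [s = 1] of [gerf]; the factor
    [- i b] from the path makes the integral purely imaginary. *)
Lemma Phi_imag (b : R) :
  Phi (- 'i * b%:C)%C = (2^-1 +i* (- ((Num.sqrt (2 * pi))^-1 * gerf 1 b)))%C.
Proof.
have H t : (expC (- (t%:C * (- 'i * b%:C)) ^+ 2 / 2) * (- 'i * b%:C))%C =
    (0 +i* (- (expR (1 * (t * b) ^+ 2 / 2) * b)))%C.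
  have -> : (- (t%:C * (- 'i * b%:C)) ^+ 2 / 2 = (1 * (t * b) ^+ 2 / 2)%:C)%C.
    have -> : (- (t%:C * (- 'i * b%:C)) ^+ 2 = (1 * (t * b) ^+ 2)%:C)%C.
      by apply/eqP; rewrite eq_complex expr2 /=; apply/andP; split; apply/eqP; ring.
    by rewrite [in RHS]rmorphM fmorphV rmorph_nat.
  rewrite /expC /= cos0 sin0.
  by apply/eqP; rewrite eq_complex /=; apply/andP; split; apply/eqP; ring.
have -> : Phi (- 'i * b%:C)%C = (2^-1 + ((Num.sqrt (2 * pi))^-1)%:C * (0 +i* (- gerf 1 b)))%C.
  rewrite /Phi /cintegral; congr (_ + _ * _)%C; congr (_ +i* _)%C.
    rewrite (@eq_Rintegral _ _ _ _ _ (cst 0)); last by move=> t _; rewrite H.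
    by rewrite Rintegral_cst ?mul0r.
  rewrite /gerf; under eq_Rintegral do rewrite H /= -mulN1r.
  rewrite RintegralZl ?mulN1r//.
  apply: segment_integrable => t.
  apply: (@continuousM _ _ (fun t : R => expR (1 * (t * b) ^+ 2 / 2)) (fun=> b));
    last exact: cst_continuous.
  exact: continuous_expR_sqrM.
have -> : 2^-1 = (2^-1)%:C%C :> R[i] by rewrite fmorphV rmorph_nat.
by apply/eqP; rewrite eq_complex /=; apply/andP; split; apply/eqP; ring.
Qed.

Lemma sqrt_2pi : Num.sqrt (pi / 2) = Num.sqrt (2 * pi) / 2 :> R.
Proof.
have -> : pi / 2 = 2 * pi * (2^-1) ^+ 2 :> R by field.
by rewrite sqrtrM ?mulr_ge0 ?pi_ge0// sqrtr_sqr ger0_norm// invr_ge0.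
Qed.

Lemma cintegral_gss (b : R) :
  cintegral setT (fun z => ((gss \_ `[0, +oo[) z)%:C * (cos (b * z) +i* (- sin (b * z))))%C =
  ((Num.sqrt (2 * pi) * gss b)%:C * Phi (- 'i * b%:C))%C.
Proof.
have P0 : Num.sqrt (2 * pi) != 0 :> R by rewrite gt_eqF// sqrtr_gt0 mulr_gt0// pi_gt0.
have E : cintegral setT (fun z => ((gss \_ `[0, +oo[) z)%:C * (cos (b * z) +i* (- sin (b * z))))%C =
    (gcos b +i* (- gsin b))%C.
  rewrite /cintegral; congr (_ +i* _)%C.
    rewrite /gcos [RHS]Rintegral_mkcond; apply: eq_Rintegral => z _ /=.
    by rewrite /patch; case: ifP => _ /=; [ring|rewrite !mul0r subr0].
  rewrite -mulN1r /gsin -RintegralZl.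
  - rewrite [RHS]Rintegral_mkcond; apply: eq_Rintegral => z _ /=.
    by rewrite /patch; case: ifP => _ /=; [ring|rewrite !mul0r addr0].
  - exact: measurable_itv.
  - apply: integrable_gss_bounded; first exact: measurable_itv.
      exact: continuous_measurable_fun (continuous_sinM (a := b)).
    by move=> z; exact: sin_max.
rewrite E eq_gcos eq_gsin Phi_imag sqrt_2pi.
by apply/eqP; rewrite eq_complex /=; apply/andP; split; apply/eqP; field.
Qed.

End real_analysis.

(** * Gaussian measure of orthants and wedges *)

Section gauss_cones.
Context {R : realType}.
Local Notation T := (measurableTypeR R).
Local Notation leb := (@lebesgue_measure R).
Local Notation s2pi := (Num.sqrt (2 * pi) : R).

Lemma s2pi_gt0 : 0 < s2pi.
Proof. by rewrite sqrtr_gt0 mulr_gt0// pi_gt0. Qed.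

Lemma integral_gss : (\int[leb]_x (gss x)%:E = s2pi%:E)%E.
Proof.
rewrite ge0_symfun_integralT//.
- rewrite (_ : [set x | _] = `[0, +oo[%classic); last first.
    by apply/seteqP; split => x/=; rewrite in_itv/= andbT.
  by rewrite integral_gss_pos sqrt_2pi -EFinM mulrC divfK.
- exact: gss_ge0.
- exact: continuous_gss.
- by move=> x; rewrite /gss /= sqrrN.
Qed.

(** One family for constrained and free coordinates, so that the density of any quadrant is a
    product over all coordinates. *)
Definition half_gss (b : bool) (z : R) : R := (b ==> (0 <= z))%:R * gss z.

Lemma half_gss_ge0 b z : 0 <= half_gss b z.
Proof. by rewrite mulr_ge0// gss_ge0. Qed.

Lemma half_gss_le b z : half_gss b z <= gss z.
Proof. by rewrite /half_gss; case: (_ ==> _); rewrite ?mul1r ?mul0r ?gss_ge0. Qed.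

Lemma half_gssT z : half_gss true z = (gss \_ `[0, +oo[) z.
Proof.
rewrite /half_gss /patch mem_setE in_itv/= andbT.
by case: ifP; rewrite ?mul1r ?mul0r.
Qed.

Lemma half_gssF z : half_gss false z = gss z.
Proof. by rewrite /half_gss mul1r. Qed.

Lemma measurable_half_gss b : measurable_fun setT (half_gss b).
Proof.
case: b; last by rewrite (funext half_gssF); exact: measurable_gss.
rewrite (funext half_gssT); apply/(measurable_restrictT _ _).1 => //.
by apply: measurable_funTS; exact: measurable_gss.
Qed.

Lemma integral_half_gss b : (\int[leb]_z (half_gss b z)%:E = (s2pi / 2 ^+ b)%:E)%E.
Proof.
case: b; last by under eq_integral do rewrite half_gssF; rewrite integral_gss divr1.
rewrite -sqrt_2pi -integral_gss_pos [RHS]integral_mkcond.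
by apply: eq_integral => z _; rewrite half_gssT /patch; case: ifP.
Qed.

Lemma gauss_weight_prod n (c : n.-tuple R) : gauss_weight c = \prod_i gss (tnth c i).
Proof.
rewrite /gauss_weight /gss -expR_sum /sqnorm -sumrN mulr_suml.
by congr expR; apply: eq_bigr => i _.
Qed.

Lemma prod_bool n (P : pred 'I_n) : \prod_i (P i)%:R = [forall i, P i]%:R :> R.
Proof.
case: (boolP [forall i, P i]) => [/forallP h|/forallPn[i hi]].
  by rewrite big1// => i _; rewrite h.
by rewrite (bigD1 i)//= (negbTE hi) mul0r.
Qed.

Lemma measurable_le_indic d (U : measurableType d) (f g : U -> R) :
  measurable_fun setT f -> measurable_fun setT g ->
  measurable_fun setT (fun x => (f x <= g x)%R%:R : R).
Proof.
move=> mf mg; rewrite (_ : (fun x => _) = (fun x => if f x <= g x then 1 else 0)); last first.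
  by apply/funext => x; case: ifP.
by apply: measurable_fun_ifT => //; exact: measurable_fun_ler.
Qed.

Lemma gauss_weight_half n (J : pred 'I_n) (c : n.-tuple R) :
  \prod_i half_gss (J i) (tnth c i) =
  [forall i, J i ==> (0 <= tnth c i)]%:R * gauss_weight c.
Proof. by rewrite gauss_weight_prod /half_gss big_split/= prod_bool. Qed.

Lemma gauss_mkcond n (C : set (n.-tuple T)) (b : n.-tuple T -> bool) :
  (forall c, C c <-> b c) ->
  gauss C = (\int[tleb n]_c ((b c)%:R * gauss_weight c)%:E)%E.
Proof.
move=> Cb; rewrite /gauss integral_mkcond; apply: eq_integral => c _.
rewrite /patch; case: ifPn => [/set_mem/Cb ->|]; first by rewrite mul1r.
by move=> /negP nC; case: (boolP (b c)) => [/Cb /mem_set//|_]; rewrite mul0r.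
Qed.

Lemma gauss_setT n : gauss (setT : set (n.-tuple T)) = (s2pi ^+ n)%:E.
Proof.
rewrite (@gauss_mkcond _ _ xpredT)//.
transitivity (\int[tleb n]_c (\prod_i half_gss false (tnth c i))%:E)%E.
  apply: eq_integral => c _; rewrite gauss_weight_prod mul1r; congr EFin.
  by apply: eq_bigr => i _; rewrite half_gssF.
rewrite (@ge0_integral_tleb_bigprod _ n (fun=> half_gss false) (fun=> s2pi)).
- by rewrite prodr_const card_ord.
- by move=> _; exact: measurable_half_gss.
- by move=> _; exact: half_gss_ge0.
- by move=> _; rewrite integral_half_gss divr1.
Qed.

Definition quadrant n (J : pred 'I_n) : set (n.-tuple T) :=
  [set c | forall i, J i -> 0 <= tnth c i].

Lemma integral_prod_half_gss n (J : pred 'I_n) :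
  (\int[tleb n]_c (\prod_i half_gss (J i) (tnth c i))%:E =
   (s2pi ^+ n / 2 ^+ #|J|)%:E)%E.
Proof.
rewrite (@ge0_integral_tleb_bigprod _ n (fun i => half_gss (J i)) (fun i => s2pi / 2 ^+ J i)).
- rewrite big_split/= prodr_const card_ord prodfV; congr (_ * _^-1)%:E.
  by rewrite prodrXr -sum1_card [in RHS]big_mkcond.
- by move=> i; exact: measurable_half_gss.
- by move=> i; exact: half_gss_ge0.
- by move=> i; exact: integral_half_gss.
Qed.

Lemma gauss_quadrant n (J : pred 'I_n) :
  gauss (quadrant J) = (s2pi ^+ n / 2 ^+ #|J|)%:E.
Proof.
rewrite (@gauss_mkcond _ _ (fun c => [forall i, J i ==> (0 <= tnth c i)])); last first.
  by move=> c; split=> [h|/forallP h i]; [apply/forallP => i; apply/implyP/h|exact/implyP].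
under eq_integral do rewrite -gauss_weight_half.
exact: integral_prod_half_gss.
Qed.

Lemma measurable_gerf : measurable_fun setT (gerf (-1) : R -> R).
Proof.
exact: continuous_measurable_fun (continuous_derivable (is_derive_gerf (-1))).
Qed.

(** This is the normal distribution function at [w], a normalised integral over [[- w, +oo[]. *)
Lemma Phi_real_ge0 (w : R) : 0 <= 2^-1 + s2pi^-1 * gerf (-1) w.
Proof.
have s0 := s2pi_gt0; have s1 : s2pi != 0 by rewrite gt_eqF.
have -> : 2^-1 + s2pi^-1 * gerf (-1) w = s2pi^-1 * (Num.sqrt (pi / 2) - gerf (-1) (- w)).
  by rewrite gerf_opp sqrt_2pi; field.
rewrite mulr_ge0 ?invr_ge0 ?(ltW s0)// -lee_fin -integral_gss_ge.
by apply: integral_ge0 => z _; rewrite lee_fin gss_ge0.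
Qed.

(** Coordinate form of the normal cone at a face G opposite to 0, taken inside its linear hull;
    [a j] will be [tau_j / sqrt s_k]. *)
Definition dual_wedge n (a : 'I_n -> R) : set (n.+1.-tuple T) :=
  [set c | 0 <= tnth c ord0 /\
    forall j, - (a j * tnth c ord0) <= tnth c (lift ord0 j)].

(** Once the head is fixed the other coordinates are independent, and each contributes a tail
    integral, that is, [sqrt (2 pi)] times a value of [Phi]. *)
Lemma gauss_dual_wedge n (a : 'I_n -> R) :
  (gauss (dual_wedge a) = (s2pi ^+ n)%:E *
   \int[leb]_(y in `[0%R, +oo[)
     ((\prod_j (2^-1 + s2pi^-1 * gerf (-1) (a j * y))) * gss y)%:E)%E.
Proof.
pose b (c : n.+1.-tuple T) := (0 <= tnth c ord0) &&
  [forall j, - (a j * tnth c ord0) <= tnth c (lift ord0 j)].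
rewrite (@gauss_mkcond _ _ b); last first.
  move=> c; split => [[h1 h2]|/andP[h1 /forallP h2]]; last by [].
  by apply/andP; split => //; apply/forallP.
have bE (c : n.+1.-tuple T) : (b c)%:R * gauss_weight c =
    (0 <= tnth c ord0)%R%:R * gss (tnth c ord0) *
    \prod_j ((- (a j * tnth c ord0) <= tnth c (lift ord0 j))%R%:R * gss (tnth c (lift ord0 j))) :> R.
  rewrite gauss_weight_prod big_ord_recl big_split/= prod_bool /b mulrACA.
  by rewrite -natrM mulnb.
have mtnth m (i : 'I_m) : measurable_fun setT (fun c : m.-tuple T => tnth c i).
  exact: measurable_tnth.
have mgss m (i : 'I_m) : measurable_fun setT (fun c : m.-tuple T => gss (tnth c i)).
  exact: (measurableT_comp measurable_gss (mtnth m i)).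
have mb : measurable_fun setT (fun c : n.+1.-tuple T => (b c)%:R * gauss_weight c).
  rewrite (funext bE); apply: measurable_funM.
    apply: measurable_funM; last exact: mgss.
    apply: (@measurable_le_indic _ _ (fun _ : n.+1.-tuple T => 0) (fun c => tnth c ord0)) => //.
    exact: mtnth.
  apply: measurable_prod => j _; apply: measurable_funM; last exact: mgss.
  apply: (@measurable_le_indic _ _ (fun c : n.+1.-tuple T => - (a j * tnth c ord0))
    (fun c => tnth c (lift ord0 j))); last exact: mtnth.
  apply: measurableT_comp => //; apply: measurable_funM => //; exact: mtnth.
rewrite ge0_integral_tlebS; last 2 first.
- exact/measurable_EFinP.
- by move=> c; rewrite lee_fin mulr_ge0// expR_ge0.
have s0 := s2pi_gt0; have s1 : s2pi != 0 by rewrite gt_eqF.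
have inner t : (\int[tleb n]_v ((b (cons_tuple t v))%:R * gauss_weight (cons_tuple t v))%:E =
    ((0 <= t)%R%:R * gss t * \prod_j (s2pi * (2^-1 + s2pi^-1 * gerf (-1) (a j * t))))%:E)%E.
  rewrite EFinM -(@ge0_integral_tleb_bigprod _ n (fun j z => (- (a j * t) <= z)%R%:R * gss z)).
  - rewrite -ge0_integralZl//.
    + apply: eq_integral => v _; rewrite bE tnth0 EFinM; congr (_ * _)%E; congr EFin.
      by apply: eq_bigr => j _; rewrite tnthS.
    + apply/measurable_EFinP; apply: measurable_prod => j _; apply: measurable_funM; last exact: mgss.
      apply: (@measurable_le_indic _ _ (fun _ : n.-tuple T => - (a j * t)) (fun c => tnth c j)) => //.
      exact: mtnth.
    + by move=> v _; rewrite lee_fin; apply: prodr_ge0 => j _; rewrite mulr_ge0// gss_ge0.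
    + by rewrite lee_fin mulr_ge0// gss_ge0.
  - move=> j; apply: measurable_funM; last exact: measurable_gss.
    by apply: (@measurable_le_indic _ _ (fun _ : T => - (a j * t)) id).
  - by move=> j z; rewrite mulr_ge0// gss_ge0.
  - move=> j; transitivity (\int[leb]_(z in `[(- (a j * t))%R, +oo[) (gss z)%:E)%E.
      rewrite [RHS]integral_mkcond; apply: eq_integral => z _.
      rewrite /patch mem_setE in_itv/= andbT; case: (_ <= _); first by rewrite mul1r.
      by rewrite mul0r.
    rewrite integral_gss_ge gerf_opp sqrt_2pi; congr EFin; by field.
under eq_integral do rewrite inner.
rewrite -ge0_integralZl//; last 2 first.
- apply/measurable_EFinP/measurable_funTS/measurable_funM; last exact: measurable_gss.
  apply: measurable_prod => j _; apply: measurable_funD => //; apply: measurable_funM => //.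
  apply: (measurableT_comp measurable_gerf); exact: measurable_funM.
- move=> y _; rewrite lee_fin mulr_ge0 ?gss_ge0// prodr_ge0// => j _.
  exact: Phi_real_ge0.
rewrite [RHS]integral_mkcond; apply: eq_integral => t _.
rewrite /patch mem_setE in_itv/= andbT; case: (_ <= _); last by rewrite !mul0r.
rewrite big_split/= prodr_const card_ord -EFinM; congr EFin; ring.
Qed.

Lemma Fubini_tleb n (f : n.+1.-tuple T -> \bar R) : (tleb n.+1).-integrable setT f ->
  leb.-integrable setT (fun t => \int[tleb n]_v f (cons_tuple t v))%E /\
      (\int[leb]_t \int[tleb n]_v f (cons_tuple t v) =
       \int[tleb n]_v \int[leb]_t f (cons_tuple t v))%E.
Proof.
move=> iF; have mf : measurable_fun setT f by exact: measurable_int iF.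
have intf : (leb \x tleb n)%E.-integrable setT (f \o @tcons _ n).
  apply/integrableP; split; first exact: measurableT_comp mf (@measurable_tcons _ n).
  have /integrableP[_] := iF.
  rewrite (@ge0_integral_pushforward _ _ _ _ _ _ (@measurable_tcons _ n) _ setT)//.
  exact: measurableT_comp.
by split; [exact: integrable_fubini_F intf|exact: Fubini intf].
Qed.

Section wedge.
Variables (n : nat) (J : pred 'I_n) (t : 'I_n -> R) (s : R).
Hypothesis s0 : 0 < s.
Hypothesis tJ : forall j, ~~ J j -> t j = 0.

(** Coordinate form of the tangent cone at G. Coordinates outside [J] are unconstrained and, since
    [t] vanishes there, span the lineality space. *)
Definition wedge : set (n.+1.-tuple T) :=
  [set c | (forall j, J j -> 0 <= tnth c (lift ord0 j)) /\
    \sum_j t j * tnth c (lift ord0 j) <= Num.sqrt s * tnth c ord0].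

Let W (v : n.-tuple T) : R := \prod_j half_gss (J j) (tnth v j).
Let K (v : n.-tuple T) : R := \sum_j t j * tnth v j.

Let mtnth m (i : 'I_m) : measurable_fun setT (fun c : m.-tuple T => tnth c i).
Proof. exact: measurable_tnth. Qed.

Let mW : measurable_fun setT W.
Proof.
apply: measurable_prod => j _.
exact: (measurableT_comp (measurable_half_gss (J j)) (mtnth j)).
Qed.

Let W0 v : 0 <= W v.
Proof. by apply: prodr_ge0 => j _; exact: half_gss_ge0. Qed.

Let mK : measurable_fun setT K.
Proof. by apply: measurable_sum => j; apply: measurable_funM => //; exact: mtnth. Qed.

(** With the other coordinates fixed, the head runs over the half-line from [K v / sqrt s]. *)
Lemma gauss_wedge_swap :
  (gauss wedge =
   \int[tleb n]_v (W v * (Num.sqrt (pi / 2) - gerf (-1) (K v / Num.sqrt s)))%:E)%E.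
Proof.
have a0 : 0 < Num.sqrt s by rewrite sqrtr_gt0.
pose b (c : n.+1.-tuple T) := [forall j, J j ==> (0 <= tnth c (lift ord0 j))] &&
  (\sum_j t j * tnth c (lift ord0 j) <= Num.sqrt s * tnth c ord0).
rewrite (@gauss_mkcond _ _ b); last first.
  move=> c; split => [[h1 h2]|/andP[/forallP h1 h2]].
    by apply/andP; split => //; apply/forallP => j; apply/implyP/h1.
  by split => // j; exact/implyP.
have bE (c : n.+1.-tuple T) : (b c)%:R * gauss_weight c =
    (\sum_j t j * tnth c (lift ord0 j) <= Num.sqrt s * tnth c ord0)%R%:R * gss (tnth c ord0) *
    \prod_j (half_gss (J j) (tnth c (lift ord0 j))) :> R.
  rewrite gauss_weight_prod big_ord_recl /half_gss big_split/= prod_bool /b andbC mulrACA.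
  by rewrite -natrM mulnb.
rewrite ge0_integral_tlebS_swap; last 2 first.
- apply/measurable_EFinP; rewrite (funext bE); apply: measurable_funM.
    apply: measurable_funM; last exact: (measurableT_comp measurable_gss (mtnth _)).
    apply: (@measurable_le_indic _ _ (fun c : n.+1.-tuple T => \sum_j t j * tnth c (lift ord0 j))
      (fun c => Num.sqrt s * tnth c ord0)).
      by apply: measurable_sum => j; apply: measurable_funM => //; exact: mtnth.
    by apply: measurable_funM => //; exact: mtnth.
  apply: measurable_prod => j _.
  exact: (measurableT_comp (measurable_half_gss (J j)) (mtnth _)).
- by move=> c; rewrite lee_fin mulr_ge0// expR_ge0.
apply: eq_integral => v _.
transitivity (\int[leb]_(y in `[(K v / Num.sqrt s)%R, +oo[) ((W v)%:E * (gss y)%:E))%E.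
  rewrite [RHS]integral_mkcond; apply: eq_integral => y _.
  rewrite bE tnth0 /patch mem_setE in_itv/= andbT ler_pdivrMr// mulrC (mulrC y).
  rewrite (_ : \sum_j _ = K v); last by apply: eq_bigr => j _; rewrite tnthS.
  rewrite (_ : \prod_j _ = W v); last by apply: eq_bigr => j _; rewrite tnthS.
  by case: (_ <= _); rewrite ?mul1r ?mul0r ?mulr0 ?EFinM.
rewrite ge0_integralZl//.
- by rewrite integral_gss_ge -EFinM.
- by apply/measurable_EFinP/measurable_funTS; exact: measurable_gss.
- by move=> y _; rewrite lee_fin gss_ge0.
- by rewrite lee_fin W0.
Qed.

(** Extended by zero, so that the double integral lives on a full product space. *)
Let k : R -> R := (fun y => expR (- (s * y ^+ 2) / 2) / y) \_ `]0, +oo[.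

Let mexp (u : R) : measurable_fun setT (fun y : R => expR (- (u * y ^+ 2) / 2)).
Proof.
apply: measurableT_comp => //; apply: measurable_funM => //.
by apply: measurableT_comp => //; apply: measurable_funM => //; exact: measurable_funX.
Qed.

Let mk : measurable_fun setT k.
Proof.
apply/(measurable_restrictT _ _).1 => //; apply: measurable_funTS.
by apply: measurable_funM; [exact: mexp|exact: measurable_inv].
Qed.

(** Integrating [f] over the head gives, up to a constant, the error function term of
    [gauss_wedge_swap]; integrating it over the tail gives, up to a constant, the final integrand
    with its product of values of [Phi]. *)
Let f (c : n.+1.-tuple T) : R :=
  k (thead c) * sin (K [tuple of behead c] * thead c) * W [tuple of behead c].

Let fE (y : T) (v : n.-tuple T) : f (cons_tuple y v) = k y * sin (K v * y) * W v.
Proof.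
rewrite /f theadE; have -> : [tuple of behead (cons_tuple y v)] = v by exact: val_inj.
by [].
Qed.

Let mf : measurable_fun setT f.
Proof.
apply: measurable_fun_tconsP.
rewrite (_ : _ \o _ = fun p => k p.1 * sin (K p.2 * p.1) * W p.2); last first.
  by apply/funext => -[y v]; exact: fE.
apply: measurable_funM; last exact: (measurableT_comp mW).
apply: measurable_funM; first exact: (measurableT_comp mk).
apply: (measurableT_comp (continuous_measurable_fun (@continuous_sin R))).
by apply: measurable_funM => //; exact: (measurableT_comp mK).
Qed.

(** A bound for [W v * |K v|] in product form, from [1 + sum x_j <= prod (1 + x_j)], which makes its
    integrability a question in one variable. *)
Let B (v : n.-tuple T) : R := \prod_j (half_gss (J j) (tnth v j) * (1 + `|t j * tnth v j|)).

Let iB : (tleb n).-integrable setT (EFin \o B).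
Proof.
pose F j z := half_gss (J j) z * (1 + `|t j * z|).
have F0 j z : 0 <= F j z by rewrite mulr_ge0 ?half_gss_ge0// addr_ge0.
have mF j : measurable_fun setT (F j).
  apply: measurable_funM; first exact: measurable_half_gss.
  by apply: measurable_funD => //; apply: measurableT_comp.
have iF j : leb.-integrable setT (EFin \o F j).
  have i1 : leb.-integrable setT (EFin \o (fun z => gss z + `|t j| * (`|z| * gss z))).
    apply: integrable_realD => //; first exact: integrable_gss.
    by apply: integrable_realZ => //; exact: integrable_normM_gss.
  apply: le_integrable i1 => //; first by apply/measurable_EFinP; exact: mF.
  move=> z _ /=; rewrite lee_fin (ger0_norm (F0 j z)) ger0_norm; last first.
    by rewrite addr_ge0 ?gss_ge0// !mulr_ge0// gss_ge0.
  have -> : gss z + `|t j| * (`|z| * gss z) = gss z * (1 + `|t j * z|).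
    by rewrite normrM; ring.
  by rewrite ler_wpM2r ?half_gss_le// addr_ge0.
have B0 v : 0 <= B v by apply: prodr_ge0 => j _; exact: F0.
apply/integrableP; split.
  apply/measurable_EFinP; apply: measurable_prod => j _.
  exact: (measurableT_comp (mF j) (mtnth j)).
under eq_integral do rewrite /= ger0_norm//.
rewrite (@ge0_integral_tleb_bigprod _ n F (fun j => \int[leb]_z F j z)) ?ltry//.
by move=> j; rewrite /Rintegral fineK//; exact: (integrable_fin_num measurableT (iF j)).
Qed.

(* |sin (K v * y) / y| <= |K v| makes f integrable. *)
Let KB v : W v * `|K v| <= B v.
Proof.
rewrite /B big_split/= ler_wpM2l// /K.
apply: le_trans (ler_norm_sum _ _ _) _.
have h (x : 'I_n -> R) : (forall i, 0 <= x i) ->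
    1 + \sum_i x i <= \prod_i (1 + x i).
  move=> x0; elim: (index_enum _) => [|i r IH]; first by rewrite !big_nil addr0.
  rewrite !big_cons mulrDl mul1r addrCA addrC lerD//.
  rewrite ler_peMr// (le_trans _ IH)// lerDl sumr_ge0//.
by apply: le_trans (h (fun j => `|t j * tnth v j|) _) => //; rewrite lerDr.
Qed.

Let f_le y v : `|f (cons_tuple y v)| <= expR (- (s * y ^+ 2) / 2) * B v.
Proof.
rewrite fE !normrM (ger0_norm (W0 v)) /k /patch mem_setE in_itv/= andbT.
case: ifPn => y0; last first.
  by rewrite normr0 !mul0r mulr_ge0 ?expR_ge0// (le_trans _ (KB v))// mulr_ge0.
rewrite normrM (ger0_norm (expR_ge0 _)) -!mulrA ler_wpM2l ?expR_ge0//.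
apply: le_trans (KB v); rewrite [leRHS]mulrC mulrA ler_wpM2r//.
rewrite normfV mulrC ler_pdivrMr ?normr_gt0 ?gt_eqF// -normrM.
exact: norm_sin_le.
Qed.

Let iexp (u : R) : 0 < u -> leb.-integrable setT (EFin \o (fun y : R => expR (- (u * y ^+ 2) / 2))).
Proof.
move=> u0; have a0 : 0 < Num.sqrt (u / 2) by rewrite sqrtr_gt0 divr_gt0.
apply: eq_integrable (integrable_expR_sqr a0) => // y _ /=.
by congr (expR _)%:E; rewrite exprMn sqr_sqrtr ?divr_ge0 ?(ltW u0)//; field.
Qed.

Let iff : (tleb n.+1).-integrable setT (EFin \o f).
Proof.
pose g (c : n.+1.-tuple T) := expR (- (s * thead c ^+ 2) / 2) * B [tuple of behead c].
have gE y v : g (cons_tuple y v) = expR (- (s * y ^+ 2) / 2) * B v.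
  rewrite /g theadE; have -> : [tuple of behead (cons_tuple y v)] = v by exact: val_inj.
  by [].
have ig := integrable_tleb_prod gE (iexp s0) iB.
apply: le_integrable ig => //; first exact/measurable_EFinP.
case/tupleP => y v _; rewrite /= lee_fin (le_trans (f_le y v))//.
by rewrite [g _]gE ler_norm.
Qed.

Let int_y v : (\int[leb]_y (f (cons_tuple y v))%:E =
  (W v * (Num.sqrt (pi / 2) * gerf (-1) (K v / Num.sqrt s)))%:E)%E.
Proof.
rewrite -Rintegral_sinc_scaled//.
have i1 : leb.-integrable `]0, +oo[ (EFin \o (fun y => expR (- (s * y ^+ 2) / 2) * (sin (K v * y) / y))).
  by apply: (@integrableS _ _ _ leb setT) => //; exact: integrable_sinc.
rewrite EFinM /Rintegral fineK; last exact: integrable_fin_num.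
rewrite -integralZl//= [RHS]integral_mkcond; apply: eq_integral => y _.
rewrite fE /k /patch mem_setE in_itv/= andbT; case: ifP => _.
  by rewrite -EFinM; congr EFin; ring.
by rewrite !mul0r.
Qed.

(** [W v e^(- i K v y)] is a product over the coordinates. A coordinate in [J] contributes [sqrt (2
    pi) e^(- (t j y)^2 / 2) Phi (- i t j y)], any other one [sqrt (2 pi)] because [t j = 0]. *)
Let Improd y : complex.Im (\prod_(j < n | J j) Phi (- 'i * (t j * y)%:C))%C *
    (expR (- ((\sum_(j | J j) t j ^+ 2) * y ^+ 2) / 2) * s2pi ^+ n) =
   - \int[tleb n]_v (sin (K v * y) * W v).
Proof.
pose F j z := ((half_gss (J j) z)%:C * (cos (t j * y * z) +i* (- sin (t j * y * z))))%C.
have FI j : cintegral setT (F j) =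
    (s2pi%:C * if J j then (gss (t j * y))%:C * Phi (- 'i * (t j * y)%:C) else 1)%C.
  rewrite /F; case: (boolP (J j)) => Jj.
    under [in LHS]eq_fun do rewrite half_gssT.
    by rewrite cintegral_gss rmorphM mulrA.
  have -> : (fun z => (half_gss false z)%:C * (cos (t j * y * z) +i* (- sin (t j * y * z))))%C =
      (fun z => (gss z)%:C)%C.
    apply/funext => z; rewrite tJ// !mul0r cos0 sin0 half_gssF.
    by apply/eqP; rewrite eq_complex /=; apply/andP; split; apply/eqP; ring.
  rewrite /cintegral /= mulr1; congr (_ +i* _)%C.
    by rewrite /Rintegral integral_gss.
  by rewrite Rintegral_cst ?mul0r.
have iF (h : R -> R) j : measurable_fun setT h -> (forall z, `|h z| <= 1) ->
    leb.-integrable setT (EFin \o (fun z => half_gss (J j) z * h z)).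
  move=> mh h1; apply: le_integrable integrable_gss => //.
    by apply/measurable_EFinP; apply: measurable_funM => //; exact: measurable_half_gss.
  move=> z _ /=; rewrite lee_fin normrM ger0_norm ?half_gss_ge0// (ger0_norm (gss_ge0 z)).
  by rewrite (le_trans (ler_piMr _ (h1 z))) ?half_gss_ge0// half_gss_le.
have FR j : leb.-integrable setT (EFin \o (fun z => complex.Re (F j z))).
  have := iF _ j (continuous_measurable_fun (continuous_cosM (a := t j * y))) (fun z => cos_max _).
  by apply: eq_integrable => // z _ /=; rewrite mul0r subr0.
have FIm j : leb.-integrable setT (EFin \o (fun z => complex.Im (F j z))).
  have := integrable_realN (iF _ j (continuous_measurable_fun (continuous_sinM (a := t j * y))) (fun z => sin_max _)).
  by apply: eq_integrable => // z _ /=; rewrite mul0r addr0 mulrN.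
have [_ iIm _] := Rintegral_tleb_complex_bigprod FR FIm.
pose cis (u : R) := (cos u +i* (- sin u))%C.
have cisD u v : cis (u + v) = cis u * cis v.
  by apply/eqP; rewrite eq_complex /= cosD sinD; apply/andP; split; apply/eqP; ring.
have cis0 : cis 0 = 1 by rewrite /cis cos0 sin0 oppr0.
have GE v : \prod_i F i (tnth v i) = ((W v)%:C * (cos (K v * y) +i* (- sin (K v * y))))%C.
  rewrite /F big_split/=; congr (_ * _); first by rewrite rmorph_prod.
  rewrite -/(cis (K v * y)) /K mulr_suml (big_morph cis cisD cis0).
  by apply: eq_bigr => j _; rewrite -/(cis _) mulrAC.
have hE v : complex.Im (\prod_i F i (tnth v i)) = - (sin (K v * y) * W v).
  by rewrite GE /=; ring.
have iH : (tleb n).-integrable setT (EFin \o (fun v => - (sin (K v * y) * W v))).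
  by apply: eq_integrable iIm => // v _; rewrite /= hE.
under eq_Rintegral do rewrite hE.
rewrite (eq_bigr _ (fun j _ => FI j)) big_split/= prodr_const card_ord.
rewrite -big_mkcond/= big_split/= => E.
have -> : - (\int[tleb n]_v (sin (K v * y) * W v)) = \int[tleb n]_v (- (sin (K v * y) * W v)) :> R.
  rewrite -[LHS]mulN1r -RintegralZl//.
    by apply: eq_Rintegral => v _; rewrite mulN1r.
  by apply: eq_integrable (integrable_realN iH) => // v _; rewrite /= opprK.
rewrite E -rmorphXn -rmorph_prod mulrA -rmorphM.
have -> : \prod_(j | J j) gss (t j * y) = expR (- ((\sum_(j | J j) t j ^+ 2) * y ^+ 2) / 2).
  rewrite /gss -expR_sum mulr_suml -sumrN mulr_suml; congr expR.
  by apply: eq_bigr => j _; rewrite exprMn.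
by case: (\prod_(j | _) _) => u v /=; ring.
Qed.

Let iW : (tleb n).-integrable setT (EFin \o W).
Proof.
apply/integrableP; split; first exact/measurable_EFinP.
under eq_integral do rewrite /= ger0_norm//.
by rewrite integral_prod_half_gss ltry.
Qed.

Let iWg : (tleb n).-integrable setT (EFin \o (fun v => W v * gerf (-1) (K v / Num.sqrt s))).
Proof.
have iW2 : (tleb n).-integrable setT (EFin \o (fun v => s2pi / 2 * W v)).
  exact: integrable_realZ.
apply: le_integrable iW2 => //.
  apply/measurable_EFinP; apply: measurable_funM => //.
  by apply: (measurableT_comp measurable_gerf); apply: measurable_funM.
move=> v _ /=; have s20 := s2pi_gt0.
have cW : 0 <= s2pi / 2 * W v by rewrite mulr_ge0// divr_ge0// ltW.
rewrite lee_fin (ger0_norm cW) normrM (ger0_norm (W0 v)) mulrC.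
rewrite ler_wpM2r//; set w := _ / _; rewrite ler_norml.
(* Nonnegativity of the normal distribution function at [w] and at [- w] bounds the odd function
   [gerf (-1)] on both sides. *)
have P u : 0 <= 2^-1 + s2pi^-1 * u -> 0 <= s2pi / 2 + u.
  move=> /(mulr_ge0 (ltW s20)); rewrite mulrDr mulrA divff ?mul1r// gt_eqF//.
have := P _ (Phi_real_ge0 w); have := P _ (Phi_real_ge0 (- w)).
by rewrite gerf_opp => h1 h2; apply/andP; split; lra.
Qed.

Let iSW y : (tleb n).-integrable setT (EFin \o (fun v => sin (K v * y) * W v)).
Proof.
apply: le_integrable iW => //.
  apply/measurable_EFinP; apply: measurable_funM => //.
  apply: (measurableT_comp (continuous_measurable_fun (@continuous_sin R))).
  exact: measurable_funM.
move=> v _ /=; rewrite lee_fin normrM ler_piMl//; exact: sin_max.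
Qed.

Lemma gauss_wedge :
  (gauss wedge = (s2pi ^+ n.+1)%:E * ((1 / 2 ^+ #|J|.+1)%:E + (1 / pi)%:E *
    \int[leb]_(y in `]0%R, +oo[)
      (expR (- ((s + \sum_(j | J j) t j ^+ 2) * y ^+ 2) / 2) / y *
       complex.Im (\prod_(j < n | J j) Phi (- 'i * (t j * y)%:C)%C))%:E))%E.
Proof.
have s20 := s2pi_gt0; have s21 : s2pi != 0 by rewrite gt_eqF.
pose Zf y := expR (- ((s + \sum_(j | J j) t j ^+ 2) * y ^+ 2) / 2) / y *
       complex.Im (\prod_(j < n | J j) Phi (- 'i * (t j * y)%:C)%C).
(* Besides the exchange, Fubini yields the integrability of the final integrand [Zf], through
   [inner]. *)
have [iy FE] := Fubini_tleb iff.
have inner y : (\int[tleb n]_v (EFin \o f) (cons_tuple y v) =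
    ((- (s2pi ^+ n)) * (Zf \_ `]0%R, +oo[) y)%:E)%E.
  transitivity ((k y)%:E * \int[tleb n]_v (sin (K v * y) * W v)%:E)%E.
    rewrite -integralZl//; last exact: iSW.
    by apply: eq_integral => v _; rewrite /= fE -mulrA EFinM.
  have -> : (\int[tleb n]_v (sin (K v * y) * W v)%:E =
      (\int[tleb n]_v (sin (K v * y) * W v))%:E)%E.
    by rewrite /Rintegral fineK//; exact: (integrable_fin_num measurableT (iSW y)).
  rewrite -[Rintegral _ _ _]opprK -Improd -EFinM; congr EFin.
  rewrite /k /Zf /patch; case: ifP => _; last by rewrite mul0r mulr0.
  have -> : - ((s + \sum_(j | J j) t j ^+ 2) * y ^+ 2) / 2 =
     - (s * y ^+ 2) / 2 + - ((\sum_(j | J j) t j ^+ 2) * y ^+ 2) / 2 by ring.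
  by rewrite expRD; ring.
have iZ : leb.-integrable setT (EFin \o (Zf \_ `]0%R, +oo[)).
  have iy' : leb.-integrable setT (EFin \o (fun y => (- (s2pi ^+ n)) * (Zf \_ `]0%R, +oo[) y)).
    by apply: eq_integrable iy => // y _; rewrite inner.
  apply: eq_integrable (integrable_realZ measurableT (- s2pi ^+ n)^-1 iy') => // y _ /=.
  by rewrite mulKf// oppr_eq0 expf_neq0.
have Zfin : (\int[leb]_(y in `]0%R, +oo[) (Zf y)%:E)%E = (\int[leb]_y (Zf \_ `]0%R, +oo[) y)%:E.
  rewrite /Rintegral fineK; last exact: (integrable_fin_num measurableT iZ).
  by rewrite [LHS]integral_mkcond; apply: eq_integral => y _; rewrite /patch; case: ifP.
(* Comparison of the two iterated integrals of [f]; [2 / s2pi] is the inverse of [sqrt (pi / 2)]. *)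
have Wg : \int[tleb n]_v (W v * gerf (-1) (K v / Num.sqrt s)) =
   - (2 / s2pi) * (s2pi ^+ n) * \int[leb]_y (Zf \_ `]0%R, +oo[) y.
  have : - s2pi ^+ n * \int[leb]_y (Zf \_ `]0%R, +oo[) y =
      s2pi / 2 * \int[tleb n]_v (W v * gerf (-1) (K v / Num.sqrt s)).
    rewrite -!RintegralZl//; congr fine.
    under [LHS]eq_integral do rewrite -inner.
    rewrite FE; apply: eq_integral => v _; rewrite int_y; congr EFin.
    by rewrite sqrt_2pi; ring.
  set Z := \int[leb]_y _; set G := \int[tleb n]_v _ => E.
  have -> : G = 2 / s2pi * (s2pi / 2 * G) by field.
  by rewrite -E; ring.
have iW2 : (tleb n).-integrable setT (EFin \o (fun v => W v * (s2pi / 2))).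
  by apply: eq_integrable (integrable_realZ measurableT (s2pi / 2) iW) => // v _ /=; rewrite mulrC.
rewrite gauss_wedge_swap Zfin.
transitivity (\int[tleb n]_v (W v * (s2pi / 2) - W v * gerf (-1) (K v / Num.sqrt s)))%:E.
  rewrite /Rintegral fineK; last first.
    exact: (integrable_fin_num measurableT (integrable_realB measurableT iW2 iWg)).
  by apply: eq_integral => v _; rewrite mulrBr sqrt_2pi.
rewrite RintegralB//.
rewrite Wg RintegralZr//.
rewrite (_ : \int[tleb n]_v W v = s2pi ^+ n / 2 ^+ #|J|); last by rewrite /Rintegral integral_prod_half_gss.
set Z := \int[leb]_y _.
transitivity ((s2pi ^+ n.+1 * (1 / 2 ^+ #|J|.+1 + 1 / pi * Z))%:E); last by [].
congr EFin; have pi0 : pi != 0 :> R by rewrite gt_eqF// pi_gt0.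
(* With [pi] expressed through [s2pi], the claim is an identity of rational functions. *)
have sq : pi = s2pi ^+ 2 / 2 by rewrite sqr_sqrtr ?mulr_ge0 ?pi_ge0//; field.
have -> : 1 / pi = 2 / s2pi ^+ 2 :> R by rewrite [X in 1 / X]sq; field.
rewrite !exprS; field.
rewrite s21 /= expf_neq0//.
Qed.

End wedge.

End gauss_cones.

(** * Solid angles as Gaussian measures *)

Section hulls.
Context {R : realType}.

Lemma lin_hullP n (S : set 'rV[R]_n) (V : 'rV[R]_n -> Prop) :
  V 0 -> (forall (a : R) u v, V u -> V v -> V (a *: u + v)) ->
  (forall u, S u -> V u) -> forall u, lin_hull S u -> V u.
Proof.
move=> V0 VD SV u [m [c [p [_ pS ->]]]].
elim/big_ind: _ => // [x y Vx Vy|i _]; first by rewrite -[x]scale1r; exact: VD.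
by rewrite -[_ *: _]addr0; apply: VD => //; exact: SV.
Qed.

Lemma sub_lin_hull n (S : set 'rV[R]_n) u : S u -> lin_hull S u.
Proof.
move=> Su; exists 1%N, (fun=> 1), (fun=> u); split=> //.
by rewrite big_ord1 scale1r.
Qed.

Lemma lin_hull0 n (S : set 'rV[R]_n) : lin_hull S 0.
Proof.
by exists 0%N, (fun=> 0), (fun=> 0); split=> //; [case|rewrite big_ord0].
Qed.

Lemma lin_hullD n (S : set 'rV[R]_n) (a : R) u v :
  lin_hull S u -> lin_hull S v -> lin_hull S (a *: u + v).
Proof.
move=> [m [c [p [_ pS ->]]]] [m' [c' [p' [_ pS' ->]]]].
exists (m + m')%N, (fun i => match fintype.split i with inl j => a * c j | inr j => c' j end),
  (fun i => match fintype.split i with inl j => p j | inr j => p' j end); split=> //.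
  by move=> i; case: (fintype.split i).
rewrite big_split_ord/= scaler_sumr; congr (_ + _); apply: eq_bigr => i _.
  by rewrite (unsplitK (inl i)) scalerA.
by rewrite (unsplitK (inr i)).
Qed.

Lemma lin_hullE n (S V : set 'rV[R]_n) :
  V 0 -> (forall (a : R) u v, V u -> V v -> V (a *: u + v)) ->
  S `<=` V -> V `<=` lin_hull S -> lin_hull S = V.
Proof.
by move=> V0 VD SV VS; apply/seteqP; split => // u; exact: lin_hullP.
Qed.

Lemma lin_hull_rows m n (b : 'M[R]_(m, n)) :
  lin_hull (range (fun i => row i b)) = range (fun q : 'rV[R]_m => q *m b).
Proof.
apply: lin_hullE.
- by exists 0; rewrite ?mul0mx.
- by move=> a _ _ [q _ <-] [r _ <-]; exists (a *: q + r); rewrite // mulmxDl scalemxAl.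
- by move=> _ [i _ <-]; exists (delta_mx 0 i); rewrite // -rowE.
- move=> _ [q _ <-]; exists m, (fun i => q 0 i), (fun i => row i b); split=> //.
  exact: mulmx_sum_row.
Qed.

End hulls.

Section solid_angle_gauss.
Context {R : realType}.
Local Notation T := (measurableTypeR R).
Variables (n : nat) (g : 'rV[R]_n -> 'rV[R]_n -> R).
Hypothesis gDl : forall (a : R) u v w, g (a *: u + v) w = a * g u w + g v w.
Hypothesis gC : forall u v, g u v = g v u.

Let orthonormal m (b : 'M[R]_(m, n)) := forall i j, g (row i b) (row j b) = (i == j)%:R.

Lemma form_suml (I : Type) (r : seq I) (c : I -> R) (p : I -> 'rV[R]_n) w :
  g (\sum_(i <- r) c i *: p i) w = \sum_(i <- r) c i * g (p i) w.
Proof.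
have g0 : g 0 w = 0.
  by have := gDl (-1) 0 0 w; rewrite scaler0 addr0 mulN1r addNr.
elim: r => [|i r IH]; first by rewrite !big_nil.
by rewrite !big_cons gDl IH.
Qed.

Lemma form_rows m (b : 'M[R]_(m, n)) (q r : 'rV[R]_m) : orthonormal b ->
  g (q *m b) (r *m b) = (q *m r^T) 0 0.
Proof.
move=> ob; rewrite !(mulmx_sum_row _ b) form_suml mxE; apply: eq_bigr => i _.
rewrite gC form_suml (bigD1 i)//= ob eqxx mulr1 big1 ?addr0; first by rewrite mxE.
by move=> j ji; rewrite ob (negbTE ji) mulr0.
Qed.

Lemma orthonormal_inj m (b : 'M[R]_(m, n)) : orthonormal b ->
  injective (fun q : 'rV[R]_m => q *m b).
Proof.
move=> ob q r /= qr; apply/rowP => i.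
have h (s : 'rV[R]_m) : g (s *m b) (delta_mx 0 i *m b) = s 0 i.
  by rewrite form_rows// trmx_delta -colE mxE.
by rewrite -[LHS]h qr h.
Qed.

(** [Q] need not be square: [Q *m Q^T = 1] bounds its number of rows by its number of columns, and
    applied both ways this gives two bases of one space the same size. *)
Lemma orthonormal_transition m m' (b : 'M[R]_(m, n)) (b' : 'M[R]_(m', n)) :
  orthonormal b -> orthonormal b' ->
  range (fun q : 'rV[R]_m' => q *m b') `<=` range (fun q : 'rV[R]_m => q *m b) ->
  exists2 Q : 'M[R]_(m', m), b' = Q *m b & Q *m Q^T = 1%:M.
Proof.
move=> ob ob' sub.
have /choice[q qE] : forall i, exists q : 'rV[R]_m, row i b' = q *m b.
  by move=> i; have [|q _ <-] := sub (row i b'); [exists (delta_mx 0 i); rewrite // -rowE|exists q].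
pose Q := \matrix_i q i.
have QE : b' = Q *m b by apply/row_matrixP => i; rewrite row_mul rowK qE.
exists Q => //; apply/matrixP => i j.
rewrite [RHS]mxE -ob' QE !row_mul form_rows// 2!mxE.
by apply: eq_bigr => k _; rewrite !mxE.
Qed.

Lemma trow_sum m (b : 'M[R]_(m, n)) (c : m.-tuple R) :
  \sum_i tnth c i *: row i b = trow c *m b.
Proof. by rewrite mulmx_sum_row; apply: eq_bigr => i _; rewrite mxE. Qed.

Lemma sqnormE m (c : m.-tuple R) : sqnorm c = (trow c *m (trow c)^T) 0 0.
Proof. by rewrite mxE; apply: eq_bigr => i _; rewrite !mxE expr2. Qed.

Variables (m : nat) (b : 'M[R]_(m, n)) (C : set (m.-tuple T)).
Hypothesis ob : orthonormal b.
Hypothesis mC : measurable C.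
Hypothesis coneC : forall r : R, 0 < r -> tscale r @^-1` C = C.

Let K : set 'rV[R]_n := [set trow c *m b | c in C].
Hypothesis LK : lin_hull K = range (fun q : 'rV[R]_m => q *m b).

(* The basis chosen in solid_angle differs from b by an orthogonal matrix. *)
Let vol_chosen (A : set 'rV[R]_n) (B : set (m.-tuple T)) :
  let bb := xget (Tagged (fun m => 'M[R]_(m, n)) (0 : 'M[R]_(0, n)))
    [set b : {m : nat & 'M[R]_(m, n)} | is_orthonormal_basis g (lin_hull K) (tagged b)] in
  measurable B -> (forall c, A (trow c *m b) <-> B c) ->
  vol_in_basis (tagged bb) A = tleb m B.
Proof.
move=> bb mB AB; have : is_orthonormal_basis g (lin_hull K) (tagged bb).
  (* [b] itself is an orthonormal basis of the hull, so [xget] does not return its default. *)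
  rewrite /bb; case: xgetP => [b0 _ //|/(_ (Tagged _ b))].
  by case; split=> //; rewrite LK lin_hull_rows.
case: bb => m' b' /= [ob' Lb'].
have sub : range (fun q : 'rV[R]_m' => q *m b') = range (fun q : 'rV[R]_m => q *m b).
  by rewrite -LK -Lb' lin_hull_rows.
have [Q QE QQ] := orthonormal_transition ob ob' (eq_ind _ (subset _) (@subset_refl _ _) _ sub).
have [Q' _ QQ'] := orthonormal_transition ob' ob (eq_ind _ (subset _) (@subset_refl _ _) _ (esym sub)).
have mm : m' = m.
  by apply/eqP; rewrite eqn_leq (mulmx1_min QQ) (mulmx1_min QQ').
subst m'; rewrite /vol_in_basis -(tleb_unitary QQ mB).
rewrite -lebesgue_volE; last exact: measurable_tmx_preimage.
congr lebesgue_vol; apply/seteqP; split => c /=;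
  by rewrite trow_sum QE mulmxA -trow_tmx AB.
Qed.

(** [gauss_cone] applies to [C] and to the whole space with the same [k], which cancels in the
    ratio. *)
Lemma solid_angle_gauss :
  ((solid_angle g K)%:E = ((Num.sqrt (2 * pi) ^+ m)^-1)%:E * gauss C)%E.
Proof.
have mB := @measurable_tball R m.
have sB c : unit_ball g (trow c *m b) <-> tball c.
  by rewrite /unit_ball /tball /= form_rows// sqnormE.
rewrite /solid_angle (@vol_chosen _ (C `&` @tball R m)); first last.
- move=> c; split => [[[c' Cc'] /(orthonormal_inj ob)/trow_inj <-]|[Cc ?]].
    by move/sB.
  by split; [exists c|exact/sB].
- exact: measurableI.
rewrite (@vol_chosen _ (@tball R m)) //; last first.
  move=> c; split => [[_ /sB]//|?]; split; last exact/sB.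
  by rewrite LK; exists (trow c).
have [k [k0 kE]] := @gauss_cone R m.
have := kE setT measurableT; rewrite setTI gauss_setT kE//.
move=> /(_ (fun _ _ => preimage_setT _)).
set s := Num.sqrt (2 * pi) ^+ m; have s0 : 0 < s by rewrite exprn_gt0// s2pi_gt0.
set VB := tleb m _; set VC := tleb m _ => E.
have VB0 : (0 <= VB)%E by exact: measure_ge0.
have VC0 : (0 <= VC)%E by exact: measure_ge0.
have VCB : (VC <= VB)%E.
  apply: le_measure; rewrite ?inE; [exact: measurableI|exact: mB|by move=> ? []].
have s1 : s != 0 by rewrite gt_eqF.
clear kE sB mB.
(* [k * VB] is finite and positive, which excludes infinite values of [k] and [VB] and, at the end,
   zero ones. *)
case: k k0 E => [k| |]// k0; last first.
  move: VB0; rewrite le_eqVlt => /predU1P[<-|V0].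
    by rewrite mule0 => -[E]; rewrite E ltxx in s0.
  by rewrite gt0_mulye.
case: (VB) VB0 VCB => [v| |]// v0; last first.
  move: k0; rewrite le_eqVlt => /predU1P[[<-]|k1].
    by rewrite mul0e => _ [E]; rewrite E ltxx in s0.
  by rewrite gt0_muley.
case: (VC) VC0 => [c| |]// c0 _ [E].
rewrite -!EFinM /=; congr EFin.
move: s1; rewrite E mulf_eq0 negb_or => /andP[k1 v1].
by field; rewrite k1 v1.
Qed.

End solid_angle_gauss.

(** * Tangent cones of the simplex *)

Section dot_product.
Context {R : realType}.

Lemma dotpC n (u v : 'rV[R]_n) : dotp u v = dotp v u.
Proof. by apply: eq_bigr => i _; rewrite mulrC. Qed.

Lemma dotpDl n (a : R) (u v w : 'rV[R]_n) :
  dotp (a *: u + v) w = a * dotp u w + dotp v w.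
Proof.
rewrite /dotp mulr_sumr -big_split/=; apply: eq_bigr => i _.
by rewrite !mxE mulrDl mulrA.
Qed.

Lemma dotpDr n (a : R) (u v w : 'rV[R]_n) :
  dotp w (a *: u + v) = a * dotp w u + dotp w v.
Proof. by rewrite dotpC dotpDl !(dotpC w). Qed.

Lemma dotpZl n (a : R) (u w : 'rV[R]_n) : dotp (a *: u) w = a * dotp u w.
Proof. by rewrite /dotp mulr_sumr; apply: eq_bigr => i _; rewrite mxE mulrA. Qed.

Lemma dotpZr n (a : R) (u w : 'rV[R]_n) : dotp w (a *: u) = a * dotp w u.
Proof. by rewrite dotpC dotpZl dotpC. Qed.

Lemma dotpNl n (u w : 'rV[R]_n) : dotp (- u) w = - dotp u w.
Proof. by rewrite -scaleN1r dotpZl mulN1r. Qed.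

Lemma dotpE n (u v : 'rV[R]_n) : dotp u v = (u *m v^T) 0 0.
Proof. by rewrite mxE; apply: eq_bigr => i _; rewrite mxE. Qed.

Lemma dotp_delta n (u : 'rV[R]_n) i : dotp (delta_mx 0 i) u = u 0 i.
Proof.
rewrite /dotp (bigD1 i)//= big1 => [|j ji]; rewrite mxE ?eqxx/=.
  by rewrite mul1r addr0.
by rewrite (negbTE ji) mul0r.
Qed.

Lemma dotp_sumr n (I : finType) (c : I -> R) (p : I -> 'rV[R]_n) u :
  dotp u (\sum_i c i *: p i) = \sum_i c i * dotp u (p i).
Proof.
by rewrite dotpC (form_suml (@dotpDl n)); apply: eq_bigr => i _; rewrite dotpC.
Qed.

Lemma dotp_ge0 n (u : 'rV[R]_n) : 0 <= dotp u u.
Proof. by apply: sumr_ge0 => i _; rewrite -expr2 sqr_ge0. Qed.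

Lemma dotp_eq0 n (u : 'rV[R]_n) : dotp u u = 0 -> u = 0.
Proof.
move=> /eqP; rewrite psumr_eq0 => [/allP h|i _]; last by rewrite -expr2 sqr_ge0.
apply/rowP => i; rewrite mxE; have := h i; rewrite mem_index_enum => /(_ isT).
by rewrite /= mulf_eq0 orbb => /eqP.
Qed.

Lemma sqr_enorm n (u : 'rV[R]_n) : enorm u ^+ 2 = dotp u u.
Proof. by rewrite sqr_sqrtr// dotp_ge0. Qed.

End dot_product.

(** * Relative interiors and feasible directions *)

Section polyhedra.
Context {R : realType} {d : nat}.
Implicit Types (A P : set 'rV[R]_d) (x y u : 'rV[R]_d).

Lemma conv_hull_le (S : set 'rV[R]_d) w (c : R) :
  (forall y, S y -> dotp w y <= c) -> forall y, conv_hull S y -> dotp w y <= c.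
Proof.
move=> Sc y [m [l [p [[l0 l1] Sp ->]]]]; rewrite dotp_sumr -[c]mul1r -l1 mulr_suml.
by apply: ler_sum => i _; rewrite ler_wpM2l// Sc.
Qed.

Lemma conv_hullS (S S' : set 'rV[R]_d) : S `<=` S' -> conv_hull S `<=` conv_hull S'.
Proof. by move=> SS y [m [l [p [lC Sp ->]]]]; exists m, l, p; split=> // i; exact: SS. Qed.

Lemma sub_conv_hull (S : set 'rV[R]_d) : S `<=` conv_hull S.
Proof.
move=> y Sy; exists 1%N, (fun=> 1), (fun=> y); split=> //; last by rewrite big_ord1 scale1r.
by rewrite big_ord1.
Qed.

(** The new point is the affine combination with coefficients [1 + e] and [- e]. The summand 1 in
    the denominator of [e] covers the case [y = x]. *)
Lemma relint_extend A x y : relint A x -> A y ->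
  exists2 e : R, 0 < e & A (x + e *: (x - y)).
Proof.
move=> [Ax [r r0 Ar]] Ay.
pose e := r / 2 / (1 + enorm (x - y)).
have n0 : 0 <= enorm (x - y) by exact: sqrtr_ge0.
have e0 : 0 < e by rewrite /e !divr_gt0// ltr_wpDr.
exists e => //; apply: Ar.
  exists 2%N, (fun i => if i == ord0 then 1 + e else - e),
    (fun i => if i == ord0 then x else y); split.
  - by rewrite big_ord_recl big_ord1/= addrK.
  - by move=> i; case: ifP.
  - by rewrite big_ord_recl big_ord1/= scalerDl scale1r scaleNr scalerBr addrA.
rewrite [X in enorm X](_ : _ = e *: (x - y)); last by rewrite addrC addKr.
have -> : enorm (e *: (x - y)) = e * enorm (x - y).
  by rewrite /enorm dotpZl dotpZr mulrA -expr2 sqrtrM ?sqr_ge0// sqrtr_sqr gtr0_norm.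
have : enorm (x - y) / (1 + enorm (x - y)) <= 1.
  by rewrite ler_pdivrMr ?ltr_wpDr// mul1r lerDr.
rewrite /e => h; have -> : r / 2 / (1 + enorm (x - y)) * enorm (x - y) =
  r / 2 * (enorm (x - y) / (1 + enorm (x - y))) by ring.
apply: (@le_lt_trans _ _ (r / 2)); last by lra.
by rewrite ler_piMr// divr_ge0// ltW.
Qed.

Lemma feasible_directionE (I : finType) (a : I -> 'rV[R]_d) (b : I -> R) P x u :
  P = [set y | forall r, dotp (a r) y <= b r] -> P x ->
  (exists2 e : R, 0 < e & P (x + e *: u)) <->
  (forall r, dotp (a r) x = b r -> dotp (a r) u <= 0).
Proof.
move=> -> Px; split=> [[e e0 Pe] r ar|h].
  have := Pe r; rewrite addrC dotpDr ar gerDr.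
  by rewrite pmulr_rle0.
pose s r := b r - dotp (a r) x.
have s0 r : 0 <= s r by rewrite subr_ge0 Px.
(* The step [D^-1] is short enough for every constraint with positive slack. The tight ones add
   nothing to [D], because division by a zero slack gives 0. *)
pose D := 1 + \sum_r `|dotp (a r) u| / s r.
have D0 : 0 < D by rewrite ltr_wpDr// sumr_ge0// => r _; rewrite divr_ge0.
exists D^-1 => [|r]; first by rewrite invr_gt0.
rewrite addrC dotpDr -lerBrDr -/(s r) mulrC ler_pdivrMr//.
have [sr|sr] := eqVneq (s r) 0.
  by rewrite sr mul0r h//; apply/eqP; rewrite eq_sym -subr_eq0 -/(s r) sr.
have sp : 0 < s r by rewrite lt_neqAle eq_sym sr s0.
rewrite mulrC -ler_pdivrMr// (@le_trans _ _ (`|dotp (a r) u| / s r))//.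
  by rewrite ler_pM2r ?invr_gt0// ler_norm.
rewrite /D (bigD1 r)//= addrCA lerDl addr_ge0// sumr_ge0// => i _.
by rewrite divr_ge0.
Qed.

(** If equality held at [x] but not at some [y] in [A], the inequality would be violated at a point
    of [A] just beyond [x] on the ray from [y] through [x]. *)
Lemma activeE m (a : 'I_m -> 'rV[R]_d) (b : 'I_m -> R) A x r :
  (forall y, A y -> dotp (a r) y <= b r) -> relint A x ->
  active a b A r <-> dotp (a r) x = b r.
Proof.
move=> Ab rx; split=> [ar|ax y Ay]; first by apply: ar; case: rx.
have [e e0 /Ab] := relint_extend rx Ay.
rewrite addrC dotpDr ax gerDr pmulr_rle0// -scaleN1r addrC dotpDr mulN1r ax => h.
by apply/eqP; rewrite eq_le Ab//=; lra.
Qed.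

(* The cone of feasible directions does not depend on the inequalities
   describing P, so those of the simplex can be used instead of a and b. *)
Lemma tangent_coneE (I : finType) m (a : 'I_m -> 'rV[R]_d) (b : 'I_m -> R)
    (a' : I -> 'rV[R]_d) (b' : I -> R) P A x :
  P = [set y | forall r, dotp (a r) y <= b r] ->
  P = [set y | forall r, dotp (a' r) y <= b' r] ->
  A `<=` P -> relint A x ->
  tangent_cone a b A =
  [set u | forall r, dotp (a' r) x = b' r -> dotp (a' r) u <= 0].
Proof.
move=> PE PE' AP rx; have Px : P x by apply: AP; case: rx.
have Ab r y : A y -> dotp (a r) y <= b r by move=> /AP; rewrite PE; exact.
apply/seteqP; split=> u /= h.
  apply/(feasible_directionE u PE' Px)/(feasible_directionE u PE Px) => r ar.
  by apply: h; apply/(activeE (Ab r) rx).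
move=> r /(activeE (Ab r) rx) ar.
by move/(feasible_directionE u PE' Px): h => /(feasible_directionE u PE Px); exact.
Qed.

End polyhedra.

Section simplex.
Context {R : realType} {d : nat}.
Variable tau : 'I_d -> R.
Hypothesis tau_gt0 : forall i, 0 < tau i.
Implicit Types (J : set 'I_d) (x y : 'rV[R]_d).

Let t : 'rV[R]_d := \row_i tau i.

Lemma vertexE i j : vertex tau i 0 j = (tau i)^-1 * (i == j)%:R.
Proof. by rewrite !mxE eqxx eq_sym. Qed.

Lemma dotp_vertex i : dotp t (vertex tau i) = 1.
Proof.
by rewrite dotpZr dotpC dotp_delta mxE mulVf// gt_eqF.
Qed.

(** [Some i] stands for the facet opposite to the vertex [i], [None] for the facet opposite to 0. *)
Definition simplex_normal (o : option 'I_d) : 'rV[R]_d :=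
  if o is Some i then - delta_mx 0 i else t.

Definition simplex_bound (o : option 'I_d) : R := if o is Some _ then 0 else 1.

Lemma simplexE : conv_hull ([set 0] `|` range (vertex tau)) =
  [set y | forall o, dotp (simplex_normal o) y <= simplex_bound o].
Proof.
apply/seteqP; split=> [y Py [i|]/=|y h].
- apply: conv_hull_le Py => _ [->|[j _ <-]]; rewrite dotpNl dotp_delta.
    by rewrite mxE oppr0.
  by rewrite vertexE oppr_le0 mulr_ge0// invr_ge0 ltW.
- apply: conv_hull_le Py => _ [->|[j _ <-]]; last by rewrite dotp_vertex.
  by rewrite -(scale0r 0) dotpZr mul0r.
- have y0 i : 0 <= y 0 i.
    by have := h (Some i); rewrite /= dotpNl dotp_delta oppr_le0.
  (* Barycentric coordinates: [tau_j y_j] at the vertex [j] and the remaining weight at 0. *)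
  exists d.+1, (fun i => if unlift ord0 i is Some j then tau j * y 0 j else 1 - dotp t y),
    (fun i => if unlift ord0 i is Some j then vertex tau j else 0); split.
  + split=> [i|].
      case: unliftP => [j _|_]; first by rewrite mulr_ge0// ltW.
      by rewrite subr_ge0; exact: (h None).
    rewrite big_ord_recl unlift_none -[RHS](subrK (dotp t y)); congr (_ + _).
    by apply: eq_bigr => i _; rewrite liftK mxE.
  + by move=> i; case: unliftP => [j _|_]; [right; exists j|left].
  + rewrite big_ord_recl unlift_none scaler0 add0r [LHS]row_sum_delta.
    apply: eq_bigr => i _; rewrite liftK scalerA mulrAC mulfV ?mul1r//.
    by rewrite gt_eqF.
Qed.

Let in_simplex J y : conv_hull ([set 0] `|` [set vertex tau i | i in J]) y ->
  [/\ forall i, 0 <= y 0 i, forall i, ~ J i -> y 0 i = 0 & dotp t y <= 1].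
Proof.
move=> Py; have y0 i : 0 <= y 0 i.
  rewrite -oppr_le0 -(dotp_delta y) -dotpNl; apply: conv_hull_le Py => _ [->|[j _ <-]];
    rewrite dotpNl dotp_delta.
    by rewrite mxE oppr0.
  by rewrite vertexE oppr_le0 mulr_ge0// invr_ge0 ltW.
split=> // [i Ji|]; last first.
  apply: conv_hull_le Py => _ [->|[j _ <-]]; last by rewrite dotp_vertex.
  by rewrite -(scale0r 0) dotpZr mul0r.
apply/eqP; rewrite eq_le y0 andbT -dotp_delta; apply: conv_hull_le Py => _ [->|[j Jj <-]].
  by rewrite dotp_delta mxE.
rewrite dotp_delta vertexE; have [ji|_] := eqVneq j i; last by rewrite mulr0.
by rewrite -ji in Ji.
Qed.

(** Prolonging the segment from the vertex [i] beyond [x] gives coordinate [i] the value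
    [(1 + e) x_i - e / tau_i], which is still nonnegative. *)
Let relint_coord (A : set 'rV[R]_d) x i :
  A `<=` [set y | 0 <= y 0 i] -> A (vertex tau i) -> relint A x -> 0 < x 0 i.
Proof.
move=> A0 Ai rx; have [e e0 /A0] := relint_extend rx Ai.
rewrite /= [X in 0 <= X -> _](_ : _ = (1 + e) * x 0 i - e * vertex tau i 0 i); last first.
  by rewrite [in LHS]mxE [in LHS]mxE [in LHS]mxE [in LHS]mxE; ring.
rewrite vertexE eqxx mulr1 subr_ge0 => h.
rewrite -(pmulr_rgt0 _ (_ : 0 < 1 + e)) ?addr_gt0//.
by apply: lt_le_trans h; rewrite mulr_gt0// invr_gt0.
Qed.

Lemma relint_simplex J x :
  relint (conv_hull ([set 0] `|` [set vertex tau i | i in J])) x ->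
  [/\ forall i, J i -> 0 < x 0 i, forall i, ~ J i -> x 0 i = 0 & dotp t x < 1].
Proof.
move=> rx; have [x0 xJ x1] := in_simplex rx.1; split=> // [i Ji|].
  apply: relint_coord rx; first by move=> y /in_simplex[+ _ _]; exact.
  by apply: sub_conv_hull; right; exists i.
(* Prolonging away from 0 multiplies [dotp t x] by [1 + e], which excludes the value 1. *)
have [|e e0 /in_simplex[_ _]] := @relint_extend _ _ _ _ 0 rx; first by apply: sub_conv_hull; left.
rewrite subr0 addrC dotpDr => h; rewrite lt_neqAle x1 andbT; apply/eqP => xe.
by move: h; rewrite xe mulr1; lra.
Qed.

Lemma relint_facet J x :
  relint (conv_hull [set vertex tau i | i in J]) x ->
  [/\ forall i, J i -> 0 < x 0 i, forall i, ~ J i -> x 0 i = 0 & dotp t x = 1].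
Proof.
have sub : conv_hull [set vertex tau i | i in J] `<=`
    conv_hull ([set 0] `|` [set vertex tau i | i in J]).
  by apply: conv_hullS => y; right.
move=> rx; have [x0 xJ x1] := in_simplex (sub _ rx.1); split=> // [i Ji|].
  apply: relint_coord rx; first by move=> y /sub/in_simplex[+ _ _]; exact.
  by apply: sub_conv_hull; exists i.
apply/eqP; rewrite eq_le x1 -[X in _ <= X]opprK -dotpNl lerNr.
by apply: conv_hull_le rx.1 => _ [i _ <-]; rewrite dotpNl dotp_vertex.
Qed.

(** For negative [kappa], [- kappa |y|^2 <= sum (tau_i y_i)^2 <= (sum tau_i y_i)^2 <= 1]. Equality
    is possible at a vertex on the boundary of the ball, so [y] is approximated by [r y] with
    [r < 1]. *)
Lemma simplex_sub_closure (kappa : R) : (forall i, - (tau i ^+ 2) <= kappa) ->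
  conv_hull ([set 0] `|` range (vertex tau)) `<=` closure (klein_ball kappa).
Proof.
move=> hk y; rewrite simplexE => h.
have y0 i : 0 <= y 0 i.
  by have := h (Some i); rewrite /= dotpNl dotp_delta oppr_le0.
have ty : \sum_i tau i * y 0 i <= 1.
  by move: (h None); rewrite /= /dotp (eq_bigr (fun i => tau i * y 0 i))// => i _; rewrite mxE.
rewrite /klein_ball; case: ifPn => [_|]; first exact: subset_closure.
rewrite -ltNge => k0; have k1 : 0 < - kappa by rewrite oppr_gt0.
have yk : - kappa * dotp y y <= 1.
  apply: (@le_trans _ _ ((\sum_i tau i * y 0 i) ^+ 2)); last first.
    by rewrite expr_le1// sumr_ge0// => i _; rewrite mulr_ge0// ltW.
  rewrite expr2 mulr_suml mulr_sumr; apply: ler_sum => i _.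
  apply: (@le_trans _ _ (tau i * y 0 i * (tau i * y 0 i))).
    by rewrite mulrACA ler_wpM2r ?mulr_ge0// -expr2 lerNl.
  rewrite ler_wpM2l//; first by rewrite mulr_ge0// ltW.
  rewrite (bigD1 i)//= lerDl sumr_ge0// => j _.
  by rewrite mulr_ge0// ltW.
move=> B By.
have cv : (fun r : R => r *: y) @ (1:R)^'- --> y.
  apply: cvg_at_left_filter; rewrite -[X in _ --> X]scale1r.
  by apply: cvgZr_tmp; exact: cvg_id.
have : \forall r \near (1:R)^'-, B (r *: y) by exact: cv.
move=> nB.
have [r [Br /andP[r0 r1]]] : exists r : R, B (r *: y) /\ 0 < r < 1.
  near (1:R)^'- => r; exists r; split; first by near: r.
  by apply/andP; split; near: r; [exact: nbhs_left_gt|exact: nbhs_left_lt].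
exists (r *: y); split=> //=.
have -> : 1 / Num.sqrt (- kappa) = Num.sqrt ((- kappa)^-1) :> R.
  by rewrite sqrtrV ?mul1r// ltW.
rewrite /enorm ltr_sqrt ?invr_gt0// dotpZl dotpZr mulrA -expr2.
rewrite -[X in _ < X]mul1r ltr_pdivlMr// -mulrA [_ * - kappa]mulrC.
apply: (@le_lt_trans _ _ (r ^+ 2)).
  by rewrite ler_piMr// sqr_ge0.
by rewrite expr_lt1// ltW.
Unshelve. all: by end_near. Qed.

End simplex.

(** * Coordinates for the Klein metric *)

Section cones_in_coordinates.
Context {R : realType}.
Local Notation T := (measurableTypeR R).

Lemma lin_hull_mulmx m n (b : 'M[R]_(m, n)) (K : set 'rV[R]_m) :
  lin_hull [set z *m b | z in K] = [set z *m b | z in lin_hull K].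
Proof.
apply: lin_hullE.
- by exists 0; [exact: lin_hull0|rewrite mul0mx].
- move=> a _ _ [q Kq <-] [r Kr <-]; exists (a *: q + r); first exact: lin_hullD.
  by rewrite mulmxDl scalemxAl.
- by move=> _ [q Kq <-]; exists q => //; exact: sub_lin_hull.
- move=> _ [q Kq <-]; move: q Kq; apply: lin_hullP => [|a u v hu hv|u Ku].
  + by rewrite mul0mx; exact: lin_hull0.
  + by rewrite mulmxDl -scalemxAl; exact: lin_hullD.
  + by apply: sub_lin_hull; exists u.
Qed.

Lemma lin_hull_setT m (K : set 'rV[R]_m) w :
  K w -> (forall i, K (w + delta_mx 0 i)) -> lin_hull K = setT.
Proof.
move=> Kw Kwi; apply: lin_hullE => // u _.
rewrite [u]row_sum_delta; elim/big_ind: _ => [|x y hx hy|i _].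
- exact: lin_hull0.
- by rewrite -[x]scale1r; exact: lin_hullD.
- rewrite -[X in lin_hull K X]addr0; apply: lin_hullD; last exact: lin_hull0.
  rewrite -[delta_mx _ _](addKr w) -scaleN1r; apply: lin_hullD; exact: sub_lin_hull.
Qed.

Section polyhedral_cone.
Variables (m : nat) (I : finType) (a : I -> 'rV[R]_m).

Definition polyhedral_cone : set 'rV[R]_m := [set z | forall r, dotp (a r) z <= 0].

Lemma measurable_polyhedral_cone :
  measurable [set c : m.-tuple T | polyhedral_cone (trow c)].
Proof.
rewrite [X in measurable X](_ : _ =
    \bigcap_(r in [set: I]) [set c : m.-tuple T | dotp (a r) (trow c) <= 0]); last first.
  by apply/seteqP; split=> c /= h r; [move=> _; exact: h|exact: h].
apply: fin_bigcap_measurable => // r _; apply: measurable_le_set => //.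
apply: measurable_sum => i; apply: measurable_funM => //.
under eq_fun do rewrite mxE; exact: measurable_tnth.
Qed.

Lemma trow_tscale (r : R) (c : m.-tuple R) : trow (tscale r c) = r *: trow c.
Proof. by apply/rowP => i; rewrite !mxE tnth_mktuple. Qed.

Lemma polyhedral_coneZ (r : R) : 0 < r ->
  tscale r @^-1` [set c : m.-tuple T | polyhedral_cone (trow c)] =
  [set c | polyhedral_cone (trow c)].
Proof.
move=> r0; apply/seteqP; split=> c /= h i; have := h i; rewrite trow_tscale dotpZr.
  by rewrite pmulr_rle0.
by rewrite pmulr_rle0.
Qed.

End polyhedral_cone.

Section orthonormal_coordinates.
Variables (n : nat) (g : 'rV[R]_n -> 'rV[R]_n -> R).
Hypothesis gDl : forall (a : R) u v w, g (a *: u + v) w = a * g u w + g v w.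
Hypothesis gC : forall u v, g u v = g v u.
Variables (m : nat) (b : 'M[R]_(m, n)).
Hypothesis ob : forall i j, g (row i b) (row j b) = (i == j)%:R.

Lemma orthonormal_left_inverse : exists c : 'M[R]_(n, m), b *m c = 1%:M.
Proof.
exists (\matrix_(j, i) g (delta_mx 0 j) (row i b)).
apply/matrixP => i j; rewrite [RHS]mxE -ob [row i b in RHS]row_sum_delta.
by rewrite (form_suml gDl) mxE; apply: eq_bigr => k _; rewrite !mxE.
Qed.

(** The linear map has to be defined on the whole ambient space, so it recovers coordinates by a
    one-sided inverse [c] of [b]. *)
Lemma cone_isometric_basis n' (b' : 'M[R]_(m, n')) (K : set 'rV[R]_m) :
  b' *m b'^T = 1%:M ->
  cone_isometric g [set z *m b | z in K] dotp [set z *m b' | z in K].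
Proof.
move=> bb'; have [c bc] := orthonormal_left_inverse.
have fE z : z *m b *m (c *m b') = z *m b'.
  by rewrite mulmxA -(mulmxA z) bc mulmx1.
exists (mulmxr (c *m b')); rewrite !lin_hull_mulmx; split.
- move=> _ _ [z _ <-] [y _ <-]; rewrite /= !fE (form_rows gDl gC)// dotpE.
  by rewrite trmx_mul mulmxA -(mulmxA z) bb' mulmx1.
- apply/seteqP; split=> [_ [_ [z Kz <-] <-]|_ [z Kz <-]]; first by exists z; rewrite //= fE.
  by exists (z *m b); rewrite /= ?fE//; exists z.
- apply/seteqP; split=> [_ [_ [z Kz <-] <-]|_ [z Kz <-]]; first by exists z; rewrite //= fE.
  by exists (z *m b); rewrite /= ?fE//; exists z.
Qed.

Lemma solid_angle_basis (I : finType) (a : I -> 'rV[R]_m) (C : set (m.-tuple T)) :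
  lin_hull (polyhedral_cone a) = setT ->
  C = [set c | polyhedral_cone a (trow c)] ->
  ((solid_angle g [set z *m b | z in polyhedral_cone a])%:E =
   ((Num.sqrt (2 * pi) ^+ m)^-1)%:E * gauss C)%E.
Proof.
move=> Ka CE.
have KE : [set z *m b | z in polyhedral_cone a] = [set trow c *m b | c in C].
  rewrite CE; apply/seteqP; split=> [_ [z Kz <-]|_ [c Kc <-]]; last by exists (trow c).
  have zE : trow [tuple z 0 i | i < m] = z.
    by apply/rowP => i; rewrite mxE tnth_mktuple.
  by exists [tuple z 0 i | i < m]; rewrite /= zE.
rewrite KE; apply: solid_angle_gauss => //.
- by rewrite CE; exact: measurable_polyhedral_cone.
- by move=> r; rewrite CE; exact: polyhedral_coneZ.
- by rewrite -KE lin_hull_mulmx Ka.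
Qed.

End orthonormal_coordinates.

Definition polar n (K : set 'rV[R]_n) : set 'rV[R]_n :=
  [set v | forall u, K u -> dotp v u <= 0].

Section square_basis.
Variables (n : nat) (g : 'rV[R]_n -> 'rV[R]_n -> R) (b : 'M[R]_n).
Hypothesis gDl : forall (a : R) u v w, g (a *: u + v) w = a * g u w + g v w.
Hypothesis gC : forall u v, g u v = g v u.
Hypothesis ob : forall i j, g (row i b) (row j b) = (i == j)%:R.

Lemma orthonormal_unit : b \in unitmx.
Proof. by have [c /mulmx1_unit[]] := orthonormal_left_inverse gDl ob. Qed.

Lemma set_coords (K : set 'rV[R]_n) : K = [set z *m b | z in [set z | K (z *m b)]].
Proof.
apply/seteqP; split=> [u Ku|_ [z Kz <-]//].
by exists (u *m invmx b); rewrite /= mulmxKV// orthonormal_unit.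
Qed.

Lemma polar_coords (K : set 'rV[R]_n) :
  [set v | forall u, [set z *m b | z in K] u -> g v u <= 0] =
  [set z *m b | z in polar K].
Proof.
rewrite [LHS]set_coords; congr image; apply/seteqP; split=> z /= h u Ku.
  by rewrite dotpE -(form_rows gDl gC _ _ ob); apply: h; exists u.
by case: Ku => y Ky <-; rewrite (form_rows gDl gC)// -dotpE; exact: h.
Qed.

Lemma orthonormal_mul m (Q : 'M[R]_(m, n)) : Q *m Q^T = 1%:M ->
  forall i j, g (row i (Q *m b)) (row j (Q *m b)) = (i == j)%:R.
Proof.
move=> QQ i j; rewrite !row_mul (form_rows gDl gC)//.
have -> : (i == j)%:R = (Q *m Q^T) i j by rewrite QQ mxE.
by rewrite mxE [RHS]mxE; apply: eq_bigr => k _; rewrite !mxE.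
Qed.

End square_basis.

End cones_in_coordinates.

Section klein_metric.
Context {R : realType} {d : nat}.
Variables (kappa : R) (x : 'rV[R]_d).

Lemma klein_formDl (a : R) u v w : klein_form kappa x (a *: u + v) w =
  a * klein_form kappa x u w + klein_form kappa x v w.
Proof. by rewrite /klein_form dotpDl dotpDr; ring. Qed.

Lemma klein_formC u v : klein_form kappa x u v = klein_form kappa x v u.
Proof. by rewrite /klein_form (dotpC u); ring. Qed.

Hypothesis xB : klein_ball kappa x.

Let q := 1 + kappa * dotp x x.

Lemma klein_ball_gt0 : 0 < q.
Proof.
move: xB; rewrite /klein_ball /q; case: ifPn => [k0 _|].
  by rewrite ltr_wpDr// mulr_ge0// dotp_ge0.
rewrite -ltNge -oppr_gt0 => k0 /=.
have -> : 1 / Num.sqrt (- kappa) = Num.sqrt ((- kappa)^-1) :> R.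
  by rewrite sqrtrV ?mul1r// ltW.
rewrite /enorm ltr_sqrt ?invr_gt0// -[X in _ < X]mul1r ltr_pdivlMr//.
by rewrite mulrC; lra.
Qed.

(** The root beta of [2 beta + beta^2 |x|^2 = kappa], written in the form that also makes sense at
    [x = 0]. This equation lets [klein_mx] absorb the rank-one term of the metric. *)
Definition klein_coef : R := kappa / (1 + Num.sqrt q).

Let sqr_q : Num.sqrt q ^+ 2 = q.
Proof. by rewrite sqr_sqrtr// ltW// klein_ball_gt0. Qed.

Let q1 : 1 + Num.sqrt q != 0.
Proof. by rewrite gt_eqF// ltr_wpDr// sqrtr_ge0. Qed.

Lemma klein_coef_sqrt : 1 + klein_coef * dotp x x = Num.sqrt q.
Proof.
have kx : kappa * dotp x x = Num.sqrt q ^+ 2 - 1 by rewrite sqr_q /q addrC addKr.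
have frac (r : R) : 1 + r != 0 -> 1 + (r ^+ 2 - 1) / (1 + r) = r.
  by move=> r1; rewrite subr_sqr_1 [r + 1]addrC mulfK// addrC subrK.
by rewrite /klein_coef -/q mulrAC kx frac.
Qed.

Lemma klein_coef_sqr : 2 * klein_coef + klein_coef ^+ 2 * dotp x x = kappa.
Proof.
have -> : 2 * klein_coef + klein_coef ^+ 2 * dotp x x =
    klein_coef * (1 + (1 + klein_coef * dotp x x)) by ring.
by rewrite klein_coef_sqrt /klein_coef divfK.
Qed.

Definition klein_mx : 'M[R]_d := Num.sqrt q *: (1%:M + klein_coef *: (x^T *m x)).

Lemma mul_klein_mx z :
  z *m klein_mx = Num.sqrt q *: (z + (klein_coef * dotp x z) *: x).
Proof.
rewrite -scalemxAr mulmxDr mulmx1 -scalemxAr mulmxA [z *m x^T]mx11_scalar.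
by rewrite mul_scalar_mx scalerA -dotpE (dotpC z).
Qed.

Lemma klein_mx_form z y : klein_form kappa x (z *m klein_mx) (y *m klein_mx) = dotp z y.
Proof.
have q0 : q != 0 by rewrite gt_eqF// klein_ball_gt0.
(* [x] is an eigenvector of the symmetric matrix [klein_mx] with eigenvalue [q]. *)
have h w : dotp x (w *m klein_mx) = q * dotp x w.
  rewrite mul_klein_mx dotpZr addrC dotpDr -[in RHS]sqr_q expr2 -[RHS]mulrA; congr (_ * _).
  by rewrite -klein_coef_sqrt; ring.
rewrite /klein_form !h sqr_enorm -/q !mul_klein_mx dotpZl dotpZr.
rewrite [z + _]addrC [y + _]addrC dotpDl !dotpDr mulrA -expr2 sqr_q.
rewrite -[X in _ - X * _ * _ / _]klein_coef_sqr (dotpC z x).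
by field.
Qed.

Lemma klein_mx_orthonormal i j :
  klein_form kappa x (row i klein_mx) (row j klein_mx) = (i == j)%:R.
Proof. by rewrite !rowE klein_mx_form dotp_delta mxE eqxx. Qed.

End klein_metric.

(** * Faces containing the origin *)

Lemma big_rshift (S : Type) (idx : S) (op : Monoid.law idx) k n (F : 'I_(k + n) -> S) :
  \big[op/idx]_(i < k + n | (k <= i)%N) F i = \big[op/idx]_(j < n) F (rshift k j).
Proof.
rewrite big_mkcond big_split_ord/= big1 => [|i _]; last by rewrite leqNgt ltn_ord.
by rewrite Monoid.mul1m; apply: eq_bigr => j _; rewrite leq_addr.
Qed.

Lemma card_rshift k n : #|[pred i : 'I_(k + n) | (k <= i)%N]| = n.
Proof. by rewrite -sum1_card (big_rshift _ (fun=> 1%N)) sum1_card card_ord. Qed.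

Lemma dotp_row_mx (R : realType) k n (u v : 'rV[R]_k) (u' v' : 'rV[R]_n) :
  dotp (row_mx u u') (row_mx v v') = dotp u v + dotp u' v'.
Proof. by rewrite !dotpE tr_row_mx mul_row_col mxE. Qed.

Lemma dotp_eq_polar (R : realType) n (K : set 'rV[R]_n) v u :
  polar K v -> K u -> K (- u) -> dotp v u = 0.
Proof.
move=> Kv Ku Ku'; apply/eqP; rewrite eq_le Kv//=.
by rewrite -oppr_le0 dotpC -dotpNl dotpC Kv.
Qed.

Section tangent_cones.
Context {R : realType}.
Variables (k n : nat) (tau : 'I_(k + n) -> R).
Hypothesis tau_gt0 : forall i, 0 < tau i.
Variables (m : nat) (a : 'I_m -> 'rV[R]_(k + n)) (b : 'I_m -> R).
Let P := conv_hull ([set 0] `|` range (vertex tau)).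
Hypothesis PE : P = [set y | forall r, dotp (a r) y <= b r].

Let t : 'rV[R]_(k + n) := \row_i tau i.

(** At a relative interior point the first [k] coordinates are positive and [dotp t x < 1], so only
    the last [n] sign constraints are active. *)
Lemma tangent_simplex x :
  let F := conv_hull ([set 0] `|` [set vertex tau i | i in [set i : 'I_(k + n) | (i < k)%N]]) in
  relint F x ->
  (forall j, x 0 (rshift k j) = 0) /\
  tangent_cone a b F = [set u : 'rV[R]_(k + n) | forall j, 0 <= u 0 (rshift k j)].
Proof.
move=> F rx; have [x0 xJ x1] := relint_simplex tau_gt0 rx.
have xr j : x 0 (rshift k j) = 0 by apply: xJ => /=; rewrite ltnNge leq_addr.
split=> //; rewrite (tangent_coneE PE (simplexE tau_gt0) _ rx); last first.
  by apply: conv_hullS; apply: setUS => _ [i _ <-]; exists i.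
apply/seteqP; split=> u /= h.
  move=> j; have := h (Some (rshift k j)); rewrite /= !dotpNl !dotp_delta xr oppr0 oppr_le0.
  exact.
case=> [i|] /=; last by move=> xe; move: x1; rewrite xe ltxx.
rewrite !dotpNl !dotp_delta oppr_le0; case: (split_ordP i) => j -> //.
by move/eqP; rewrite oppr_eq0 gt_eqF// x0/=.
Qed.

Lemma tangent_facet x :
  let G := conv_hull [set vertex tau i | i in [set i : 'I_(k + n) | (i < k)%N]] in
  relint G x ->
  [/\ dotp t x = 1, forall j, x 0 (rshift k j) = 0 &
  tangent_cone a b G = [set u : 'rV[R]_(k + n) | (forall j, 0 <= u 0 (rshift k j)) /\ dotp t u <= 0]].
Proof.
move=> F rx; have [x0 xJ x1] := relint_facet tau_gt0 rx.
have xr j : x 0 (rshift k j) = 0 by apply: xJ => /=; rewrite ltnNge leq_addr.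
split=> //; rewrite (tangent_coneE PE (simplexE tau_gt0) _ rx); last first.
  by apply: conv_hullS => _ [i _ <-]; right; exists i.
apply/seteqP; split=> u /= h.
  split; last exact: (h None).
  move=> j; have := h (Some (rshift k j)); rewrite /= !dotpNl !dotp_delta xr oppr0 oppr_le0.
  exact.
case=> [i|] /=; last by case: h.
rewrite !dotpNl !dotp_delta oppr_le0; case: (split_ordP i) => j -> //; last by case: h.
by move/eqP; rewrite oppr_eq0 gt_eqF// x0/=.
Qed.

End tangent_cones.

Section face_through_0.
Context {R : realType}.
Variables (k n : nat) (tau : 'I_(k + n) -> R).
Hypothesis tau_gt0 : forall i, 0 < tau i.
Variables (m : nat) (a : 'I_m -> 'rV[R]_(k + n)) (b : 'I_m -> R).
Hypothesis PE : conv_hull ([set 0] `|` range (vertex tau)) =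
  [set y | forall r, dotp (a r) y <= b r].
Variables (kappa : R) (x : 'rV[R]_(k + n)).
Hypothesis xB : klein_ball kappa x.
Let F := conv_hull ([set 0] `|` [set vertex tau i | i in [set i : 'I_(k + n) | (i < k)%N]]).
Hypothesis rx : relint F x.
Let g := klein_form kappa x.
Let W := klein_mx kappa x.
Let gDl := klein_formDl kappa x.
Let gC := klein_formC kappa x.
Let ob := klein_mx_orthonormal xB.

Let orthant_polyhedral : orthant n = polyhedral_cone (fun j => - delta_mx 0 j : 'rV[R]_n).
Proof.
by apply/seteqP; split=> u h j; have := h j; rewrite dotpNl dotp_delta oppr_le0.
Qed.

Let sum_polyhedral : orth_sum (setT : set 'rV[R]_k) (orthant n) =
  polyhedral_cone (fun j => - delta_mx 0 (rshift k j) : 'rV[R]_(k + n)).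
Proof.
apply/seteqP; split=> [_ [u _ [v v0 <-]] j|u h].
  by rewrite dotpNl dotp_delta row_mxEr oppr_le0; exact: v0.
exists (lsubmx u) => //; exists (rsubmx u); last by rewrite hsubmxK.
by move=> j; have := h j; rewrite dotpNl dotp_delta mxE oppr_le0.
Qed.

(** [x] vanishes in the last [n] coordinates, so there [klein_mx] only multiplies by
    [sqrt q > 0]. *)
Let tangentE : tangent_cone a b F =
  [set z *m W | z in orth_sum (setT : set 'rV[R]_k) (orthant n)].
Proof.
have [xr ->] := tangent_simplex tau_gt0 PE rx.
rewrite [LHS](set_coords gDl ob); congr image; rewrite sum_polyhedral.
have q0 : 0 < Num.sqrt (1 + kappa * dotp x x) by rewrite sqrtr_gt0; exact: klein_ball_gt0.
apply/seteqP; split=> z /= h j; have := h j; rewrite dotpNl dotp_delta oppr_le0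
  mul_klein_mx !mxE xr mulr0 addr0; first by rewrite pmulr_rge0.
by move=> zj; rewrite pmulr_rge0.
Qed.

(** The polar cone consists of the vectors supported on the last [n] coordinates with nonpositive
    entries; the sign parametrises it by the standard orthant. *)
Let S : 'M[R]_(n, k + n) := row_mx 0 (- 1%:M).

Let SS : S *m S^T = 1%:M.
Proof.
by rewrite /S tr_row_mx mul_row_col mul0mx add0r linearN/= trmx1 mulmxN mulNmx mulmx1 opprK.
Qed.

Let normalE : normal_cone kappa a b x F = [set z *m (S *m W) | z in orthant n].
Proof.
rewrite /normal_cone tangentE (polar_coords gDl gC ob).
have Sz (z : 'rV[R]_n) : z *m S = row_mx 0 (- z).
  by rewrite mul_mx_row mulmx0 mulmxN mulmx1.
apply/seteqP; split=> [_ [v Kv <-]|_ [z z0 <-]].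
  exists (- rsubmx v); last first.
    rewrite mulmxA Sz opprK -[v in RHS]hsubmxK; congr (row_mx _ _ *m _).
    (* A polar vector is orthogonal to the lineality space [R^k]. *)
    apply/rowP => i; rewrite [LHS]mxE -dotp_delta.
    have Ki (c : R) : orth_sum (setT : set 'rV[R]_k) (orthant n) (row_mx (c *: delta_mx 0 i) 0).
      by exists (c *: delta_mx 0 i) => //; exists 0 => // j; rewrite mxE.
    have := @dotp_eq_polar _ _ _ v (row_mx (1 *: delta_mx 0 i) 0) Kv (Ki 1).
    rewrite opp_row_mx -scaleNr oppr0 => /(_ (Ki _)).
    rewrite -[v in X in X -> _]hsubmxK dotp_row_mx scale1r dotpC => <-.
    by rewrite [X in _ + X]big1 ?addr0// => j _; rewrite !mxE mulr0.
  move=> j; rewrite mxE oppr_ge0.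
  have := Kv (row_mx 0 (delta_mx 0 j)); rewrite -[v in X in X -> _]hsubmxK dotp_row_mx.
  rewrite [X in X + _]big1 ?add0r => [|i _]; last by rewrite !mxE mulr0.
  rewrite dotpC dotp_delta; apply; exists 0 => //; exists (delta_mx 0 j) => // i.
  by rewrite mxE; case: (_ && _).
exists (z *m S); last by rewrite mulmxA.
move=> _ [u _ [v v0 <-]]; rewrite Sz dotp_row_mx.
rewrite [X in X + _]big1 ?add0r => [|i _]; last by rewrite !mxE mul0r.
by rewrite dotpNl oppr_le0; apply: sumr_ge0 => i _; rewrite mulr_ge0.
Qed.

Let quadrant_angle p (J : pred 'I_p) : #|J| = n ->
  (((Num.sqrt (2 * pi) ^+ p)^-1)%:E * (Num.sqrt (2 * pi) ^+ p / 2 ^+ #|J|)%:E =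
   (1 / 2 ^+ n)%:E :> \bar R)%E.
Proof.
move=> ->; rewrite -EFinM mulrA mulVf ?mul1r ?div1r// expf_neq0// gt_eqF//.
exact: s2pi_gt0.
Qed.

Lemma face_through_0_cones :
  [/\ cone_isometric g (normal_cone kappa a b x F) dotp (orthant n),
      solid_angle g (normal_cone kappa a b x F) = 1 / 2 ^+ n,
      cone_isometric g (tangent_cone a b F) dotp
        (orth_sum (setT : set 'rV[R]_k) (orthant n))
    & solid_angle g (tangent_cone a b F) = 1 / 2 ^+ n].
Proof.
have oSW := orthonormal_mul gDl gC ob SS.
have id1 p (K : set 'rV[R]_p) : K = [set z *m 1%:M | z in K].
  apply/seteqP; split=> [u Ku|_ [u Ku <-]]; last by rewrite mulmx1.
  by exists u; rewrite ?mulmx1.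
have o0 p (K : set 'rV[R]_p) : (forall i, K (delta_mx 0 i)) -> K 0 -> lin_hull K = setT.
  by move=> Ki K0; apply: (lin_hull_setT K0) => i; rewrite add0r.
rewrite normalE tangentE; split.
- rewrite [X in cone_isometric _ _ _ X]id1; apply: cone_isometric_basis => //.
  by rewrite trmx1 mulmx1.
- apply: EFin_inj; rewrite orthant_polyhedral.
  rewrite (@solid_angle_basis _ _ _ gDl gC _ _ oSW _ _ (quadrant predT)).
  + by rewrite gauss_quadrant quadrant_angle// card_ord.
  + rewrite -orthant_polyhedral; apply: o0 => [i j|i]; rewrite mxE//.
  + rewrite -orthant_polyhedral; apply/seteqP; split=> c /= h i; have := h i; rewrite mxE//.
    exact.
- rewrite [X in cone_isometric _ _ _ X]id1; apply: cone_isometric_basis => //.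
  by rewrite trmx1 mulmx1.
- apply: EFin_inj; rewrite sum_polyhedral.
  rewrite (@solid_angle_basis _ _ _ gDl gC _ _ ob _ _ (quadrant [pred i : 'I_(k + n) | (k <= i)%N])).
  + by rewrite gauss_quadrant quadrant_angle// card_rshift.
  + apply: o0 => [i j|j]; rewrite dotpNl dotp_delta oppr_le0 mxE//.
  + apply/seteqP; split=> c /= h i.
      by rewrite dotpNl dotp_delta oppr_le0 mxE; apply: h => /=; exact: leq_addr.
    case: (split_ordP i) => j -> /=; first by rewrite leqNgt ltn_ord.
    by have := h j; rewrite dotpNl dotp_delta oppr_le0 mxE.
Qed.

End face_through_0.

(** * Faces not containing the origin *)

Lemma pos_hullP (R : realType) n (S : set 'rV[R]_n) (V : 'rV[R]_n -> Prop) :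
  V 0 -> (forall (a : R) u v, 0 <= a -> V u -> V v -> V (a *: u + v)) ->
  (forall u, S u -> V u) -> forall u, pos_hull S u -> V u.
Proof.
move=> V0 VD SV u [m [c [p [c0 pS ->]]]].
elim/big_ind: _ => // [x y Vx Vy|i _]; first by rewrite -[x]scale1r; exact: VD.
by rewrite -[_ *: _]addr0; apply: VD => //; exact: SV.
Qed.

Lemma pos_hull_sum (R : realType) n (S : set 'rV[R]_n) p (c : 'I_p -> R)
    (w : 'I_p -> 'rV[R]_n) (c0 : R) w0 :
  0 <= c0 -> (forall i, 0 <= c i) -> S w0 -> (forall i, S (w i)) ->
  pos_hull S (c0 *: w0 + \sum_i c i *: w i).
Proof.
move=> c00 ci Sw0 Sw.
exists p.+1, (fun i => if unlift ord0 i is Some j then c j else c0),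
  (fun i => if unlift ord0 i is Some j then w j else w0); split.
- by move=> i; case: unliftP.
- by move=> i; case: unliftP.
- rewrite big_ord_recl unlift_none; congr (_ + _).
  by apply: eq_bigr => i _; rewrite liftK.
Qed.

(** The reflection in the hyperplane orthogonal to [w = u - v]; equal lengths give
    [|w|^2 = 2 <u, w>]. *)
Lemma householder (R : realType) n (u v : 'rV[R]_n) : dotp u u = dotp v v ->
  exists2 H : 'M[R]_n, u *m H = v & H *m H^T = 1%:M.
Proof.
move=> uv; pose w := -1 *: v + u.
have wu : w = u - v by rewrite /w scaleN1r addrC.
have [w0|w0] := eqVneq (dotp w w) 0.
  exists 1%:M; last by rewrite trmx1 mulmx1.
  by rewrite mulmx1; apply/eqP; rewrite -subr_eq0 -wu (dotp_eq0 w0).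
pose s := 2 / dotp w w; pose H := 1%:M - s *: (w^T *m w).
have wE : dotp w w = 2 * dotp u w.
  by rewrite /w dotpDl !dotpDr uv (dotpC v u); ring.
have HT : H^T = H by rewrite /H linearB/= linearZ/= trmx_mul trmxK trmx1.
exists H.
  rewrite /H mulmxBr mulmx1 -scalemxAr mulmxA [u *m w^T]mx11_scalar -dotpE.
  rewrite mul_scalar_mx scalerA /s (_ : 2 / dotp w w * dotp u w = 1).
    by rewrite scale1r wu subKr.
  by rewrite mulrAC -wE mulfV.
rewrite HT /H mulmxBl mul1mx mulmxBr mulmx1 -scalemxAr -scalemxAl.
rewrite [w^T *m w *m _]mulmxA -[w^T *m w *m w^T]mulmxA [w *m w^T]mx11_scalar -dotpE.
rewrite mul_mx_scalar -scalemxAl !scalerA.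
have -> : s * s * dotp w w = s + s by rewrite /s; field.
rewrite scalerDl; set A := s *: _; have -> : A - (A + A) = - A.
  by rewrite opprD addrA subrr sub0r.
by rewrite opprK subrK.
Qed.

Section facet_cones.
Context {R : realType}.
Variables (k n : nat) (tau : 'I_(k.+1 + n) -> R).
Hypothesis tau_gt0 : forall i, 0 < tau i.
Variables (m : nat) (a : 'I_m -> 'rV[R]_(k.+1 + n)) (b : 'I_m -> R).
Hypothesis PE : conv_hull ([set 0] `|` range (vertex tau)) =
  [set y | forall r, dotp (a r) y <= b r].
Variables (kappa : R) (x : 'rV[R]_(k.+1 + n)).
Hypothesis xB : klein_ball kappa x.
Let G := conv_hull [set vertex tau i | i in [set i : 'I_(k.+1 + n) | (i <= k)%N]].
Hypothesis rx : relint G x.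
Let g := klein_form kappa x.
Let W := klein_mx kappa x.
Let gDl := klein_formDl kappa x.
Let gC := klein_formC kappa x.
Let ob := klein_mx_orthonormal xB.
Let t : 'rV[R]_(k.+1 + n) := \row_i tau i.
Let s := kappa + \sum_(i < k.+1 + n | (i <= k)%N) tau i ^+ 2.

(* The image of t under the adjoint of klein_mx, up to a positive factor. *)
Let p := t + klein_coef kappa x *: x.

Let xr : rsubmx x = 0.
Proof.
by have [_ xr _] := tangent_facet tau_gt0 PE rx; apply/rowP => j; rewrite !mxE xr.
Qed.

Let tx : dotp t x = 1.
Proof. by have [] := tangent_facet tau_gt0 PE rx. Qed.

Let p_right : rsubmx p = rsubmx t.
Proof. by rewrite /p linearD/= linearZ/= xr scaler0 addr0. Qed.

Let dotp_left (u v : 'rV[R]_(k.+1 + n)) : rsubmx v = 0 ->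
  dotp (lsubmx u) (lsubmx v) = dotp u v.
Proof.
move=> v0; rewrite -[u in RHS]hsubmxK -[v in RHS]hsubmxK v0 dotp_row_mx.
by rewrite [X in _ + X]big1 ?addr0// => i _; rewrite !mxE mulr0.
Qed.

(** Since [dotp t x = 1], the terms with [klein_coef] add up to [2 beta + beta^2 |x|^2 = kappa]. *)
Let dotp_p_left : dotp (lsubmx p) (lsubmx p) = s.
Proof.
have -> : lsubmx p = klein_coef kappa x *: lsubmx x + lsubmx t.
  by rewrite /p linearD/= linearZ/= addrC.
rewrite dotpDl !dotpDr (dotpC (lsubmx x) (lsubmx t)) !(dotp_left _ xr) tx /s.
rewrite -[X in _ = X + _](klein_coef_sqr xB) mulr1.
have -> : \sum_(i < k.+1 + n | (i <= k)%N) tau i ^+ 2 = dotp (lsubmx t) (lsubmx t).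
  rewrite big_mkcond big_split_ord/= [X in _ + X]big1 ?addr0 => [|i _].
    by apply: eq_bigr => i _; rewrite !mxE -ltnS ltn_ord.
  by rewrite leqNgt ltn_addr ?ltnS.
by ring.
Qed.

(** The left part of [p] is nonzero because [dotp p x = sqrt q > 0]. Strict positivity thus comes
    from [x] lying in the open ball; [kappa >= - tau_i^2] alone permits [s = 0] at a vertex. *)
Let s_gt0 : 0 < s.
Proof.
rewrite -dotp_p_left lt_neqAle dotp_ge0 andbT eq_sym; apply/eqP => /dotp_eq0 p0.
have : dotp (lsubmx p) (lsubmx x) = 0 by rewrite p0 -(scale0r 0) dotpZl mul0r.
rewrite dotp_left// /p addrC dotpDl tx addrC (klein_coef_sqrt xB) => /eqP.
by rewrite gt_eqF// sqrtr_gt0 klein_ball_gt0.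
Qed.

Let r := Num.sqrt s.

Let r_gt0 : 0 < r. Proof. by rewrite sqrtr_gt0. Qed.
Let r_neq0 : r != 0. Proof. by rewrite gt_eqF. Qed.
Let sqr_r : r ^+ 2 = s. Proof. by rewrite sqr_sqrtr// ltW. Qed.

(** The image of [p] under the reflection of its left part onto the first axis. With the minus sign,
    the cone lies on the side of nonnegative head. *)
Let w0 : 'rV[R]_(k.+1 + n) := row_mx (- r *: delta_mx 0 0) (rsubmx t).

Let dotp_w0 z : dotp w0 z =
  - (r * z 0 (lshift n 0)) + \sum_j tau (rshift k.+1 j) * z 0 (rshift k.+1 j).
Proof.
rewrite -[z in LHS]hsubmxK dotp_row_mx dotpZl dotp_delta mxE mulNr; congr (_ + _).
by apply: eq_bigr => j _; rewrite !mxE.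
Qed.

Let wv (o : option 'I_n) : 'rV[R]_(k.+1 + n) :=
  if o is Some j then - delta_mx 0 (rshift k.+1 j) else w0.

Let K := polyhedral_cone wv.

Let KP z : K z <-> (forall j, 0 <= z 0 (rshift k.+1 j)) /\
  \sum_j tau (rshift k.+1 j) * z 0 (rshift k.+1 j) <= r * z 0 (lshift n 0).
Proof.
split=> [h|[h1 h2] [j|]].
- split=> [j|]; first by have := h (Some j); rewrite dotpNl dotp_delta oppr_le0.
  by have := h None; rewrite dotp_w0 addrC subr_le0.
- by rewrite dotpNl dotp_delta oppr_le0.
- by rewrite dotp_w0 addrC subr_le0.
Qed.

(** Up to the factor [sqrt q], the constraint [dotp t u <= 0] pulls back through [klein_mx] to [p]
    and then through the reflection to [w0]. The reflection fixes the last [n] coordinates and with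
    them the sign constraints. *)
Let basis : exists2 B : 'M[R]_(k.+1 + n),
  forall i j, g (row i B) (row j B) = (i == j)%:R &
  tangent_cone a b G = [set z *m B | z in K].
Proof.
have [|H pH HH] := @householder _ _ (lsubmx p) (- r *: delta_mx 0 0).
  by rewrite dotp_p_left dotpZl dotpZr dotp_delta mxE eqxx mulr1 mulrNN -expr2 sqr_r.
pose H' : 'M[R]_(k.+1 + n) := block_mx H 0 0 1%:M.
have HH' : H'^T *m H'^T^T = 1%:M.
  apply/mulmx1C; rewrite trmxK tr_block_mx mulmx_block HH !trmx0 !mulmx0 !mul0mx.
  by rewrite !addr0 add0r trmx1 mulmx1 -scalar_mx_block.
have pH' : p *m H' = w0.
  by rewrite -[p]hsubmxK mul_row_block pH !mulmx0 addr0 add0r mulmx1 p_right.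
exists (H'^T *m W); first exact: (orthonormal_mul gDl gC ob HH').
have [_ xr0 ->] := tangent_facet tau_gt0 PE rx.
have oB := orthonormal_mul gDl gC ob HH'.
rewrite [LHS](set_coords gDl oB); congr image.
have q0 : 0 < Num.sqrt (1 + kappa * dotp x x) by rewrite sqrtr_gt0; exact: klein_ball_gt0.
have tz z : dotp t (z *m (H'^T *m W)) = Num.sqrt (1 + kappa * dotp x x) * dotp w0 z.
  rewrite mulmxA mul_klein_mx dotpZr [z *m _ + _]addrC dotpDr tx mulr1 -pH'; congr (_ * _).
  rewrite [RHS]dotpE -mulmxA -[in RHS](trmxK H') -trmx_mul -dotpE /p.
  by rewrite [t + _]addrC dotpDl.
have zr (z : 'rV[R]_(k.+1 + n)) j : (z *m (H'^T *m W)) 0 (rshift k.+1 j) =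
    Num.sqrt (1 + kappa * dotp x x) * z 0 (rshift k.+1 j).
  rewrite mulmxA mul_klein_mx !mxE xr0 mulr0 addr0; congr (_ * _).
  rewrite big_split_ord/= big1 ?add0r => [|i _]; last by rewrite mxE block_mxEdl mxE mulr0.
  rewrite (bigD1 j)//= mxE block_mxEdr mxE eqxx mulr1 big1 ?addr0// => i ij.
  by rewrite mxE block_mxEdr mxE eq_sym (negbTE ij) mulr0.
apply/seteqP; split=> z /=.
  move=> [h1 h2] [j|] /=; first by move: (h1 j); rewrite zr dotpNl dotp_delta oppr_le0 pmulr_rge0.
  by move: h2; rewrite tz pmulr_rle0.
move=> h; split; last by rewrite tz pmulr_rle0//; exact: (h None).
by move=> j; have := h (Some j); rewrite zr dotpNl dotp_delta oppr_le0 pmulr_rge0.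
Qed.

(** * The polar cone and its generators *)

Let alpha j := tau (rshift k.+1 j) / r.

Let alpha_ge0 j : 0 <= alpha j.
Proof. by rewrite divr_ge0// ltW. Qed.

Let D := polyhedral_cone (fun o : option 'I_n => if o is Some j
  then - (alpha j *: delta_mx 0 0 + delta_mx 0 (lift ord0 j))
  else - delta_mx 0 0 : 'rV[R]_n.+1).

Let DP z : D z <-> 0 <= z 0 0 /\ forall j, - (alpha j * z 0 0) <= z 0 (lift ord0 j).
Proof.
split=> [h|[h1 h2] [j|]].
- split=> [|j]; first by have := h None; rewrite dotpNl dotp_delta oppr_le0.
  by have := h (Some j); rewrite dotpNl dotpDl !dotp_delta oppr_le0 -lerBlDl sub0r.
- by rewrite dotpNl dotpDl !dotp_delta oppr_le0 -lerBlDl sub0r.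
- by rewrite dotpNl dotp_delta oppr_le0.
Qed.

(** Skips the [k] lineality directions of [K], to which the polar cone is orthogonal; the sign makes
    the head coordinate nonnegative. *)
Let S : 'M[R]_(1 + n, k.+1 + n) := - block_mx (delta_mx 0 0) 0 0 1%:M.

Let SS : S *m S^T = 1%:M.
Proof.
rewrite /S linearN/= mulmxN mulNmx opprK tr_block_mx mulmx_block !trmx0 trmx1.
have d1 : delta_mx 0 0 = 1%:M :> 'M[R]_1 by apply/matrixP => i j; rewrite !ord1 !mxE.
by rewrite !mulmx0 !mul0mx !addr0 add0r mulmx1 trmx_delta mul_delta_mx d1 -scalar_mx_block.
Qed.

Let head (c : R) (u : 'rV[R]_n) : (row_mx c%:M u : 'rV_n.+1) 0 0 = c.
Proof.
have -> : 0 = lshift n 0 :> 'I_(1 + n) by exact: val_inj.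
by apply: etrans (row_mxEl _ _ _ _) _; rewrite mxE.
Qed.

Let tail (c : R) (u : 'rV[R]_n) j : (row_mx c%:M u : 'rV_n.+1) 0 (lift ord0 j) = u 0 j.
Proof. by rewrite -rshift1; exact: row_mxEr. Qed.

Let mulS (z : 'rV[R]_n.+1) : z *m S = row_mx (- z 0 0 *: delta_mx 0 0) (- \row_j z 0 (lift ord0 j)).
Proof.
have zE : z = row_mx (z 0 0)%:M (\row_j z 0 (lift ord0 j)) :> 'rV_(1 + n).
  apply/rowP => i; case: (split_ordP i) => j ->; first by rewrite row_mxEl ord1 mxE lshift0.
  by rewrite row_mxEr mxE rshift1.
transitivity ((row_mx (z 0 0)%:M (\row_j z 0 (lift ord0 j)) : 'rV_(1 + n)) *m S).
  by rewrite -zE.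
rewrite /S mulmxN mul_row_block !mulmx0 addr0 add0r mulmx1 opp_row_mx.
by rewrite mul_scalar_mx scaleNr.
Qed.

Let w (j : 'I_(k.+1 + n)) : 'rV[R]_(k.+1 + n) := - delta_mx 0 j.
Let above := [set j : 'I_(k.+1 + n) | (k < j)%N].
Let dual_rays := [set w0] `|` [set w j | j in above].

Let K_row (u : 'rV[R]_k.+1) (v : 'rV[R]_n) : (forall j, 0 <= v 0 j) ->
  \sum_j tau (rshift k.+1 j) * v 0 j <= r * u 0 0 -> K (row_mx u v).
Proof.
move=> v0 h; apply/KP; split=> [j|]; first by rewrite row_mxEr.
by rewrite row_mxEl; under eq_bigr do rewrite row_mxEr.
Qed.

(** The first of three inclusions that close a cycle: the polar cone, the image of [D], the hull of
    [dual_rays]. The image of [D] serves the angle, the hull the isometry. *)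
Let polar_sub : polar K `<=` [set z *m S | z in D].
Proof.
move=> v Kv.
have dv (u : 'rV[R]_k.+1) u' : dotp v (row_mx u u') = dotp (lsubmx v) u + dotp (rsubmx v) u'.
  by rewrite -[v in LHS]hsubmxK dotp_row_mx.
have d0 q (u : 'rV[R]_q) : dotp u 0 = 0 by rewrite -(scale0r 0) dotpZr mul0r.
exists (row_mx (- (lsubmx v 0 0))%:M (- rsubmx v) : 'rV_(1 + n)).
  apply/DP; split=> [|j]; last first.
    rewrite head tail [leRHS]mxE mulrN opprK.
    (* The rays [tau_j e_0 + r e_j], on which the last inequality of [K] is an equality, test the
       inequalities of [D]. *)
    have : dotp v (row_mx (tau (rshift k.+1 j) *: delta_mx 0 0) (r *: delta_mx 0 j)) <= 0.
      apply: Kv; apply: K_row => [i|]; first by rewrite !mxE mulr_ge0// ltW.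
      rewrite (bigD1 j)//= big1 ?addr0 => [|i ij].
        by rewrite !mxE !eqxx !mulr1 mulrC.
      by rewrite !mxE (negbTE ij) !mulr0.
    rewrite dv !dotpZr !(dotpC _ (delta_mx _ _)) !dotp_delta => h.
    rewrite -(ler_pM2l r_gt0) mulrN /alpha mulrA (mulrC r) divfK//.
    by rewrite -subr_le0 opprK.
  rewrite head oppr_ge0.
  have : dotp v (row_mx (delta_mx 0 0) 0) <= 0.
    apply: Kv; apply: K_row => [i|]; first by rewrite mxE.
    rewrite big1 => [|i _]; last by rewrite mxE mulr0.
    by rewrite mxE mulr1 ltW.
  by rewrite dv d0 addr0 dotpC dotp_delta.
rewrite mulS -[v in RHS]hsubmxK; congr row_mx.
  rewrite head opprK; apply/rowP => i.
  case: (unliftP ord0 i) => [j ->|->]; last by rewrite !mxE eqxx mulr1.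
  rewrite [LHS]mxE [X in _ * X]mxE /= mulr0 -dotp_delta dotpC.
  have Kj (c : R) : K (row_mx (c *: delta_mx 0 (lift ord0 j)) 0).
    apply: K_row => [l|]; first by rewrite mxE.
    rewrite big1 => [|l _]; last by rewrite mxE mulr0.
    by rewrite !mxE/= !mulr0.
  have := dotp_eq_polar Kv (Kj 1); rewrite opp_row_mx -scaleNr oppr0 => /(_ (Kj _)).
  by rewrite dv d0 addr0 scale1r.
by apply/rowP => j; rewrite [LHS]mxE [X in - X]mxE tail mxE opprK.
Qed.

Let sub_hull : [set z *m S | z in D] `<=` pos_hull dual_rays.
Proof.
move=> _ [z /DP[z0 zj] <-].
(* The head determines the coefficient of [w0]; the coefficients left for the other rays are
   nonnegative by the inequalities of [D]. *)
have -> : z *m S = (z 0 0 / r) *: w0 +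
    \sum_j (alpha j * z 0 0 + z 0 (lift ord0 j)) *: w (rshift k.+1 j).
  rewrite mulS; apply/rowP => i; rewrite [RHS]mxE summxE [X in _ = X + _]mxE.
  case: (split_ordP i) => l ->.
    rewrite big1 => [|j _]; last by rewrite !mxE eq_lrshift andbF oppr0 mulr0.
    by rewrite addr0 !row_mxEl [in RHS]mxE [LHS]mxE mulrA mulrN divfK.
  rewrite !row_mxEr (bigD1 l)//= big1 => [|j jl]; last first.
    by rewrite !mxE eq_rshift eq_sym (negbTE jl) andbF oppr0 mulr0.
  by rewrite !mxE !eqxx /alpha /=; ring.
apply: pos_hull_sum => [|j||j].
- by rewrite divr_ge0// ltW.
- by rewrite addrC -lerBlDr sub0r.
- by left.
- by right; exists (rshift k.+1 j) => //; exact: leq_addr.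
Qed.

Let hull_sub : pos_hull dual_rays `<=` polar K.
Proof.
apply: pos_hullP => [u _|c u v c0 hu hv z Kz|_ [->|[j kj <-]] z Kz].
- by rewrite -(scale0r 0) dotpZl mul0r.
- by rewrite dotpDl -[leRHS](addr0 0) lerD ?mulr_ge0_le0 ?hu ?hv.
- exact: (Kz None).
- move: kj; rewrite /above/=; case: (split_ordP j) => l -> /=; first by rewrite ltnNge -ltnS ltn_ord.
  by move=> _; exact: (Kz (Some l)).
Qed.

Let polarE : polar K = [set z *m S | z in D].
Proof.
apply/seteqP; split; first exact: polar_sub.
exact: subset_trans sub_hull hull_sub.
Qed.

Let polar_hull : polar K = pos_hull dual_rays.
Proof.
apply/seteqP; split; last exact: hull_sub.
exact: subset_trans polar_sub sub_hull.
Qed.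

(** * The tangent cone as an orthogonal sum *)

Let v0 : 'rV[R]_(k.+1 + n) := delta_mx 0 (lshift n 0).
Let v (j : 'I_(k.+1 + n)) : 'rV[R]_(k.+1 + n) := tau j *: v0 + r *: delta_mx 0 j.
Let rays := [set v0] `|` [set v j | j in above].

(** Blocks of an isometric embedding that moves the lineality directions to the front and leaves
    zeros in their place, because the generators must again be vectors of the full space. *)
Let Q0 : 'M[R]_(1, k + (1 + k + n)) := row_mx 0 (row_mx (row_mx 1%:M 0) 0).
Let Q1 : 'M[R]_(k, k + (1 + k + n)) := row_mx 1%:M 0.
Let Q2 : 'M[R]_(n, k + (1 + k + n)) := row_mx 0 (row_mx 0 1%:M).
(* (y_0, y', y'') |-> (y', (y_0, 0, y'')) *)
Let Q : 'M[R]_(1 + k + n, k + (1 + k + n)) := col_mx (col_mx Q0 Q1) Q2.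

Let QQ : Q *m Q^T = 1%:M.
Proof.
rewrite /Q !tr_col_mx !mul_col_row /Q0 /Q1 /Q2 !tr_row_mx !mul_row_col.
rewrite !(trmx0, trmx1, mul_col_mx, mul_mx_row, mul_row_col, mul0mx, mulmx0, mulmx1).
by rewrite !(add0r, addr0, row_mx0, col_mx0) !scalar_mx_block.
Qed.

Let mulQ (z0 : 'rV[R]_1) (y : 'rV[R]_k) (u : 'rV[R]_n) :
  row_mx (row_mx z0 y) u *m Q = row_mx y (row_mx (row_mx z0 0) u).
Proof.
rewrite /Q !mul_row_col /Q0 /Q1 /Q2 !mul_mx_row !(mulmx0, mulmx1) !add_row_mx.
by rewrite !(addr0, add0r, add_row_mx).
Qed.

Let head_block (z0 : 'rV[R]_1) (y : 'rV[R]_k) :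
  (row_mx z0 y : 'rV_k.+1) 0 0 = z0 0 0.
Proof.
have -> : 0 = lshift k 0 :> 'I_(1 + k) by exact: val_inj.
exact: row_mxEl.
Qed.

Let tail_block (z0 : 'rV[R]_1) (y : 'rV[R]_k) i :
  (row_mx z0 y : 'rV_k.+1) 0 (lift ord0 i) = y 0 i.
Proof. by rewrite -rshift1; exact: row_mxEr. Qed.

Let K_block (z0 : 'rV[R]_1) (y : 'rV[R]_k) (u : 'rV[R]_n) :
  K (row_mx (row_mx z0 y) u) <->
  (forall j, 0 <= u 0 j) /\ \sum_j tau (rshift k.+1 j) * u 0 j <= r * z0 0 0.
Proof.
have eu j : row_mx (row_mx z0 y) u 0 (rshift k.+1 j) = u 0 j by exact: row_mxEr.
have e0 : row_mx (row_mx z0 y) u 0 (lshift n 0) = z0 0 0.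
  by apply: etrans (row_mxEl _ _ _ _) _; exact: head_block.
rewrite KP e0 (eq_bigr (fun j => tau (rshift k.+1 j) * u 0 j)) => [|j _]; last by rewrite eu.
by split=> -[h ?]; split=> // j; have := h j; rewrite eu.
Qed.

Let sub_rays : [set z *m Q | z in K] `<=` orth_sum (setT : set 'rV[R]_k) (pos_hull rays).
Proof.
move=> _ [z Kz <-]; move: Kz; rewrite -[z]hsubmxK -[lsubmx z](@hsubmxK _ 1 1 k).
move: (lsubmx _) (rsubmx _) (rsubmx z) => z0 y u /K_block[u0 hu].
rewrite mulQ; exists y => //; exists (row_mx (row_mx z0 0) u) => //.
(* Each [u_j] fixes the coefficient of [v_j]; the last inequality of [K] says that the remaining
   coefficient of [v0] is nonnegative. *)
have -> : row_mx (row_mx z0 0) u =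
    (z0 0 0 - \sum_j u 0 j / r * tau (rshift k.+1 j)) *: v0 +
    \sum_j (u 0 j / r) *: v (rshift k.+1 j).
  apply/rowP => i; rewrite [RHS]mxE summxE [X in _ = X + _]mxE.
  case: (split_ordP i) => l ->.
    apply: etrans (row_mxEl _ _ _ _) _; case: (unliftP ord0 l) => [l' ->|->].
      rewrite tail_block mxE /v0 mxE eq_lshift /= mulr0 add0r big1// => j _.
      by rewrite !mxE eq_lrshift eq_lshift /= !mulr0 addr0 mulr0.
    rewrite head_block /v0 mxE !eqxx mulr1 -[LHS](subrK (\sum_j u 0 j / r * tau (rshift k.+1 j))).
    congr (_ + _); apply: eq_bigr => j _.
    by rewrite !mxE eq_lrshift eqxx /= mulr0 addr0 mulr1.
  apply: etrans (row_mxEr _ _ _ _) _.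
  rewrite /v0 mxE eq_rlshift andbF mulr0 add0r (bigD1 l)//= big1 ?addr0 => [|j jl].
    by rewrite !mxE eq_rlshift !eqxx /= mulr0 add0r mulr1 divfK.
  by rewrite !mxE eq_rlshift eq_rshift eq_sym (negbTE jl) /= !mulr0 addr0 mulr0.
apply: pos_hull_sum => [|j||j].
- rewrite subr_ge0 -(ler_pM2l r_gt0) mulr_sumr; apply: le_trans hu.
  by rewrite le_eqVlt; apply/orP; left; apply/eqP; apply: eq_bigr => j _; field.
- by rewrite divr_ge0// ltW.
- by left.
- by right; exists (rshift k.+1 j) => //; exact: leq_addr.
Qed.

Let rays_sub : orth_sum (setT : set 'rV[R]_k) (pos_hull rays) `<=` [set z *m Q | z in K].
Proof.
move=> _ [y _ [h Vh <-]].
(* Membership in [K] leaves the inner [k] coordinates free while [Q] puts zeros there, so their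
   vanishing is carried through the induction. *)
have {Vh} [Kh h0] : K h /\ forall i, h 0 (lshift n (lift ord0 i)) = 0.
  move: h Vh; apply: pos_hullP => [|c u1 u2 c0 [K1 h1] [K2 h2]|_ [->|[j kj <-]]].
  - split=> [q|i]; last by rewrite mxE.
    by rewrite -(scale0r 0) dotpZr mul0r.
  - split=> [q|i]; last by rewrite !mxE h1 h2 mulr0 addr0.
    by rewrite dotpDr -[leRHS](addr0 0) lerD ?mulr_ge0_le0 ?K1 ?K2.
  - split=> [|i]; last by rewrite mxE eq_lshift.
    apply/KP; split=> [j|]; first by rewrite mxE.
    rewrite big1 => [|j _]; last by rewrite mxE eq_rlshift andbF mulr0.
    by rewrite mxE !eqxx mulr1 ltW.
  - move: kj; rewrite /above/=; case: (split_ordP j) => l -> /=.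
      by rewrite ltnNge -ltnS ltn_ord.
    move=> _; split=> [|i]; last first.
      by rewrite !mxE eq_lshift eq_lrshift /= !mulr0 addr0.
    apply/KP; split=> [i|].
      rewrite !mxE eq_rlshift eq_rshift /= mulr0 add0r mulr_ge0 ?ler0n// ltW//.
    rewrite (bigD1 l)//= big1 ?addr0 => [|i il].
      by rewrite !mxE eq_rlshift eq_lrshift !eqxx /= !mulr0 add0r addr0 !mulr1 mulrC.
    by rewrite !mxE eq_rlshift eq_rshift (negbTE il) /= !mulr0 addr0 mulr0.
move: Kh h0; rewrite -[h]hsubmxK -[lsubmx h](@hsubmxK _ 1 1 k).
move: (lsubmx _) (rsubmx _) (rsubmx h) => z0 y' u /K_block Kh h0.
have -> : y' = 0.
  apply/rowP => i; rewrite mxE -(h0 i) row_mxEl; exact/esym/tail_block.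
by exists (row_mx (row_mx z0 y) u); [apply/K_block|rewrite mulQ].
Qed.

Lemma dotp_w0_w0 : dotp w0 w0 = kappa + \sum_i tau i ^+ 2.
Proof.
rewrite dotp_row_mx dotpZl dotpZr dotp_delta mxE eqxx mulr1 mulrNN -expr2 sqr_r /s -addrA.
congr (_ + _); rewrite [in RHS]big_split_ord/= big_mkcond big_split_ord/=.
rewrite [X in _ + X + _]big1 ?addr0 => [|i _]; last by rewrite leqNgt ltn_addr ?ltnS.
congr (_ + _); first by apply: eq_bigr => i _; rewrite -ltnS ltn_ord.
by apply: eq_bigr => i _; rewrite !mxE expr2.
Qed.

Lemma facet_normal_isometric :
  exists (w0 : 'rV[R]_(k.+1 + n)) (w : 'I_(k.+1 + n) -> 'rV[R]_(k.+1 + n)),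
  [/\ dotp w0 w0 = kappa + \sum_i tau i ^+ 2,
      forall j : 'I_(k.+1 + n), (k < j)%N -> dotp w0 (w j) = - tau j,
      forall i j : 'I_(k.+1 + n), (k < i)%N -> (k < j)%N -> dotp (w i) (w j) = (i == j)%:R
    & cone_isometric g (normal_cone kappa a b x G)
        dotp (pos_hull ([set w0] `|` [set w j | j in [set j : 'I_(k.+1 + n) | (k < j)%N]]))].
Proof.
have [B oB TE] := basis.
exists w0, w; split.
- exact: dotp_w0_w0.
- move=> j; case: (split_ordP j) => l -> /=; first by rewrite ltnNge -ltnS ltn_ord.
  by rewrite dotpC dotpNl dotp_delta row_mxEr !mxE.
- by move=> i j _ _; rewrite dotpNl dotp_delta [X in - X]mxE opprK mxE eqxx eq_sym.
- rewrite /normal_cone TE (polar_coords gDl gC oB) polar_hull.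
  rewrite -[X in cone_isometric _ _ _ X](_ : [set z *m 1%:M | z in pos_hull dual_rays] = _).
    by apply: cone_isometric_basis => //; rewrite trmx1 mulmx1.
  apply/seteqP; split=> [_ [u Ku <-]|u Ku]; first by rewrite mulmx1.
  by exists u; rewrite ?mulmx1.
Qed.

Lemma facet_tangent_isometric :
  exists (v0 : 'rV[R]_(k.+1 + n)) (v : 'I_(k.+1 + n) -> 'rV[R]_(k.+1 + n)),
  [/\ dotp v0 v0 = 1,
      forall j : 'I_(k.+1 + n), (k < j)%N -> dotp v0 (v j) = tau j,
      forall i j : 'I_(k.+1 + n), (k < i)%N -> (k < j)%N ->
        dotp (v i) (v j) = tau i * tau j + (i == j)%:R * s
    & cone_isometric g (tangent_cone a b G)
        dotp (orth_sum (setT : set 'rV[R]_k)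
          (pos_hull ([set v0] `|` [set v j | j in [set j : 'I_(k.+1 + n) | (k < j)%N]])))].
Proof.
have [B oB TE] := basis.
have v0E (j : 'I_(k.+1 + n)) : (k < j)%N -> v0 0 j = 0.
  case: (split_ordP j) => l ->; first by rewrite /= ltnNge -ltnS ltn_ord.
  by rewrite mxE eq_rlshift andbF.
have v00 : dotp v0 v0 = 1 by rewrite dotp_delta mxE !eqxx.
exists v0, v; split=> //.
- by move=> j kj; rewrite dotpDr v00 dotpZr dotpC dotp_delta v0E// mulr0 addr0 mulr1.
- move=> i j ki kj; rewrite dotpDl !dotpDr !dotpZl !dotpZr v00 (dotpC v0) !dotp_delta.
  by rewrite !v0E// [delta_mx _ _ _ _]mxE eqxx -sqr_r eq_sym /=; ring.
- rewrite TE -/above -/rays.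
  rewrite -[X in cone_isometric _ _ _ X](_ : [set z *m Q | z in K] = _).
    exact: cone_isometric_basis.
  by apply/seteqP; split; [exact: sub_rays|exact: rays_sub].
Qed.

Lemma facet_normal_angle :
  ((solid_angle g (normal_cone kappa a b x G))%:E =
   (1 / Num.sqrt (2 * pi))%R%:E *
   \int[lebesgue_measure]_(y in `[0%R, +oo[)
     (complex.Re (\prod_(j < k.+1 + n | (k < j)%N) Phi (tau j / Num.sqrt s * y)%:C%C)
      * expR (- (y ^+ 2) / 2))%R%:E)%E.
Proof.
have [B oB TE] := basis.
rewrite /normal_cone TE (polar_coords gDl gC oB) polarE.
have oS := orthonormal_mul gDl gC oB SS.
have -> : [set z *m B | z in [set z *m S | z in D]] = [set z *m (S *m B) | z in D].
  apply/seteqP; split=> [_ [_ [z Dz <-] <-]|_ [z Dz <-]]; first by exists z; rewrite ?mulmxA.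
  by exists (z *m S); rewrite ?mulmxA//; exists z.
rewrite (@solid_angle_basis _ _ _ gDl gC _ _ oS _ _ (dual_wedge alpha)).
- rewrite gauss_dual_wedge muleA -EFinM; congr (_%:E * _)%E.
    by rewrite exprS invfM -mulrA mulVf ?mulr1 ?div1r// expf_neq0// gt_eqF// s2pi_gt0.
  apply: eq_integral => y _; congr (_ * _)%:E.
  rewrite (big_rshift _ (fun j => Phi (tau j / Num.sqrt s * y)%:C%C)).
  under [in RHS]eq_bigr do rewrite Phi_gerf.
  by rewrite -rmorph_prod.
- apply: (lin_hull_setT (w := 0)) => [|i].
    by apply/DP; rewrite mxE; split=> // j; rewrite !mxE mulr0 oppr0.
  apply/DP; rewrite add0r mxE; split=> [|j]; first by rewrite ler0n.
  rewrite !mxE; apply: le_trans (ler0n _ _).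
  by rewrite oppr_le0 mulr_ge0 ?ler0n.
- apply/seteqP; split=> c /=.
    by move=> [h1 h2]; apply/DP; rewrite mxE; split=> // j; have := h2 j; rewrite mxE.
  by move=> /DP; rewrite mxE => -[h1 h2]; split=> // j; have := h2 j; rewrite mxE.
Qed.

Lemma facet_tangent_angle :
  ((solid_angle g (tangent_cone a b G))%:E =
   (1 / 2 ^+ n.+1)%R%:E +
   (1 / pi)%R%:E *
   \int[lebesgue_measure]_(y in `]0%R, +oo[)
     (expR (- ((kappa + \sum_i tau i ^+ 2) * y ^+ 2) / 2) / y
      * complex.Im (\prod_(j < k.+1 + n | (k < j)%N) Phi (- 'i * (tau j * y)%:C)%C))%R%:E)%E.
Proof.
have [B oB ->] := basis.
(* The head of the tuple is [y_0]; of the other [k + n] coordinates the first [k] are free. *)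
pose J := [pred j : 'I_(k + n) | (k <= j)%N].
pose tJ (j : 'I_(k + n)) := if J j then tau (lift ord0 j) else 0.
have lr j : lift ord0 (rshift k j) = rshift k.+1 j :> 'I_(k.+1 + n) by exact: val_inj.
have tJr j : tJ (rshift k j) = tau (rshift k.+1 j).
  by rewrite /tJ /J /= leq_addr; congr tau; exact: lr.
rewrite (@solid_angle_basis _ _ _ gDl gC _ _ oB _ _ (wedge J tJ s)).
- rewrite gauss_wedge//; last by move=> j /negbTE Jj; rewrite /tJ Jj.
  rewrite muleA -EFinM mulVf ?mul1e; last first.
    by rewrite expf_neq0// gt_eqF// s2pi_gt0.
  rewrite card_rshift; congr (_ + _ * _)%E; apply: eq_integral => y _; congr EFin.
  have -> : s + \sum_(j < k + n | J j) tJ j ^+ 2 = kappa + \sum_i tau i ^+ 2.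
    rewrite -dotp_w0_w0 dotp_row_mx dotpZl dotpZr dotp_delta mxE eqxx mulr1 mulrNN.
    rewrite -expr2 sqr_r; congr (_ + _); rewrite (big_rshift _ (fun j => tJ j ^+ 2)).
    by apply: eq_bigr => j _; rewrite tJr !mxE expr2.
  congr (_ * complex.Im _).
  rewrite (big_rshift _ (fun j => Phi (- 'i * (tJ j * y)%:C)%C)).
  rewrite (big_rshift _ (fun j => Phi (- 'i * (tau j * y)%:C)%C)).
  by apply: eq_bigr => j _; rewrite tJr.
(* [r c] is the sum of the [tau_j], enough for [c v0 + e_i] to stay in [K] for every [i]. *)
- pose c := \sum_j tau (rshift k.+1 j) / r.
  have c0 : 0 <= c by apply: sumr_ge0 => j _; exact: alpha_ge0.
  have dr i : \sum_j tau (rshift k.+1 j) * (i == rshift k.+1 j)%:R <= r * c.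
    rewrite mulr_sumr; apply: ler_sum => j _; rewrite mulrCA mulfV// mulr1.
    by case: (_ == _); rewrite ?mulr1 ?mulr0// ltW.
  apply: (lin_hull_setT (w := c *: v0)) => [|i]; apply/KP; split=> [j|].
  + by rewrite !mxE eq_rlshift andbF mulr0.
  + rewrite big1 => [|j _]; last by rewrite !mxE eq_rlshift andbF !mulr0.
    by rewrite !mxE !eqxx mulr1 mulr_ge0// ltW.
  + by rewrite !mxE eq_rlshift andbF mulr0 add0r ler0n.
  + rewrite [X in _ <= r * X]mxE mulrDr.
    apply: (@le_trans _ _ (r * (c *: v0) 0 (lshift n 0))); last first.
      by rewrite lerDl mulr_ge0 ?mxE ?ler0n// ltW.
    rewrite [X in _ <= r * X]mxE [X in _ * (_ * X)]mxE !eqxx mulr1.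
    apply: le_trans (dr i); apply: ler_sum => j _.
    by rewrite !mxE eq_rlshift andbF mulr0 add0r eq_sym.
- have sumE (z : (k.+1 + n).-tuple R) : \sum_j tJ j * tnth z (lift ord0 j) =
      \sum_j tau (rshift k.+1 j) * trow z 0 (rshift k.+1 j).
    rewrite (bigID J)/= [X in _ + X]big1 ?addr0 => [|j].
      rewrite (big_rshift _ (fun j => tJ j * tnth z (lift ord0 j))).
      by apply: eq_bigr => j _; rewrite tJr lr mxE.
    by rewrite /tJ /J /= => /negbTE ->; rewrite mul0r.
  have headE (z : (k.+1 + n).-tuple R) : trow z 0 (lshift n 0) = tnth z ord0.
    by rewrite mxE; congr tnth; exact: val_inj.
  apply/seteqP; split=> z /=.
    move=> [h1]; rewrite sumE => h2; apply/KP; split=> [j|]; last by rewrite headE.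
    by have := h1 (rshift k j); rewrite lr mxE; apply; exact: leq_addr.
  move=> /KP[h1 h2]; split=> [j|]; last by rewrite sumE -headE.
  case: (split_ordP j) => l -> /=; first by rewrite leqNgt ltn_ord.
  by move=> _; have := h1 l; rewrite mxE lr.
Qed.

End facet_cones.

Local Open Scope complex_scope.

Theorem theorem6p1 (R : realType) (d : nat) (hd : (2 <= d)%N)
    (tau : 'I_d -> R) (htau : forall i, 0 < tau i)
    (kappa : R) (hkappa : forall i, - (tau i ^+ 2) <= kappa) :
  let P := conv_hull ([set 0] `|` range (vertex tau)) in
  P `<=` closure (klein_ball kappa) /\
  forall (m : nat) (a : 'I_m -> 'rV[R]_d) (b : 'I_m -> R),
    irredundant_hrep a b P ->
    forall k : 'I_d,
    (let F := conv_hull ([set 0] `|` [set vertex tau i | i in [set i : 'I_d | (i < k)%N]]) in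
     forall x : 'rV[R]_d, relint F x -> klein_ball kappa x ->
     let g := klein_form kappa x in
     let N := normal_cone kappa a b x F in
     let T := tangent_cone a b F in
     [/\ cone_isometric g N dotp (orthant (d - k)%N),
         solid_angle g N = 1 / 2 ^+ (d - k)%N,
         cone_isometric g T
           dotp (orth_sum (setT : set 'rV[R]_k) (orthant (d - k)%N))
       & solid_angle g T = 1 / 2 ^+ (d - k)%N]) /\
    (let G := conv_hull [set vertex tau i | i in [set i : 'I_d | (i <= k)%N]] in
     forall x : 'rV[R]_d, relint G x -> klein_ball kappa x ->
     let g := klein_form kappa x in
     let N := normal_cone kappa a b x G in
     let T := tangent_cone a b G in
     let s_k := kappa + \sum_(i < d | (i <= k)%N) tau i ^+ 2 in
     let s_d := kappa + \sum_(i < d) tau i ^+ 2 in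
     [/\ exists (w0 : 'rV[R]_d) (w : 'I_d -> 'rV[R]_d),
           [/\ dotp w0 w0 = s_d,
               forall j : 'I_d, (k < j)%N -> dotp w0 (w j) = - tau j,
               forall i j : 'I_d, (k < i)%N -> (k < j)%N ->
                 dotp (w i) (w j) = (i == j)%:R
             & cone_isometric g N
                 dotp (pos_hull ([set w0] `|` [set w j | j in [set j : 'I_d | (k < j)%N]]))],
         ((solid_angle g N)%:E =
            (1 / Num.sqrt (2 * pi))%R%:E *
            \int[lebesgue_measure]_(y in `[0%R, +oo[)
              (complex.Re (\prod_(j < d | (k < j)%N)
                 Phi (tau j / Num.sqrt s_k * y)%:C)
               * expR (- (y ^+ 2) / 2))%R%:E)%E,
         exists (v0 : 'rV[R]_d) (v : 'I_d -> 'rV[R]_d),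
           [/\ dotp v0 v0 = 1,
               forall j : 'I_d, (k < j)%N -> dotp v0 (v j) = tau j,
               forall i j : 'I_d, (k < i)%N -> (k < j)%N ->
                 dotp (v i) (v j) = tau i * tau j + (i == j)%:R * s_k
             & cone_isometric g T
                 dotp (orth_sum (setT : set 'rV[R]_k)
                   (pos_hull ([set v0] `|` [set v j | j in [set j : 'I_d | (k < j)%N]])))]
       & ((solid_angle g T)%:E =
            (1 / 2 ^+ (d - k)%N)%R%:E +
            (1 / pi)%R%:E *
            \int[lebesgue_measure]_(y in `]0%R, +oo[)
              (expR (- (s_d * y ^+ 2) / 2) / y
               * complex.Im (\prod_(j < d | (k < j)%N)
                   Phi (- 'i * (tau j * y)%:C)))%R%:E)%E]).
Proof.
move=> P; split; first exact: simplex_sub_closure.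
move=> m a b [_ PE _] [k kd]; rewrite {}/P in PE; split=> /= x rx xB.
  (* The dimension is rewritten as [k + n] here and as [k.+1 + n] for G, to split the indices at the
     face; in the second case [d - k] is [n.+1]. *)
  have := subnKC (ltnW kd); move: (d - k)%N => n dE.
  by subst d; exact: face_through_0_cones rx.
rewrite -(subnSK kd); have := subnKC kd; move: (d - k.+1)%N => n dE; subst d.
split.
- exact: facet_normal_isometric rx.
- exact: facet_normal_angle rx.
- exact: facet_tangent_isometric rx.
- exact: facet_tangent_angle rx.
Qed.
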